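(* Let $\{X_i\}_{i\in\mathbb{Z}}$ be a stationary Gaussian time series with mean $\mu$ and autocovariance function $\gamma_X$, satisfying $\sigma^2:=\sum_{h=-\infty}^{+\infty}\gamma_X(h)>0$ and $\sum_{h=-\infty}^{+\infty}h^2|\gamma_X(h)|<\infty$. Let $K\ge 2$ be a fixed integer, and suppose that the $K$ groups have equal sizes, $|\mathcal{M}_1|=|\mathcal{M}_2|=\cdots=|\mathcal{M}_K|$. Then under the null hypothesis $H_0:\mu=\mu_0$, as the sample size $T\to\infty$, $$\sup_{x\in[0,+\infty)}\bigl|P(|T_K|\le x)-\Psi(x;K)\bigr|=O(1/T^2),$$ where $$\Psi(x;K)=P(|t_{K-1}|\le x)-\frac{B}{2\sigma^2T}\Upsilon(x;K),\qquad B=\sum_{h=-\infty}^{+\infty}|h|\gamma_X(h),$$ $$\Upsilon(x;K)=-K^2P(|t_{K-1}|\le x)+(K+1)E\left[\chi^2_{K-1}G_1\left(\frac{\chi^2_{K-1}x^2}{K-1}\right)\right]-E\left[\chi^2_1G_{K-1}\left(\frac{(K-1)\chi^2_1}{x^2}\right)\right]+1.$$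
   Context: Given observations $X_1,\dots,X_T$, the $j$th group of indices is $\mathcal{M}_j=\{s\in\mathbb{Z}:(j-1)T/K<s\le jT/K\}$, $j=1,\dots,K$, and $|\mathcal{M}_j|$ is its cardinality. The group means are $\hat\mu_k=\frac{1}{|\mathcal{M}_k|}\sum_{i\in\mathcal{M}_k}X_i$; put $\bar\mu_n=\frac1K\sum_{i=1}^K\hat\mu_i$ and $S_n^2=\frac{1}{K-1}\sum_{i=1}^K(\hat\mu_i-\bar\mu_n)^2$. The subsampling-based $t$-statistic is $T_K=\sqrt{K}(\bar\mu_n-\mu_0)/S_n$. $\gamma_X(h)=E[(X_i-\mu)(X_{i+h}-\mu)]$. $t_k$ denotes a random variable with the $t$ distribution with $k$ degrees of freedom, $\chi^2_k$ a random variable with the $\chi^2$ distribution with $k$ degrees of freedom, and $G_k$ the distribution function of $\chi^2_k$. At $x=0$, $G_{K-1}((K-1)\chi_1^2/x^2)$ is read as $G_{K-1}(+\infty)=1$. (Equal group sizes mean that $T$ is a multiple of $K$, and $T\to\infty$ along such values.) *)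

(* Defs.v *)
From HB Require Import structures.
From mathcomp Require Import all_boot all_order all_algebra finmap.
From mathcomp Require Import all_classical all_reals all_analysis.
From mathcomp Require Import measurable_realfun.

Set Implicit Arguments.
Unset Strict Implicit.
Unset Printing Implicit Defensive.

Import Order.TTheory GRing.Theory Num.Theory.
Import numFieldNormedType.Exports.

Local Open Scope classical_set_scope.
Local Open Scope ring_scope.

Section measurable_maps.
Context {R : realType}.

Definition tcons (n : nat) (p : R * n.-tuple R) : n.+1.-tuple R :=
  [the n.+1.-tuple R of p.1 :: p.2].

Lemma measurable_tcons n : measurable_fun setT (@tcons n).
Proof. by apply: measurable_cons; [exact: measurable_fst|exact: measurable_snd]. Qed.

HB.instance Definition _ n :=
  isMeasurableFun.Build _ _ _ _ (@tcons n) (@measurable_tcons n).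

Definition sum_sqr (n : nat) (z : n.-tuple R) : R :=
  \sum_(i < n) tnth z i ^+ 2.

Lemma measurable_sum_sqr n : measurable_fun setT (@sum_sqr n).
Proof.
apply: measurable_sum => i.
by apply: measurable_funX; exact: measurable_tnth.
Qed.

HB.instance Definition _ n :=
  isMeasurableFun.Build _ _ _ _ (@sum_sqr n) (@measurable_sum_sqr n).

Definition student_ratio (k : nat) (p : R * R) : R :=
  p.1 / Num.sqrt (p.2 / k%:R).

Lemma measurable_student_ratio k : measurable_fun setT (student_ratio k).
Proof.
rewrite (_ : student_ratio k =
  fun p => p.1 * (Num.sqrt (p.2 * k%:R^-1) `^ (-1))); last first.
  by apply/funext => p; rewrite powR_inv1 ?sqrtr_ge0.
apply: measurable_funM; first exact: measurable_fst.
apply: (measurableT_comp (measurable_powR _)).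
apply: (measurableT_comp (continuous_measurable_fun (@sqrt_continuous R))).
by apply: measurable_funM; [exact: measurable_snd|exact: measurable_cst].
Qed.

HB.instance Definition _ k :=
  isMeasurableFun.Build _ _ _ _ (student_ratio k) (@measurable_student_ratio k).

End measurable_maps.

Section distributions.
Context {R : realType}.

(* normal_prob lives on measurableTypeR R, which has the same measurable sets
   as R but another display; idTR carries it over to R. *)
Definition idTR : measurableTypeR R -> R := idfun.

Lemma measurable_idTR : measurable_fun setT idTR.
Proof. by move=> _ A mA; rewrite setTI. Qed.

HB.instance Definition _ :=
  isMeasurableFun.Build _ _ _ _ idTR measurable_idTR.

Definition normal01 : probability R R :=
  distribution (normal_prob (0 : R) 1) idTR.

(* law of n independent N(0, 1) variables *)
Fixpoint std_normal (n : nat) : probability (n.-tuple R) R :=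
  match n with
  | 0 => dirac [tuple]
  | n'.+1 => distribution (normal01 \x std_normal n')%E (@tcons R n')
  end.

Definition chi2 (k : nat) : probability R R :=
  distribution (std_normal k) (@sum_sqr R k).

(* law of Z / sqrt (V / k), with Z ~ N(0, 1) and V ~ chi2 k independent *)
Definition student (k : nat) : probability R R :=
  distribution (normal01 \x chi2 k)%E (@student_ratio R k).

(* The argument is extended so that G k +oo = 1. *)
Definition chi2_cdf (k : nat) (y : \bar R) : R :=
  fine (chi2 k [set v : R | (v%:E <= y)%E]).

End distributions.

Section time_series.
Context {R : realType} d (Omega : measurableType d) (P : probability Omega R).
Implicit Type X : int -> {RV P >-> R}.

Definition stationary_with X (mu : R) (gamma : int -> R) :=
  [/\ forall i, (X i : Omega -> R) \in Lfun P 2%:E,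
      forall i, 'E_P[X i]%E = mu%:E
    & forall i h : int,
        'E_P[fun w => ((X i w - mu) * (X (i + h)%R w - mu))%R]%E = (gamma h)%:E].

(* A random vector is Gaussian (possibly degenerate) when it is distributed as
   a + B Z, where the components of Z are independent N(0, 1). *)
Definition gaussian_series X :=
  forall (n : nat) (t : 'I_n -> int),
  exists (m : nat) (a : 'I_n -> R) (B : 'M[R]_(n, m)),
  forall A : set (n.-tuple R), measurable A ->
    P [set w | A [tuple X (t i) w | i < n]] =
    std_normal m
      [set z | A [tuple a i + \sum_(j < m) B i j * tnth z j | i < n]].

(* the group M_j, j = 1, ..., K (not indexed from 0) *)
Definition group (K T j : nat) : set int :=
  [set s : int | (j.-1%:R * T%:R / K%:R < s%:~R :> rat) /\
                 (s%:~R <= j%:R * T%:R / K%:R :> rat)].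

Definition group_size (K T j : nat) : nat := #|` fset_set (group K T j)|.

Definition equal_groups (K T : nat) :=
  forall i j : nat, (1 <= i <= K)%N -> (1 <= j <= K)%N ->
    group_size K T i = group_size K T j.

Definition group_mean X (K T j : nat) (w : Omega) : R :=
  (\sum_(s \in group K T j) X s w) / (group_size K T j)%:R.

Definition mean_bar X (K T : nat) (w : Omega) : R :=
  K%:R^-1 * \sum_(1 <= j < K.+1) group_mean X K T j w.

Definition S2 X (K T : nat) (w : Omega) : R :=
  (K.-1)%:R^-1 *
  \sum_(1 <= j < K.+1) (group_mean X K T j w - mean_bar X K T w) ^+ 2.

Definition t_stat X (mu0 : R) (K T : nat) (w : Omega) : R :=
  Num.sqrt K%:R * (mean_bar X K T w - mu0) / Num.sqrt (S2 X K T w).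

End time_series.

Section expansion.
Context {R : realType}.

Definition zsum (f : int -> R) : R :=
  f 0 + limn (series (fun k : nat => f k.+1%:Z + f (- k.+1%:Z))).

Definition Upsilon (K : nat) (x : R) : R :=
  - K%:R ^+ 2 * fine (student K.-1 [set t : R | `|t| <= x])
  + K.+1%:R * fine 'E_(chi2 K.-1)
      [fun v : R => (v * chi2_cdf 1 (v * x ^+ 2 / (K.-1)%:R)%:E)%R]%E
  - fine 'E_(chi2 1)
      [fun v : R => (v * chi2_cdf K.-1
         (if x == 0 then +oo%E else ((K.-1)%:R * v / x ^+ 2)%:E))%R]%E
  + 1.

Definition Psi (sigma2 B : R) (K T : nat) (x : R) : R :=
  fine (student K.-1 [set t : R | `|t| <= x])
  - B / (2 * sigma2 * T%:R) * Upsilon K x.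

End expansion.

(* Main.v *)
(**
  Let Z be standard Gaussian. If S = B B^T is invertible, the law of B Z has
  density proportional to exp((|y|^2 - y^T S^-1 y) / 2) with respect to the
  standard Gaussian law; the normalising constant is known because the total
  mass is 1, so no determinant is needed. Taking S = 1 + E and expanding the
  exponential in numerator and denominator gives, uniformly over measurable A,

    P(B Z in A) = P(Z in A)
                  + (E[Z^T E Z; Z in A] - tr(E) P(Z in A)) / 2 + O(|E|^2).

  The event |T_K| <= x depends only on the K block sums, and is invariant under
  scaling, so these may be normalised by their asymptotic standard deviation.
  Writing T = b K, the variance of n consecutive observations is
  n sigma^2 - B + O(1/n), so that its second differences give

    E = B / (sigma^2 b) (M / 2 - 1) + O(1/b^2),

  where M is the adjacency matrix of the path on K vertices. Since the event is
  invariant under permutations of the coordinates, the first-order term involves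
  only the second moments of the coordinate mean and of the squared deviation
  on it, and a Householder reflection makes these two independent, with
  chi-square laws of 1 and K - 1 degrees of freedom: this is Upsilon.
*)
Require Import Defs.
From HB Require Import structures.
From mathcomp Require Import all_boot all_order all_algebra perm finmap.
From mathcomp Require Import all_classical all_reals all_analysis.
From mathcomp Require Import measurable_realfun ring lra zify.

Set Implicit Arguments.
Unset Strict Implicit.
Unset Printing Implicit Defensive.

Import Order.TTheory GRing.Theory Num.Theory.
Import numFieldNormedType.Exports.

Local Open Scope classical_set_scope.
Local Open Scope ring_scope.

(* The law of B Z is needed for a rectangular B about which only B B^T is controlled. The change of
   variables is therefore built from dimension one alone: shears and one-coordinate scalings
   generate the invertible matrices, and a rectangular B is completed to an invertible square matrix
   whose extra coordinates integrate to a constant. All densities are relative to the standard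
   Gaussian law. Total mass 1, applied to scalings of Z, also yields the dominating function
   exp(|y|^2 / 4) and the second moments.

   The rate 1/T^2 results from two second-order errors: the remainder of the Gaussian expansion is
   O(|E|^2) with |E| = O(1/b), and the covariance remainder O(1/b) is divided by sigma^2 b in the
   normalisation. Neither bound depends on the event, which gives uniformity in x.

   The term M / 2 in E is due to the variance of an empty sum being 0 and not -B. It enters the
   second difference only for adjacent blocks, where it leaves the covariance B / 2; for blocks
   further apart the contributions -B, 2B, -B cancel. *)
#[local] Opaque integral.

(** * Change of variables for Gaussian measures *)

Section one_dim.
Context {R : realType}.
Local Notation mu := (@lebesgue_measure R).
Local Notation push := measure_function_pushforward__canonical__measure_function_Measure.
Local Open Scope ereal_scope.

Lemma measurable_affine (a b : R) :
  measurable_fun setT (fun z : R => a * z + b)%R.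
Proof. by apply: measurable_funD => //; apply: measurable_funM. Qed.

(** Lebesgue measure is determined by its values on the intervals []x, y]], so these are computed
    for |a| times the image measure. For a < 0 the preimage is closed on the left and open on the
    right, which does not affect its length. *)
Lemma lebesgue_measure_affine (a b : R) (A : set (measurableTypeR R)) :
  (a != 0)%R -> measurable A ->
  mu [set x | A (a * x + b)%R] = (`|a|^-1)%:E * mu A.
Proof.
move=> a0 mA.
pose aff (z : measurableTypeR R) : measurableTypeR R := (a * z + b)%R.
have maff : measurable_fun setT aff by exact: measurable_affine.
have H : mu A = pushforward (mscale (NngNum (normr_ge0 a)) mu) aff A.
  apply: (@lebesgue_measure_unique R
    (push
       (mscale (NngNum (normr_ge0 a)) mu) maff)) => // _ [[x y] _ <-].
  rewrite [RHS](_ : _ = `|a|%:E * mu (aff @^-1` `]x, y]%classic))//.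
  have [a0'|a0'] := ltP 0%R a.
    have -> : aff @^-1` `]x, y]%classic = [set` `](x - b) / a, (y - b) / a]%R].
      apply/seteqP; split => z /=; rewrite !in_itv/= ltr_pdivrMr// ler_pdivlMr//;
        by rewrite ltrBlDr lerBrDr mulrC.
    rewrite !lebesgue_measure_itv/= !lte_fin ltr_pM2r ?invr_gt0// ltrD2r.
    case: ifPn => _; last by rewrite mule0.
    rewrite gtr0_norm// -!EFinD -EFinM; congr EFin.
    by field.
  have a0n : (a < 0)%R by rewrite lt_neqAle a0.
  have -> : aff @^-1` `]x, y]%classic = [set` `[(y - b) / a, (x - b) / a[%R].
    apply/seteqP; split => z /=; rewrite !in_itv/= ltr_ndivlMr// ler_ndivrMr//;
      by rewrite ltrBlDr lerBrDr mulrC andbC.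
  rewrite !lebesgue_measure_itv/= !lte_fin ltr_nM2r ?invr_lt0// ltrD2r.
  case: ifPn => _; last by rewrite mule0.
  rewrite ltr0_norm// -!EFinD -EFinM; congr EFin.
  by field.
rewrite H /pushforward /mscale/= muleA -EFinM mulVf ?normr_eq0// mul1e.
by congr (mu _).
Qed.

Lemma ge0_integral_affine (a b : R) (f : measurableTypeR R -> \bar R) :
  (a != 0)%R -> measurable_fun setT f -> (forall x, 0 <= f x) ->
  \int[mu]_x f (a * x + b)%R = (`|a|^-1)%:E * \int[mu]_x f x.
Proof.
move=> a0 mf f0.
pose aff (z : measurableTypeR R) : measurableTypeR R := (a * z + b)%R.
have maff : measurable_fun setT aff by exact: measurable_affine.
transitivity (\int[pushforward mu aff]_y f y).
  by rewrite ge0_integral_pushforward.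
have a1 : (0 <= `|a|^-1)%R by rewrite invr_ge0.
rewrite -(ge0_integral_mscale mu measurableT (NngNum a1))//.
apply: (eq_measure_integral _ (m1 := push mu maff)) => //= A mA _.
rewrite /pushforward.
by rewrite /mscale/= -(lebesgue_measure_affine b)//.
Qed.

(** The density is reached through the Radon-Nikodym derivative of [normal_prob], which agrees
    almost everywhere with [normal_pdf] because both have the same integral over every measurable
    set. *)
Lemma integral_normal01 (f : R -> \bar R) :
  measurable_fun setT f -> (forall x, 0 <= f x) ->
  \int[normal01]_x f x = \int[mu]_x (f x * (normal_pdf 0 1 x)%:E).
Proof.
move=> mf f0.
rewrite ge0_integral_distribution//=.
have ndom := @normal_prob_dominates R 0%R 1%R.
rewrite -(@Radon_Nikodym_SigmaFinite.change_of_variables _ _ _ _ _ ndom)//.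
apply: ae_eq_integral => //.
- apply: emeasurable_funM => //.
  exact: (measurable_int mu (Radon_Nikodym_SigmaFinite.f_integrable ndom)).
- apply: emeasurable_funM => //; apply/measurable_EFinP.
  exact: measurable_normal_pdf.
- apply: ae_eqe_mul2l => /=.
  apply: integral_ae_eq => //=.
  + exact: Radon_Nikodym_SigmaFinite.f_integrable.
  + by apply/measurable_EFinP; exact: measurable_normal_pdf.
  + move=> E _ mE.
    by rewrite -(Radon_Nikodym_SigmaFinite.f_integral ndom).
Qed.

(** The exponential is the ratio of the normal densities at the preimage (y - b) / a and at y. With
    the Gaussian law as reference measure on both sides, the formula can be iterated over the
    coordinates of [std_normal]. *)
Lemma integral_normal01_affine (a b : R) (f : R -> \bar R) :
  (a != 0)%R -> measurable_fun setT f -> (forall x, 0 <= f x) ->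
  \int[normal01]_x f (a * x + b)%R = (`|a|^-1)%:E *
  \int[normal01]_y (f y * (expR ((y ^+ 2 - ((y - b) / a) ^+ 2) / 2))%:E).
Proof.
move=> a0 mf f0.
rewrite !integral_normal01//; last 3 first.
- apply: emeasurable_funM => //; apply/measurable_EFinP.
  apply: measurableT_comp => //; apply: measurable_funM => //.
  apply: measurable_funB => //; apply: measurable_funX => //.
  by apply: measurable_funM => //; exact: measurable_funB.
- by move=> x; rewrite mule_ge0// lee_fin expR_ge0.
- exact: (measurableT_comp mf (measurable_affine a b)).
pose g x := f x * (expR ((x ^+ 2 - ((x - b) / a) ^+ 2) / 2))%:E * (normal_pdf 0 1 x)%:E.
rewrite -(@ge0_integral_affine a b g a0); first last.
- by move=> x; rewrite /g mule_ge0// ?lee_fin ?normal_pdf_ge0// mule_ge0// lee_fin expR_ge0.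
- apply: emeasurable_funM => //; last first.
    by apply/measurable_EFinP; exact: measurable_normal_pdf.
  apply: emeasurable_funM => //; apply/measurable_EFinP.
  apply: measurableT_comp => //; apply: measurable_funM => //.
  apply: measurable_funB => //; apply: measurable_funX => //.
  by apply: measurable_funM => //; exact: measurable_funB.
rewrite /g.
apply: eq_integral => x _; rewrite -muleA -EFinM; congr (_ * EFin _)%E.
rewrite normal_pdfE ?oner_eq0// /normal_fun mulrCA -expRD.
congr (_ * expR _)%R.
by field.
Qed.

Lemma integral_normal01_shift (b : R) (f : R -> \bar R) :
  measurable_fun setT f -> (forall x, 0 <= f x) ->
  \int[normal01]_x f (x + b)%R =
  \int[normal01]_y (f y * (expR ((y ^+ 2 - (y - b) ^+ 2) / 2))%:E).
Proof.
move=> mf f0; transitivity (\int[normal01]_x f (1 * x + b)%R).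
  by apply: eq_integral => x _; rewrite mul1r.
rewrite integral_normal01_affine ?oner_eq0// normr1 invr1 mul1e.
by apply: eq_integral => y _; rewrite mulr1.
Qed.

End one_dim.

(** * Densities of invertible linear images, built from shears and scalings *)

Section gauss_fubini.
Context {R : realType}.
Local Notation N := (@std_normal R).
Local Open Scope ereal_scope.

Lemma measurable_tcons_r n x : measurable_fun setT (fun y => @tcons R n (x, y)).
Proof. by apply: (measurableT_comp (@measurable_tcons R n)). Qed.

Lemma measurable_tcons_l n y : measurable_fun setT (fun x => @tcons R n (x, y)).
Proof. by apply: (measurableT_comp (@measurable_tcons R n)). Qed.

Lemma integral_std_normalS n (f : n.+1.-tuple R -> \bar R) :
  measurable_fun setT f -> (forall z, 0 <= f z) ->
  \int[N n.+1]_z f z = \int[normal01]_x \int[N n]_y f (tcons (x, y)).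
Proof.
move=> mf f0 /=; rewrite ge0_integral_distribution//.
rewrite fubini_tonelli1//;
  [exact: (measurableT_comp mf (@measurable_tcons R n))|by move=> p; exact: f0].
Qed.

Lemma integral_std_normalS_swap n (f : n.+1.-tuple R -> \bar R) :
  measurable_fun setT f -> (forall z, 0 <= f z) ->
  \int[N n.+1]_z f z = \int[N n]_y \int[normal01]_x f (tcons (x, y)).
Proof.
move=> mf f0; rewrite integral_std_normalS//.
rewrite (fubini_tonelli (fun p => f (tcons p)))//.
exact: (measurableT_comp mf (@measurable_tcons R n)).
Qed.

Lemma integral_std_normal0 (f : 0.-tuple R -> \bar R) :
  \int[N 0]_z f z = f [tuple].
Proof.
have -> : f = cst (f [tuple]) by apply/funext => z; rewrite (tuple0 z).
by rewrite integral_cst//= diracT mule1.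
Qed.



#[local] Opaque std_normal.

Lemma measurable_sum_sqr_comp d (T : measurableType d) n (f : T -> n.-tuple R) :
  measurable_fun setT f -> measurable_fun setT (fun x => sum_sqr (f x)).
Proof. exact: (measurableT_comp (@measurable_sum_sqr R n)). Qed.

Lemma sum_sqr_cons n x (y : n.-tuple R) :
  sum_sqr (tcons (x, y)) = (x ^+ 2 + sum_sqr y)%R.
Proof.
rewrite /sum_sqr big_ord_recl/= tnth0; congr (_ + _)%R.
by apply: eq_bigr => i _; rewrite tnthS.
Qed.

Definition act n m (A : 'M[R]_(n, m)) (z : m.-tuple R) : n.-tuple R :=
  [tuple \sum_(j < m) A i j * tnth z j | i < n]%R.

Lemma measurable_act n m (A : 'M[R]_(n, m)) : measurable_fun setT (act A).
Proof.
apply/measurable_fun_tnthP => i /=.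
rewrite (_ : _ \o _ = fun z => \sum_(j < m) A i j * tnth z j)%R; last first.
  by apply/funext => z /=; rewrite tnth_mktuple.
apply: measurable_sum => j.
by apply: measurable_funM => //; exact: measurable_tnth.
Qed.

Lemma act_mul n m p (A : 'M[R]_(n, m)) (B : 'M[R]_(m, p)) z :
  act (A *m B) z = act A (act B z).
Proof.
apply: eq_from_tnth => i; rewrite !tnth_mktuple.
under eq_bigr do rewrite mxE mulr_suml.
rewrite exchange_big/=; apply: eq_bigr => j _.
by rewrite tnth_mktuple mulr_sumr; apply: eq_bigr => k _; rewrite mulrA.
Qed.

Lemma act1 n (z : n.-tuple R) : act 1%:M z = z.
Proof.
apply: eq_from_tnth => i; rewrite !tnth_mktuple (bigD1 i)//= mxE eqxx mul1r.
by rewrite big1 ?addr0// => j ji; rewrite mxE eq_sym (negbTE ji) mul0r.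
Qed.

Definition tadd n (w y : n.-tuple R) : n.-tuple R :=
  [tuple tnth y i + tnth w i | i < n]%R.

Lemma measurable_tadd n (w : n.-tuple R) : measurable_fun setT (tadd w).
Proof.
apply/measurable_fun_tnthP => i /=.
rewrite (_ : _ \o _ = fun z => tnth z i + tnth w i)%R; last first.
  by apply/funext => z /=; rewrite tnth_mktuple.
by apply: measurable_funD => //; exact: measurable_tnth.
Qed.

Definition topp n (w : n.-tuple R) : n.-tuple R := [tuple - tnth w i | i < n]%R.

Lemma tadd_cons n a (w : n.-tuple R) x y :
  tadd (tcons (a, w)) (tcons (x, y)) = tcons ((x + a)%R, tadd w y).
Proof.
apply: eq_from_tnth => i; rewrite tnth_mktuple.
case: (unliftP ord0 i) => [j ->|->]; first by rewrite !tnthS tnth_mktuple.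
by rewrite !tnth0.
Qed.

Lemma topp_cons n a (w : n.-tuple R) :
  topp (tcons (a, w)) = tcons ((- a)%R, topp w).
Proof.
apply: eq_from_tnth => i; rewrite tnth_mktuple.
case: (unliftP ord0 i) => [j ->|->]; first by rewrite !tnthS tnth_mktuple.
by rewrite !tnth0.
Qed.

Lemma tcons_surj n (z : n.+1.-tuple R) : exists x y, z = tcons (x, y).
Proof. by exists (thead z), [tuple of behead z]; rewrite [LHS]tuple_eta. Qed.

(** Ratio of the standard Gaussian densities at [psi y] and at [y], where [psi] is the inverse of
    the map under study. The Jacobian is left out; it is absorbed by a constant. *)
Definition dens n (psi : n.-tuple R -> n.-tuple R) (y : n.-tuple R) : \bar R :=
  (expR ((sum_sqr y - sum_sqr (psi y)) / 2))%:E.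

Lemma dens_ge0 n (psi : n.-tuple R -> n.-tuple R) y : 0 <= dens psi y.
Proof. by rewrite lee_fin expR_ge0. Qed.

Lemma measurable_dens n (psi : n.-tuple R -> n.-tuple R) :
  measurable_fun setT psi -> measurable_fun setT (dens psi).
Proof.
move=> mpsi; apply/measurable_EFinP; apply: measurableT_comp => //.
apply: measurable_funM => //; apply: measurable_funB.
  exact: measurable_sum_sqr.
exact: measurable_sum_sqr_comp.
Qed.

(** The Cameron-Martin formula, by induction on the dimension: the induction hypothesis translates
    the tail, the one-dimensional formula translates the head, and the two exponentials multiply. *)
Lemma integral_tadd n (w : n.-tuple R) (f : n.-tuple R -> \bar R) :
  measurable_fun setT f -> (forall z, 0 <= f z) ->
  \int[N n]_z f (tadd w z) = \int[N n]_z (f z * dens (tadd (topp w)) z).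
Proof.
elim: n w f => [|n IH] w f mf f0.
  rewrite !integral_std_normal0 /dens.
  by rewrite !(tuple0 (tadd _ _)) subrr mul0r expR0 mule1.
have [a [v ->]] := tcons_surj w => {w}.
have mD : measurable_fun setT (fun z => f z * dens (tadd (topp (tcons (a, v)))) z).
  by apply: emeasurable_funM => //; apply: measurable_dens; exact: measurable_tadd.
have D0 z : 0 <= f z * dens (tadd (topp (tcons (a, v)))) z by rewrite mule_ge0// dens_ge0.
rewrite integral_std_normalS//; last first.
  exact: (measurableT_comp mf (measurable_tadd _)).
under eq_integral => x _.
  under eq_integral do rewrite tadd_cons.
  rewrite (IH v (fun y => f (tcons ((x + a)%R, y))))//; last first.
    exact: (measurableT_comp mf (measurable_tcons_r _)).
  over.
rewrite (integral_std_normalS mD D0).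
pose g x := \int[N n]_y (f (tcons (x, y)) * dens (tadd (topp v)) y).
have mfv : measurable_fun setT
    (fun p : R * n.-tuple R => f (tcons p) * dens (tadd (topp v)) p.2).
  apply: emeasurable_funM; first exact: (measurableT_comp mf (@measurable_tcons R n)).
  by apply: measurableT_comp => //; apply: measurable_dens; exact: measurable_tadd.
have g0 x : 0 <= g x by apply: integral_ge0 => y _; rewrite mule_ge0 ?dens_ge0.
have mg : measurable_fun setT g.
  apply: (measurable_fun_fubini_tonelli_F
    (fun p : R * n.-tuple R => f (tcons p) * dens (tadd (topp v)) p.2)) => //.
  by move=> p; rewrite mule_ge0// dens_ge0.
transitivity (\int[normal01]_x g (x + a)%R); first exact: eq_integral.
apply: (etrans (integral_normal01_shift a mg g0)).
apply: eq_integral => x _.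
have mgx : measurable_fun setT (fun y => f (tcons (x, y)) * dens (tadd (topp v)) y).
  apply: emeasurable_funM; first exact: (measurableT_comp mf (measurable_tcons_r _)).
  by apply: measurable_dens; exact: measurable_tadd.
apply: (etrans (esym (ge0_integralZr _ measurableT mgx _ _))).
- by move=> y _; rewrite mule_ge0// dens_ge0.
- by rewrite lee_fin expR_ge0.
apply: eq_integral => y _.
rewrite -muleA -EFinM -expRD /dens topp_cons tadd_cons !sum_sqr_cons.
by congr (_ * EFin (expR _)); field.
Qed.

(* The law of [act A Z] has density proportional to
   [exp ((|y|^2 - |A^-1 y|^2) / 2)] with respect to the law of [Z]; this form
   is stable under products of matrices. *)
Definition transports n (A B : 'M[R]_n) : Prop :=
  exists2 c : R, (0 < c)%R &
    forall f, measurable_fun setT f -> (forall z, 0 <= f z) ->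
    \int[N n]_z f (act A z) = c%:E * \int[N n]_z (f z * dens (act B) z).

Lemma transports_mul n (A B A' B' : 'M[R]_n) :
  A *m B = 1%:M -> transports A B -> transports A' B' ->
  transports (A *m A') (B' *m B).
Proof.
move=> AB [c c0 tA] [c' c'0 tA']; exists (c * c')%R; first exact: mulr_gt0.
move=> f mf f0.
have mdB := measurable_dens (measurable_act B).
have mdB' := measurable_dens (measurable_act B').
pose g z := f z * dens (act B') (act B z).
have mg : measurable_fun setT g.
  by apply: emeasurable_funM => //; exact: (measurableT_comp mdB' (measurable_act B)).
have g0 z : 0 <= g z by rewrite mule_ge0// dens_ge0.
transitivity (\int[N n]_z f (act A (act A' z))).
  by apply: eq_integral => z _; rewrite act_mul.
apply: (etrans (tA' (f \o act A) (measurableT_comp mf (measurable_act A)) _)).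
  by move=> z; exact: f0.
(* Since [B] inverts [A], the factor [dens (act B') z] is a function of [act A z], so that [tA]
   applies to the whole integrand. *)
transitivity (c'%:E * \int[N n]_z g (act A z)).
  apply: (congr1 (mule c'%:E)); apply: eq_integral => z _.
  by rewrite /g -act_mul (mulmx1C AB) act1.
rewrite (tA _ mg g0).
rewrite muleA -EFinM mulrC; apply: (congr1 (mule (c * c')%:E)).
apply: eq_integral => z _; rewrite /g /dens -muleA -EFinM -expRD act_mul.
by congr (_ * EFin (expR _)); field.
Qed.

Lemma tnth_tcons0 n x (y : n.-tuple R) (i : 'I_1) :
  tnth (tcons (x, y)) (lshift n i) = x.
Proof. by rewrite (_ : lshift n i = ord0)//; apply/val_inj; rewrite /= ord1. Qed.

Lemma tnth_tconsS n x (y : n.-tuple R) (i : 'I_n) :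
  tnth (tcons (x, y)) (rshift 1 i) = tnth y i.
Proof. by rewrite (_ : rshift 1 i = lift ord0 i) ?tnthS//; exact/val_inj. Qed.

Definition tuple1 (x : R) : 1.-tuple R := [tuple x].

Lemma act_block n a (u : 'rV[R]_n) (v : 'cV[R]_n) (S : 'M[R]_n) x y :
  act (block_mx a%:M u v S) (tcons (x, y)) =
  tcons ((a * x + tnth (act u y) ord0)%R, tadd (act v (tuple1 x)) (act S y)).
Proof.
apply: eq_from_tnth => i; rewrite tnth_mktuple big_split_ord/= big_ord1.
rewrite tnth_tcons0; under eq_bigr do rewrite tnth_tconsS.
case: (split_ordP (i : 'I_(1 + n))) => [k ->|k ->].
  rewrite tnth_tcons0 block_mxEul (ord1 k) mxE eqxx tnth_mktuple; congr (_ + _)%R.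
  by apply: eq_bigr => j _; rewrite block_mxEur.
rewrite tnth_tconsS block_mxEdl !tnth_mktuple big_ord1 addrC; congr (_ + _)%R.
by apply: eq_bigr => j _; rewrite block_mxEdr.
Qed.

Lemma tadd0 n (z : n.-tuple R) : tadd [tuple 0%R | i < n] z = z.
Proof. by apply: eq_from_tnth => i; rewrite !tnth_mktuple addr0. Qed.

Lemma act0 n m (z : m.-tuple R) : act (0 : 'M[R]_(n, m)) z = [tuple 0%R | i < n].
Proof.
apply: eq_from_tnth => i; rewrite !tnth_mktuple big1// => j _.
by rewrite mxE mul0r.
Qed.

Lemma act_opp n m (A : 'M[R]_(n, m)) (z : m.-tuple R) : act (- A) z = topp (act A z).
Proof.
apply: eq_from_tnth => i; rewrite !tnth_mktuple -sumrN.
by apply: eq_bigr => j _; rewrite mxE mulNr.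
Qed.

(** For a fixed tail [y] the first coordinate undergoes the affine map x -> a x + u y and the tail
    does not move; the first coordinate is therefore integrated innermost, by the one-dimensional
    formula. *)
Lemma transports_upper n a (u : 'rV[R]_n) : (a != 0)%R ->
  transports (block_mx a%:M u 0 1%:M)
             (block_mx a^-1%:M (- a^-1 *: u) 0 1%:M).
Proof.
move=> a0; exists `|a|^-1%R; first by rewrite invr_gt0 normr_gt0.
move=> f mf f0.
pose B : 'M[R]_(1 + n) := block_mx a^-1%:M (- a^-1 *: u) 0 1%:M.
pose A : 'M[R]_(1 + n) := block_mx a%:M u 0 1%:M.
have mfA := measurableT_comp mf (measurable_act A).
rewrite -/A -/B; have md := measurable_dens (measurable_act B).
rewrite (integral_std_normalS_swap (f := fun z => f (act A z)) mfA)//.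
rewrite (integral_std_normalS_swap (emeasurable_funM mf md)); last first.
  by move=> z; rewrite mule_ge0// dens_ge0.
pose h p := f (tcons p) * dens (act B) (tcons p).
have mh : measurable_fun setT h.
  by apply: (measurableT_comp (emeasurable_funM mf md) (@measurable_tcons R n)).
have h0 p : 0 <= h p by rewrite mule_ge0// dens_ge0.
have a1 : (0 <= `|a|^-1)%R by rewrite invr_ge0.
have mG := measurable_fun_fubini_tonelli_G (m1 := normal01) h mh h0.
apply: (etrans _ (ge0_integralZl_EFin (N n) measurableT _ mG a1)); last first.
  by move=> y _; apply: integral_ge0 => x _; exact: h0.
apply: eq_integral => y _.
pose b := tnth (act u y) ord0.
under eq_integral do rewrite /A act_block act0 tadd0 act1.
apply: (etrans (integral_normal01_affine b a0 (f := fun x => f (tcons (x, y)))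
  (measurableT_comp mf (measurable_tcons_l y)) (fun x => f0 _))).
apply: (congr1 (mule (`|a|^-1)%:E)); apply: eq_integral => x _; congr (_ * EFin (expR _)).
rewrite /B act_block act0 tadd0 act1 !sum_sqr_cons.
have -> : tnth (act (- a^-1 *: u) y) ord0 = (- (a^-1 * b))%R.
  rewrite /b !tnth_mktuple mulr_sumr -sumrN.
  by apply: eq_bigr => j _; rewrite mxE mulNr mulrA mulNr.
by field.
Qed.

(** For a fixed first coordinate x the tail is translated by x v, so this is the Cameron-Martin
    formula under the integral in x, with constant 1. *)
Lemma transports_lower n (v : 'cV[R]_n) :
  transports (block_mx 1%:M 0 v 1%:M) (block_mx 1%:M 0 (- v) 1%:M).
Proof.
exists 1%R => // f mf f0.
pose B : 'M[R]_(1 + n) := block_mx 1%:M 0 (- v) 1%:M.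
pose A : 'M[R]_(1 + n) := block_mx 1%:M 0 v 1%:M.
have mfA := measurableT_comp mf (measurable_act A).
rewrite -/A -/B; have md := measurable_dens (measurable_act B).
rewrite mul1e (integral_std_normalS (f := fun z => f (act A z)) mfA)//.
rewrite (integral_std_normalS (emeasurable_funM mf md)); last first.
  by move=> z; rewrite mule_ge0// dens_ge0.
apply: eq_integral => x _.
under eq_integral do rewrite /A act_block act0 tnth_mktuple addr0 mul1r act1.
apply: (etrans (integral_tadd _ (f := fun y => f (tcons (x, y)))
  (measurableT_comp mf (measurable_tcons_r x)) (fun y => f0 _))).
apply: eq_integral => y _; congr (_ * EFin (expR _)).
rewrite /B act_block act0 tnth_mktuple addr0 mul1r act1 !sum_sqr_cons act_opp.
by field.
Qed.

Lemma transports_diag n (S T : 'M[R]_n) : transports S T ->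
  transports (block_mx (1%:M : 'M[R]_1) 0 0 S) (block_mx (1%:M : 'M[R]_1) 0 0 T).
Proof.
move=> [c c0 tS]; exists c => // f mf f0.
pose B : 'M[R]_(1 + n) := block_mx 1%:M 0 0 T.
pose A : 'M[R]_(1 + n) := block_mx 1%:M 0 0 S.
have mfA := measurableT_comp mf (measurable_act A).
rewrite -/A -/B; have md := measurable_dens (measurable_act B).
rewrite (integral_std_normalS (f := fun z => f (act A z)) mfA)//.
rewrite (integral_std_normalS (emeasurable_funM mf md)); last first.
  by move=> z; rewrite mule_ge0// dens_ge0.
pose h p := f (tcons p) * dens (act B) (tcons p).
have mh : measurable_fun setT h.
  by apply: (measurableT_comp (emeasurable_funM mf md) (@measurable_tcons R n)).
have h0 p : 0 <= h p by rewrite mule_ge0// dens_ge0.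
have mF := measurable_fun_fubini_tonelli_F (m2 := N n) h mh h0.
apply: (etrans _ (ge0_integralZl_EFin normal01 measurableT _ mF (ltW c0))); last first.
  by move=> x _; apply: integral_ge0 => y _; exact: h0.
apply: eq_integral => x _.
under eq_integral do rewrite /A act_block !act0 tnth_mktuple tadd0 addr0 mul1r.
apply: (etrans (tS (fun y => f (tcons (x, y)))
  (measurableT_comp mf (measurable_tcons_r x)) (fun y => f0 _))).
apply: (congr1 (mule c%:E)); apply: eq_integral => y _; congr (_ * EFin (expR _)).
rewrite /B act_block !act0 tnth_mktuple tadd0 addr0 mul1r !sum_sqr_cons.
by field.
Qed.

End gauss_fubini.

Section transportable.
Context {R : realType}.
Local Notation N := (@std_normal R).

#[local] Opaque std_normal.

Definition transportable n (A : 'M[R]_n) : Prop :=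
  exists2 B, A *m B = 1%:M & transports A B.

Lemma transportable_mul n (A A' : 'M[R]_n) :
  transportable A -> transportable A' -> transportable (A *m A').
Proof.
move=> [B AB tA] [B' AB' tA']; exists (B' *m B); last exact: transports_mul.
by rewrite mulmxA -(mulmxA A) AB' mulmx1.
Qed.

Lemma transportable_upper n a (u : 'rV[R]_n) : (a != 0)%R ->
  transportable (block_mx a%:M u 0 1%:M).
Proof.
move=> a0; exists (block_mx a^-1%:M (- a^-1 *: u) 0 1%:M); last exact: transports_upper.
rewrite mulmx_block !mulmx0 !mul0mx !mulmx1 ?mul1mx !addr0 add0r.
rewrite -scalar_mxM divff// mul_scalar_mx scalerA mulrN divff// scaleN1r addNr.
by rewrite -scalar_mx_block.
Qed.

Lemma transportable_lower n (v : 'cV[R]_n) :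
  transportable (block_mx 1%:M 0 v 1%:M).
Proof.
exists (block_mx 1%:M 0 (- v) 1%:M); last exact: transports_lower.
rewrite mulmx_block !mulmx0 !mul0mx !mulmx1 ?mul1mx !addr0 add0r subrr.
by rewrite -scalar_mx_block.
Qed.

Lemma transportable_diag n (S : 'M[R]_n) : transportable S ->
  transportable (block_mx (1%:M : 'M[R]_1) 0 0 S).
Proof.
move=> [T ST tS].
exists (block_mx (1%:M : 'M[R]_1) 0 0 T); last exact: transports_diag.
rewrite mulmx_block !mulmx0 !mul0mx !mulmx1 ST !addr0 add0r.
by rewrite -scalar_mx_block.
Qed.

(** Gaussian elimination by induction on the dimension: with a nonzero corner, the matrix is the
    product of a lower shear, a block carrying a smaller invertible matrix, and an upper factor. *)
Lemma transportable_unit n (A : 'M[R]_n) : A \in unitmx -> transportable A.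
Proof.
elim: n A => [|n IH] A Au.
  exists 1%:M; first by rewrite [RHS]flatmx0 [LHS]flatmx0.
  exists 1%R => // f mf f0; rewrite mul1e.
  apply: eq_integral => z _; rewrite /dens !(tuple0 (act _ z)) (tuple0 z).
  by rewrite subrr mul0r expR0 mule1.
pose z0 : 'I_(1 + n) := lshift n 0.
wlog a0 : A Au / (A : 'M[R]_(1 + n)) z0 z0 != 0 => [hw|].
  have [a0|] := eqVneq ((A : 'M[R]_(1 + n)) z0 z0) 0; last exact: hw.
  have [i Ai0] : exists i : 'I_n, (A : 'M[R]_(1 + n)) (rshift 1 i) z0 != 0.
    apply/existsP; rewrite -[X in is_true X]negbK negb_exists; apply/negP => /forallP H.
    have := congr1 (fun M : 'M[R]_(1 + n) => M z0 z0) (mulVmx Au).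
    rewrite !mxE eqxx (@big_split_ord _ _ _ 1 n)/= big_ord1 a0 mulr0 add0r.
    rewrite big1 => [/esym/eqP|j _]; first by rewrite oner_eq0.
    by have := H j; rewrite negbK => /eqP ->; rewrite mulr0.
  (* [e 1] adds row [i] to the first row, which turns the vanishing corner into the nonzero entry
     just found; [e (-1)] undoes it. *)
  pose e (c : R) : 'M[R]_(1 + n) := block_mx 1%:M (c *: delta_mx 0 i) 0 1%:M.
  have te c : transportable (e c) by apply: transportable_upper; exact: oner_neq0.
  have e1 : e (- 1) *m e 1 = 1%:M.
    rewrite /e mulmx_block !mulmx0 !mul0mx !mulmx1 mul1mx !addr0 add0r.
    by rewrite scaleN1r scale1r subrr -scalar_mx_block.
  have -> : A = e (-1) *m (e 1 *m A) by rewrite mulmxA e1 mul1mx.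
  apply: transportable_mul => //; apply: hw.
    by rewrite unitmx_mul Au andbT; case/mulmx1_unit: e1.
  rewrite !mxE (@big_split_ord _ _ _ 1 n)/= big_ord1 a0 mulr0 add0r.
  rewrite (bigD1 i)//= big1 => [|j ji].
    by rewrite addr0 block_mxEur !mxE !eqxx mulr1 mul1r.
  by rewrite block_mxEur !mxE !eqxx (negbTE ji) mulr0 mul0r.
pose a := (A : 'M[R]_(1 + n)) z0 z0.
pose u := ursubmx (A : 'M[R]_(1 + n)).
pose v := a^-1 *: dlsubmx (A : 'M[R]_(1 + n)).
(* The Schur complement of the pivot [a], to which the induction hypothesis will apply. *)
pose S := drsubmx (A : 'M[R]_(1 + n)) - v *m u.
have AE : A = block_mx 1%:M 0 v 1%:M *m (block_mx (1%:M : 'M[R]_1) 0 0 S *m block_mx a%:M u 0 1%:M).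
  rewrite !mulmx_block !mulmx0 !mul0mx !mulmx1 ?mul1mx !addr0 !add0r.
  rewrite addrC subrK mul_mx_scalar scalerA divff// scale1r.
    have -> : a%:M = ulsubmx (A : 'M[R]_(1 + n)).
    by apply/matrixP => i j; rewrite !ord1 !mxE mulr1n.
  exact: (esym (submxK (A : 'M[R]_(1 + n)))).
have Su : S \in unitmx.
  move: Au; rewrite AE !unitmx_mul => /and3P[_ + _].
  by rewrite !unitmxE (@det_ublock _ 1 n) det1 mul1r.
rewrite AE; apply: transportable_mul; first exact: transportable_lower.
apply: transportable_mul; last exact: transportable_upper.
exact/transportable_diag/IH.
Qed.

End transportable.

(** * Densities of linear images under rectangular matrices *)

Section gaussian_image.
Context {R : realType}.
Local Notation N := (@std_normal R).

#[local] Opaque std_normal.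

Definition tcat n m (x : n.-tuple R) (y : m.-tuple R) : (n + m).-tuple R :=
  [tuple of x ++ y].

Lemma measurable_tcat d (T : measurableType d) n m
    (f : T -> n.-tuple R) (g : T -> m.-tuple R) :
  measurable_fun setT f -> measurable_fun setT g ->
  measurable_fun setT (fun t => tcat (f t) (g t)).
Proof.
move=> mf mg; apply/measurable_fun_tnthP => i.
case: (split_ordP i) => k ->.
  rewrite (_ : _ \o _ = (fun z => tnth z k) \o f).
    by apply: measurableT_comp => //; exact: measurable_tnth.
  by apply/funext => t /=; rewrite tnth_lshift.
rewrite (_ : _ \o _ = (fun z => tnth z k) \o g).
  by apply: measurableT_comp => //; exact: measurable_tnth.
by apply/funext => t /=; rewrite tnth_rshift.
Qed.

Local Open Scope ereal_scope.

Lemma integral_std_normal_cat n m (f : (n + m).-tuple R -> \bar R) :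
  measurable_fun setT f -> (forall z, 0 <= f z) ->
  \int[N (n + m)]_z f z = \int[N n]_x \int[N m]_y f (tcat x y).
Proof.
elim: n f => [|n IH] f mf f0.
  rewrite integral_std_normal0; apply: eq_integral => y _.
  by congr (f _); exact/val_inj.
have mfc : measurable_fun setT (fun p : n.+1.-tuple R * m.-tuple R => f (tcat p.1 p.2)).
  by apply: (measurableT_comp mf); exact: measurable_tcat.
have mF := measurable_fun_fubini_tonelli_F (m2 := N m) _ mfc (fun p => f0 _).
apply: (etrans (integral_std_normalS (n := n + m) mf f0)).
apply/esym; apply: (etrans (integral_std_normalS mF _)).
  by move=> x; apply: integral_ge0 => y _; exact: f0.
apply: eq_integral => x _; apply/esym.
apply: (etrans (IH (fun z => f (tcons (x, z))) (measurableT_comp mf (measurable_tcons_r x)) _)).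
  by move=> z; exact: f0.
apply: eq_integral => y _; apply: eq_integral => z _.
by congr (f _); exact/val_inj.
Qed.

Local Close Scope ereal_scope.

Definition qform n (W : 'M[R]_n) (y : n.-tuple R) : R :=
  \sum_(i < n) \sum_(j < n) W i j * tnth y i * tnth y j.

Lemma sum_sqr_act n m (A : 'M[R]_(n, m)) z : sum_sqr (act A z) = qform (A^T *m A) z.
Proof.
rewrite /sum_sqr /qform.
under eq_bigr do rewrite tnth_mktuple expr2 mulr_suml.
under eq_bigr do under eq_bigr do rewrite mulr_sumr.
rewrite exchange_big/=; apply: eq_bigr => i _.
rewrite exchange_big/=; apply: eq_bigr => j _.
rewrite mxE !mulr_suml; apply: eq_bigr => k _.
by rewrite mxE; ring.
Qed.

Lemma measurable_qform n (W : 'M[R]_n) : measurable_fun setT (qform W).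
Proof.
apply: measurable_sum => i; apply: measurable_sum => j.
apply: measurable_funM; last exact: measurable_tnth.
by apply: measurable_funM => //; exact: measurable_tnth.
Qed.

Lemma qform_tcat n m (W : 'M[R]_n) (V : 'M[R]_m) x y :
  qform (block_mx W 0 0 V) (tcat x y) = qform W x + qform V y.
Proof.
rewrite /qform big_split_ord/=; congr (_ + _); apply: eq_bigr => i _.
  rewrite big_split_ord/= [X in _ + X]big1 ?addr0 => [|j _].
    by apply: eq_bigr => j _; rewrite block_mxEul !tnth_lshift.
  by rewrite block_mxEur mxE !mul0r.
rewrite big_split_ord/= big1 ?add0r => [|j _].
  by apply: eq_bigr => j _; rewrite block_mxEdr !tnth_rshift.
by rewrite block_mxEdl mxE !mul0r.
Qed.

Lemma sum_sqr_tcat n m (x : n.-tuple R) (y : m.-tuple R) :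
  sum_sqr (tcat x y) = sum_sqr x + sum_sqr y.
Proof.
rewrite /sum_sqr big_split_ord/=.
by congr (_ + _); apply: eq_bigr => i _; rewrite ?tnth_lshift ?tnth_rshift.
Qed.

Lemma act_row n m p (A : 'M[R]_(p, n)) (B : 'M[R]_(p, m)) x y :
  act (row_mx A B) (tcat x y) = tadd (act B y) (act A x).
Proof.
apply: eq_from_tnth => i; rewrite !tnth_mktuple big_split_ord/=.
by congr (_ + _); apply: eq_bigr => j _;
  rewrite ?row_mxEl ?row_mxEr ?tnth_lshift ?tnth_rshift.
Qed.

Lemma act_row0l n m p (B : 'M[R]_(p, m)) (x : n.-tuple R) y :
  act (row_mx 0 B) (tcat x y) = act B y.
Proof.
rewrite act_row act0; apply: eq_from_tnth => i.
by rewrite !tnth_mktuple add0r.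
Qed.

Lemma act_row0r n m p (A : 'M[R]_(p, n)) x (y : m.-tuple R) :
  act (row_mx A 0) (tcat x y) = act A x.
Proof. by rewrite act_row act0 tadd0. Qed.

(** Up to normalisation, the density of the centred Gaussian law with inverse covariance [W],
    relative to the standard one. *)
Definition gdens n (W : 'M[R]_n) (y : n.-tuple R) : \bar R :=
  (expR ((sum_sqr y - qform W y) / 2))%:E.

Lemma gdens_ge0 n (W : 'M[R]_n) y : (0 <= gdens W y)%E.
Proof. by rewrite lee_fin expR_ge0. Qed.

Lemma measurable_gdens n (W : 'M[R]_n) : measurable_fun setT (gdens W).
Proof.
apply/measurable_EFinP; apply: measurableT_comp => //.
apply: measurable_funM => //; apply: measurable_funB.
  exact: measurable_sum_sqr.
exact: measurable_qform.
Qed.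

Local Open Scope ereal_scope.

Lemma integral_std_normal_cst n (k : \bar R) : \int[N n]_x (cst k) x = k.
Proof.
rewrite integral_cst//.
by rewrite -[RHS]mule1; apply: (congr1 (mule k)); exact: probability_setT.
Qed.

Lemma act_law n m (B : 'M[R]_(n, m)) : B *m B^T \in unitmx ->
  exists2 c : R, (0 < c)%R &
    forall f, measurable_fun setT f -> (forall z, 0 <= f z) ->
    \int[N m]_z f (act B z) = c%:E * \int[N n]_y (f y * gdens (invmx (B *m B^T)) y).
Proof.
move=> Su; set W := invmx _.
(* [B] is completed to the invertible symmetric matrix
   [C = [[0, B], [B^T, 1 - B^T (B B^T)^-1 B]]], whose square is block diagonal. *)
pose Q : 'M[R]_m := (1%:M - B^T *m W *m B)%R.
pose V : 'M[R]_m := (B^T *m W *m W *m B + Q)%R.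
pose C : 'M[R]_(n + m) := block_mx 0 B B^T Q.
have WT : W^T = W by rewrite /W trmx_inv trmx_mul trmxK.
have SW : B *m B^T *m W = 1%:M by rewrite mulmxV.
have WS : W *m (B *m B^T) = 1%:M by rewrite mulVmx.
have QE : Q = (1%:M - B^T *m W *m B)%R by [].
clearbody Q.
(* [Q] is the orthogonal projection onto the kernel of [B]; hence the off-diagonal blocks of
   [C *m C] vanish. *)
have BQ : B *m Q = 0%R.
  by rewrite QE mulmxBr mulmx1 !mulmxA SW mul1mx subrr.
have QB : Q *m B^T = 0%R.
  by rewrite QE mulmxBl mul1mx -!mulmxA WS mulmx1 subrr.
have QQ : Q *m Q = Q.
  by rewrite {1}QE mulmxBl mul1mx -!mulmxA BQ !mulmx0 subr0.
have QT : Q^T = Q.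
  by rewrite QE linearB/= trmx1 !trmx_mul trmxK WT mulmxA.
have CT : C^T = C by rewrite /C tr_block_mx trmxK QT trmx0.
have CC : C *m C = block_mx (B *m B^T) 0 0 (B^T *m B + Q).
  by rewrite /C mulmx_block !mul0mx !mulmx0 add0r BQ QB QQ !add0r.
have VG : V *m (B^T *m B + Q) = 1%:M.
  rewrite /V mulmxDl !mulmxDr QQ (mulmxA Q) QB mul0mx add0r.
  rewrite -(mulmxA _ B Q) BQ mulmx0 addr0.
  rewrite -!mulmxA (mulmxA B) (mulmxA W (B *m B^T)) WS mul1mx QE !mulmxA.
  by rewrite addrC subrK.
have PCC : block_mx W 0 0 V *m (C *m C) = 1%:M.
  rewrite CC mulmx_block !mulmx0 !mul0mx !addr0 !add0r WS VG.
  by rewrite -scalar_mx_block.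
have Cu : C \in unitmx by move: PCC; rewrite mulmxA => /mulmx1_unit[].
have [Ci CCi [c c0 tC]] := transportable_unit Cu.
have CiE : Ci^T *m Ci = block_mx W 0 0 V.
  have E : C *m C *m (Ci^T *m Ci) = 1%:M.
    rewrite -{2}CT mulmxA -(mulmxA C) -trmx_mul (mulmx1C CCi) trmx1 mulmx1.
    by rewrite CCi.
  by rewrite -[LHS]mul1mx -PCC -mulmxA E mulmx1.
pose kappa := \int[N m]_y gdens V y.
have k0 : 0 <= kappa by apply: integral_ge0 => y _; exact: gdens_ge0.
have key f : measurable_fun setT f -> (forall z, 0 <= f z) ->
    \int[N m]_z f (act B z) = c%:E * (kappa * \int[N n]_y (f y * gdens W y)).
  move=> mf f0.
  (* [P] keeps the first [n] coordinates. As [P *m C = row_mx 0 B], the auxiliary coordinates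
     disappear on the left; on the right the density is a product and the last [m] coordinates
     integrate to [kappa]. *)
  pose P : 'M[R]_(n, n + m) := row_mx 1%:M 0.
  pose g z := f (act P z).
  have mg : measurable_fun setT g by exact: (measurableT_comp mf (measurable_act P)).
  have g0 z : 0 <= g z by exact: f0.
  have mgC : measurable_fun setT (fun z => g (act C z)).
    exact: (measurableT_comp mg (measurable_act C)).
  transitivity (\int[N (n + m)]_z g (act C z)).
    apply/esym; apply: (etrans (integral_std_normal_cat mgC (fun z => g0 _))).
    transitivity (\int[N n]_x cst (\int[N m]_y f (act B y)) x).
      apply: eq_integral => x _; apply: eq_integral => y _.
      rewrite /g -act_mul /P /C mul_row_block !mul0mx !mul1mx !addr0.
      by rewrite act_row0l.
    by rewrite integral_std_normal_cst.
  apply: (etrans (tC g mg g0)); apply: (congr1 (mule c%:E)).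
  have mgd : measurable_fun setT (fun z => g z * dens (act Ci) z).
    by apply: emeasurable_funM => //; apply: measurable_dens; exact: measurable_act.
  apply: (etrans (integral_std_normal_cat mgd _)).
    by move=> z; rewrite mule_ge0// dens_ge0.
  transitivity (\int[N n]_x (kappa * (f x * gdens W x))); last first.
    have mfd := emeasurable_funM mf (measurable_gdens W).
    apply: (ge0_integralZl _ measurableT mfd _ k0).
    by move=> x _; rewrite mule_ge0// gdens_ge0.
  apply: eq_integral => x _.
  transitivity (\int[N m]_y (f x * gdens W x * gdens V y)).
    apply: eq_integral => y _.
    rewrite /g /P act_row0r act1 -muleA; apply: (congr1 (mule (f x))).
    rewrite /dens /gdens sum_sqr_act CiE qform_tcat sum_sqr_tcat -EFinM -expRD.
    by congr (EFin (expR _)); field.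
  rewrite [RHS]muleC; apply: (ge0_integralZl _ measurableT (measurable_gdens V)).
    by move=> y _; exact: gdens_ge0.
  by rewrite mule_ge0// gdens_ge0.
(* For the constant function, [key] says that 1 is the product of [c], [kappa] and an integral,
   which excludes [kappa = 0] and [kappa = +oo]. *)
have := key (cst 1) (@measurable_cst _ _ _ _ _ _) (fun=> lee01).
under eq_integral do rewrite /=.
rewrite integral_std_normal_cst.
set I := \int[_]_y _ => E1.
have I0 : 0 <= I by apply: integral_ge0 => y _; rewrite mule_ge0// ?gdens_ge0.
have [k' k'0 kE] : exists2 k, (0 < k)%R & kappa = k%:E.
  clear key; move: (kappa) k0 E1 => [k|_|//].
    rewrite lee_fin le_eqVlt => /orP[/eqP <-|k0 _]; last by exists k.
    by rewrite mul0e mule0 => /eqP; rewrite onee_eq0.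
  move: I0; rewrite le_eqVlt => /orP[/eqP <-|I0].
    by rewrite mule0 mule0 => /eqP; rewrite onee_eq0.
  by rewrite gt0_mulye// gt0_muley ?lte_fin.
exists (c * k')%R; first exact: mulr_gt0.
by move=> f mf f0; rewrite key// kE muleA EFinM.
Qed.

End gaussian_image.

(** * Consequences of the normalisation: orthogonal invariance, exponential integrability, second
    moment *)

Section moments.
Context {R : realType}.
Local Notation N := (@std_normal R).

#[local] Opaque std_normal.

Lemma qform1 n (y : n.-tuple R) : qform 1%:M y = sum_sqr y.
Proof.
apply: eq_bigr => i _; rewrite (bigD1 i)//= big1 => [|j ji].
  by rewrite mxE eqxx mul1r addr0 expr2.
by rewrite mxE eq_sym (negbTE ji) !mul0r.
Qed.

Lemma qformZ n c (W : 'M[R]_n) (y : n.-tuple R) : qform (c *: W) y = c * qform W y.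
Proof.
rewrite /qform mulr_sumr; apply: eq_bigr => i _.
by rewrite mulr_sumr; apply: eq_bigr => j _; rewrite mxE !mulrA.
Qed.

Lemma qformB n (V W : 'M[R]_n) (y : n.-tuple R) : qform (V - W) y = qform V y - qform W y.
Proof.
rewrite /qform -sumrB; apply: eq_bigr => i _.
by rewrite -sumrB; apply: eq_bigr => j _; rewrite !mxE !mulrBl.
Qed.

Lemma sum_sqr_ge0 n (y : n.-tuple R) : 0 <= sum_sqr y.
Proof. by apply: sumr_ge0 => i _; exact: sqr_ge0. Qed.

(** Dividing both inequalities by |s - 1| and letting s tend to 1 gives r <= 1 from above and r >= 1
    from below. The proof does this quantitatively with s = 1 + h and s = 1 - h. *)
Lemma second_moment_bounds (r : R) :
  (forall s, 1 < s -> 1 + (1 - s ^- 2) / 2 * r <= s) ->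
  (forall s, 0 < s < 1 -> 1 <= s + (s ^- 2 - 1) / 2 * r) -> r = 1.
Proof.
move=> up lo; apply/eqP; rewrite eq_le; apply/andP; split.
  apply/ler_addgt0Pr => e e0.
  pose h := Num.min 1 (e / 3).
  have h0 : (0 < h) by rewrite lt_min ltr01 divr_gt0.
  have h1 : (h <= 1) by rewrite ge_min lexx.
  have h3 : (3 * h <= e) by rewrite mulrC -ler_pdivlMr// ge_min lexx orbT.
  have h1' : (1 < 1 + h) by lra.
  have H := up _ h1'.
  have hp : (0 < 1 + h) by lra.
  have {}H : (h / 2 * (2 + h) * r <= h * (1 + h) ^+ 2).
    have -> : (h / 2 * (2 + h) * r = (1 - (1 + h) ^- 2) / 2 * r * (1 + h) ^+ 2).
      by field; rewrite lt0r_neq0.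
    by rewrite ler_pM2r ?exprn_gt0//; lra.
  have : ((2 + h) / 2 * r <= (1 + h) ^+ 2).
    by rewrite -(ler_pM2l h0) (le_trans _ H)//; lra.
  by move=> ?; nra.
apply/ler_addgt0Pr => e e0.
pose h := Num.min 2^-1 (e / 3).
have h0 : (0 < h) by rewrite lt_min invr_gt0 ltr0n divr_gt0.
have h1 : (h <= 2^-1) by rewrite ge_min lexx.
have h3 : (3 * h <= e) by rewrite mulrC -ler_pdivlMr// ge_min lexx orbT.
have h1' : (0 < 1 - h < 1) by lra.
have H := lo _ h1'.
have hp : (0 < 1 - h) by lra.
have {}H : (h * (1 - h) ^+ 2 <= h / 2 * (2 - h) * r).
  have -> : (h / 2 * (2 - h) * r = ((1 - h) ^- 2 - 1) / 2 * r * (1 - h) ^+ 2).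
    by field; rewrite lt0r_neq0.
  by rewrite ler_pM2r ?exprn_gt0//; lra.
have : ((1 - h) ^+ 2 <= (2 - h) / 2 * r).
  by rewrite -(ler_pM2l h0) (le_trans H)//; lra.
by move=> ?; nra.
Qed.

Local Open Scope ereal_scope.

(** The density in [act_law] is identically 1 here, and the constant function 1 then forces the
    constant to be 1. [B] may be rectangular, with orthonormal rows. *)
Lemma act_orthogonal n m (B : 'M[R]_(n, m)) (f : n.-tuple R -> \bar R) :
  B *m B^T = 1%:M -> measurable_fun setT f -> (forall z, 0 <= f z) ->
  \int[N m]_z f (act B z) = \int[N n]_y f y.
Proof.
move=> BB.
have [|c c0] := @act_law _ _ _ B; first by rewrite BB unitmx1.
rewrite BB invmx1 => H.
have {}H g : measurable_fun setT g -> (forall z, 0 <= g z) ->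
    \int[N m]_z g (act B z) = c%:E * \int[N n]_y g y.
  move=> mg g0; rewrite H//; apply: (congr1 (mule c%:E)).
  by apply: eq_integral => y _; rewrite /gdens qform1 subrr mul0r expR0 mule1.
move=> mf f0; rewrite H//.
have := H (cst 1) (@measurable_cst _ _ _ _ _ _) (fun=> lee01).
by rewrite !integral_std_normal_cst mule1 => <-; rewrite mul1e.
Qed.

(** exp(|y|^2 / 4) is, up to a constant, the density of sqrt(2) Z relative to the law of Z, hence
    integrable. It dominates every integrand of the expansion. *)
Lemma exp_sum_sqr_fin n :
  exists2 c : R, (0 < c)%R & \int[N n]_y (expR (sum_sqr y / 4))%:E = c%:E.
Proof.
pose a : R := Num.sqrt 2.
have a2 : (a * a = 2)%R by rewrite -expr2 sqr_sqrtr.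
have BB : (a%:M : 'M[R]_n) *m (a%:M)^T = (2%:R)%:M by rewrite tr_scalar_mx -scalar_mxM a2.
have [|c c0] := @act_law _ _ _ (a%:M : 'M[R]_n).
  by rewrite BB unitmxE det_scalar unitfE expf_neq0.
move=> /(_ (cst 1) (@measurable_cst _ _ _ _ _ _) (fun=> lee01)).
rewrite integral_std_normal_cst BB invmx_scalar.
under eq_integral do rewrite mul1e /gdens -scalemx1 qformZ qform1.
move=> E; exists c^-1%R; first by rewrite invr_gt0.
have -> : \int[N n]_y (expR (sum_sqr y / 4))%:E =
    \int[N n]_x (expR ((sum_sqr x - 2^-1 * sum_sqr x) / 2))%:E.
  by apply: eq_integral => y _; congr (EFin (expR _)); field.
rewrite -[RHS]mule1 E muleA -EFinM mulVf ?lt0r_neq0//.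
by rewrite mul1e.
Qed.

Lemma integral_normal01_cst (k : \bar R) : \int[normal01]_x (cst k) x = k.
Proof.
rewrite integral_cst//.
by rewrite -[RHS]mule1; apply: (congr1 (mule k)); exact: probability_setT.
Qed.

Lemma integral_normal01_exp (s : R) : (0 < s)%R ->
  \int[normal01]_y (expR ((1 - s ^- 2) * y ^+ 2 / 2))%:E = s%:E.
Proof.
move=> s0.
have /(_ (cst 1) (@measurable_cst _ _ _ _ _ _) (fun=> lee01)) :=
  integral_normal01_affine 0 (lt0r_neq0 s0).
rewrite integral_normal01_cst gtr0_norm// => E.
rewrite -[RHS]mule1 E muleA -EFinM divff ?lt0r_neq0// mul1e.
apply: eq_integral => y _; rewrite mul1e subr0; congr (EFin (expR _)).
by field; rewrite lt0r_neq0.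
Qed.

(** The exponential exp((1 - s^-2) y^2 / 2) has integral s and is at least 1 + (1 - s^-2) y^2 / 2.
    Integrating this inequality for s on both sides of 1 pins the second moment down. *)
Lemma normal01_second_moment : \int[normal01]_y (y ^+ 2)%:E = 1 :> \bar R.
Proof.
have ms : measurable_fun setT (fun y : R => (y ^+ 2)%:E).
  by apply/measurable_EFinP; exact: measurable_funX.
have mk (k : R) : measurable_fun setT (fun y : R => k%:E * (y ^+ 2)%:E).
  exact: measurable_funeM.
have me (s : R) : measurable_fun setT (fun y : R => (expR ((1 - s ^- 2) * y ^+ 2 / 2))%:E).
  apply/measurable_EFinP; apply: measurableT_comp => //; apply: measurable_funM => //.
  by apply: measurable_funM => //; exact: measurable_funX.
have s20 y : (0 <= (y ^+ 2 : R)%:E) by rewrite lee_fin sqr_ge0.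
set m2 := \int[_]_y _.
have m20 : 0 <= m2 by exact: integral_ge0.
have up (s : R) : (1 < s)%R -> 1 + ((1 - s ^- 2) / 2)%:E * m2 <= s%:E.
  move=> s1; have s0 : (0 < s)%R by exact: lt_trans s1.
  have k0 : (0 <= (1 - s ^- 2) / 2)%R.
    by rewrite divr_ge0// subr_ge0 invf_le1 ?exprn_gt0// expr_ge1 ?ltW.
  rewrite -(integral_normal01_exp s0) /m2 -[X in X + _](integral_normal01_cst 1).
  rewrite -(ge0_integralZl_EFin normal01 measurableT _ ms k0)//.
  rewrite -(ge0_integralD normal01 measurableT _ _ _ (mk _))//; last first.
    by move=> y _; rewrite mule_ge0.
  apply: ge0_le_integral => //.
  - by move=> y _; rewrite adde_ge0// mule_ge0.
  - by apply: emeasurable_funD.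
  - move=> y _; rewrite -EFinM -EFinD lee_fin.
    apply: le_trans (expR_ge1Dx _).
    by rewrite lerD2l [leRHS]mulrAC.
(* For s < 1 the quadratic term is negative; it is moved to the other side so that only nonnegative
   functions are integrated, [m2] not being known to be finite yet. *)
have lo (s : R) : (0 < s < 1)%R -> 1 <= s%:E + ((s ^- 2 - 1) / 2)%:E * m2.
  move=> /andP[s0 s1].
  have k0 : (0 <= (s ^- 2 - 1) / 2)%R.
    by rewrite divr_ge0// subr_ge0 invf_ge1 ?exprn_gt0// exprn_ile1 ?ltW.
  rewrite -(integral_normal01_exp s0) /m2 -[leLHS](integral_normal01_cst 1).
  rewrite -(ge0_integralZl_EFin normal01 measurableT _ ms k0)//.
  have E0 y : [set: R] y -> 0 <= (expR ((1 - s ^- 2) * y ^+ 2 / 2))%:E.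
    by move=> _; rewrite lee_fin expR_ge0.
  have K0 y : [set: R] y -> 0 <= ((s ^- 2 - 1) / 2)%:E * (y ^+ 2)%:E.
    by move=> _; rewrite mule_ge0.
  rewrite -(ge0_integralD normal01 measurableT E0 (me _) K0 (mk _)).
  apply: ge0_le_integral => //.
  - by apply: emeasurable_funD.
  - move=> y _; rewrite -EFinM -EFinD lee_fin -lerBlDr.
    apply: le_trans (expR_ge1Dx _).
    by rewrite lerD2l -mulNr mulrAC -[leRHS]mulrA mulrC -mulNr opprB mulrC mulrA.
(* The bound [up] at s = 2 already makes [m2] finite. *)
have [r rE] : exists r : R, m2 = r%:E.
  have := up 2%R (ltr1n R 2); move: (m2) m20 => [r _ _|_|//]; first by exists r.
  by rewrite gt0_muley// lte_fin; lra.
rewrite rE; apply: (congr1 EFin); apply: second_moment_bounds => s hs.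
  by have := up s hs; rewrite rE.
by have := lo s hs; rewrite rE.
Qed.

End moments.

(** * First-order expansion of nearly standard Gaussian laws *)

Section mixed_moments.
Context {R : realType}.
Local Notation N := (@std_normal R).

#[local] Opaque std_normal.

Lemma Rintegral_sum d (T : measurableType d) (mu : {measure set T -> \bar R})
    (D : set T) (I : Type) (s : seq I) (g : I -> T -> R) :
  measurable D -> (forall i, mu.-integrable D (EFin \o g i)) ->
  \int[mu]_(x in D) (\sum_(i <- s) g i x) = \sum_(i <- s) \int[mu]_(x in D) g i x.
Proof.
move=> mD ig; elim: s => [|i s IH].
  under eq_Rintegral do rewrite big_nil.
  by rewrite big_nil Rintegral_cst// mul0r.
under eq_Rintegral do rewrite big_cons.
rewrite big_cons RintegralD//; first by rewrite IH.
rewrite (_ : _ \o _ = fun x => (\sum_(i <- s) (EFin \o g i) x)%E).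
  by apply: integrable_sum => // j _; exact: ig.
by apply/funext => x /=; rewrite sumEFin.
Qed.

Definition expq n : R := \int[N n]_y expR (sum_sqr y / 4).

Lemma measurable_exp_sum_sqr n :
  measurable_fun setT (fun y : n.-tuple R => expR (sum_sqr y / 4)).
Proof.
by apply: measurableT_comp => //; exact: measurable_funM.
Qed.

Lemma integrable_expq n :
  (N n).-integrable setT (EFin \o (fun y => expR (sum_sqr y / 4))).
Proof.
apply/integrableP; split.
  by apply/measurable_EFinP; exact: measurable_exp_sum_sqr.
under eq_integral do rewrite /= ger0_norm ?expR_ge0//.
by have [c _ ->] := exp_sum_sqr_fin (R := R) n; rewrite ltry.
Qed.

Lemma expq_gt0 n : 0 < expq n.
Proof. by rewrite /expq /Rintegral; have [c c0 ->] := exp_sum_sqr_fin (R := R) n. Qed.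

Section dominated.
Variables (n : nat) (g : n.-tuple R -> R) (c : R).
Hypothesis mg : measurable_fun setT g.
Hypothesis gc : forall y, `|g y| <= c * expR (sum_sqr y / 4).

Lemma integrable_dominated D : measurable D -> (N n).-integrable D (EFin \o g).
Proof.
move=> mD; apply: (integrableS measurableT mD (@subsetT _ _)).
have := integrableZl measurableT c (integrable_expq n).
apply: le_integrable => //; first exact/measurable_EFinP.
move=> y _ /=; rewrite lee_fin.
by rewrite (le_trans (gc y))// ler_norm.
Qed.

Lemma Rintegral_dominated D : measurable D ->
  `|\int[N n]_(y in D) g y| <= c * expq n.
Proof.
move=> mD; have ig := integrable_dominated mD.
apply: (le_trans (le_normr_Rintegral mD ig)).
have c0 : 0 <= c.
  have := le_trans (normr_ge0 _) (gc [tuple 0 | i < n]).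
  by rewrite pmulr_lge0// expR_gt0.
have ic := integrableZl measurableT c (integrable_expq n).
rewrite /expq -RintegralZl//; last exact: integrable_expq.
have icD := integrableS measurableT mD (@subsetT _ D) ic.
apply: (@le_trans _ _ (\int[N n]_(y in D) (c * expR (sum_sqr y / 4)))).
  apply: le_Rintegral => //; first exact: (integrable_norm ig).
apply: fine_le; [exact: integrable_fin_num|exact: integrable_fin_num|].
apply: ge0_subset_integral => //.
  by apply/measurable_EFinP; apply: measurable_funM => //; exact: measurable_exp_sum_sqr.
by move=> y _; rewrite lee_fin mulr_ge0// expR_ge0.
Qed.

End dominated.

Lemma sum_sqr_le_exp n (y : n.-tuple R) : sum_sqr y <= 4 * expR (sum_sqr y / 4).
Proof.
have := expR_ge1Dx (sum_sqr y / 4).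
by set e := expR _ => ?; lra.
Qed.

Lemma sqr_le_sum_sqr n (y : n.-tuple R) i : tnth y i ^+ 2 <= sum_sqr y.
Proof. by rewrite /sum_sqr (bigD1 i)//= lerDl sumr_ge0// => j _; exact: sqr_ge0. Qed.

Lemma mul_le_sum_sqr n (y : n.-tuple R) i j : `|tnth y i * tnth y j| <= sum_sqr y.
Proof.
have hi := sqr_le_sum_sqr y i; have hj := sqr_le_sum_sqr y j.
by rewrite ler_norml; apply/andP; split; nra.
Qed.

Lemma measurable_mul_tnth n (i j : 'I_n) :
  measurable_fun setT (fun y : n.-tuple R => tnth y i * tnth y j).
Proof. by apply: measurable_funM; exact: measurable_tnth. Qed.

Lemma mul_dominated n (i j : 'I_n) (y : n.-tuple R) :
  `|tnth y i * tnth y j| <= 4 * expR (sum_sqr y / 4).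
Proof. exact: le_trans (mul_le_sum_sqr y i j) (sum_sqr_le_exp y). Qed.

Lemma tnth_dominated n (i : 'I_n) (y : n.-tuple R) :
  `|tnth y i| <= 5 * expR (sum_sqr y / 4).
Proof.
have h := sqr_le_sum_sqr y i.
have := sum_sqr_le_exp y.
have := expR_ge1Dx (sum_sqr y / 4); have := sum_sqr_ge0 y.
set e := expR _ => ? ? ?; rewrite ler_norml; apply/andP; split; nra.
Qed.

Lemma integrable_mul n (i j : 'I_n) D : measurable D ->
  (N n).-integrable D (EFin \o (fun y => tnth y i * tnth y j)).
Proof.
by apply: integrable_dominated; [exact: measurable_mul_tnth|exact: mul_dominated].
Qed.

Lemma integrable_tnth n (i : 'I_n) D : measurable D ->
  (N n).-integrable D (EFin \o (fun y => tnth y i)).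
Proof.
by apply: integrable_dominated; [exact: measurable_tnth|exact: tnth_dominated].
Qed.

Lemma act_orthogonalR n m (B : 'M[R]_(n, m)) (f : n.-tuple R -> R) :
  B *m B^T = 1%:M -> measurable_fun setT f -> (forall z, 0 <= f z) ->
  \int[N m]_z f (act B z) = \int[N n]_y f y.
Proof.
move=> BB mf f0; rewrite /Rintegral (act_orthogonal (f := EFin \o f) BB)//.
exact/measurable_EFinP.
Qed.

Lemma Rintegral_unit_sqr m (v : 'rV[R]_m) : v *m v^T = 1%:M ->
  \int[N m]_z (tnth (act v z) ord0 ^+ 2) = 1.
Proof.
move=> vv.
have mf : measurable_fun setT (fun y : 1.-tuple R => tnth y ord0 ^+ 2).
  by apply: measurable_funX; exact: measurable_tnth.
rewrite (act_orthogonalR (f := fun y => tnth y ord0 ^+ 2))//; last first.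
  by move=> z; exact: sqr_ge0.
rewrite /Rintegral.
rewrite (integral_std_normalS (f := fun y => (tnth y ord0 ^+ 2)%:E)); last 2 first.
- exact/measurable_EFinP.
- by move=> z; rewrite lee_fin sqr_ge0.
under eq_integral do rewrite integral_std_normal0 tnth0.
by rewrite normal01_second_moment.
Qed.

(** Orthogonal invariance gives second moment 1 in the direction of any unit vector. The
    off-diagonal case follows by polarisation, with the unit vector (e_i + e_j) / sqrt(2). *)
Lemma Rintegral_mul n (i j : 'I_n) :
  \int[N n]_y (tnth y i * tnth y j) = (i == j)%:R.
Proof.
have actd (k : 'I_n) (y : n.-tuple R) : tnth (act (delta_mx ord0 k : 'rV_n) y) ord0 = tnth y k.
  rewrite tnth_mktuple (bigD1 k)//= big1 => [|l lk].
    by rewrite mxE !eqxx mul1r addr0.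
  by rewrite mxE (negbTE lk) mul0r.
have dd (k l : 'I_n) : (delta_mx ord0 k : 'rV[R]_n) *m (delta_mx ord0 l)^T = (k == l)%:R%:M.
  rewrite trmx_delta; have [->|kl] := eqVneq k l.
    by rewrite mul_delta_mx; apply/matrixP => a b; rewrite !ord1 !mxE eqxx.
  by rewrite mul_delta_mx_0// raddf0.
have sq k : \int[N n]_y (tnth y k * tnth y k) = 1.
  rewrite -[RHS](@Rintegral_unit_sqr n (delta_mx ord0 k)) ?dd ?eqxx//.
  by apply: eq_Rintegral => y _; rewrite actd expr2.
have [->|ij] := eqVneq i j; first exact: sq.
pose a : R := (Num.sqrt 2)^-1.
have a2 : a * a = 2^-1 by rewrite -expr2 exprVn sqr_sqrtr.
pose v : 'rV[R]_n := a *: (delta_mx ord0 i + delta_mx ord0 j).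
have vv : v *m v^T = 1%:M.
  rewrite /v linearZ/= -scalemxAl -scalemxAr scalerA a2 linearD/= mulmxDl !mulmxDr !dd.
  rewrite !eqxx (negbTE ij) eq_sym (negbTE ij) !raddf0 addr0 add0r.
  by rewrite -raddfD/= scale_scalar_mx; congr _%:M; field.
have := Rintegral_unit_sqr vv.
have ii := integrable_mul i i measurableT.
have jj := integrable_mul j j measurableT.
have ij' := integrable_mul i j measurableT.
have -> : \int[N n]_z (tnth (act v z) ord0 ^+ 2) =
  \int[N n]_z (2^-1 * (tnth z i * tnth z i + tnth z j * tnth z j) + tnth z i * tnth z j).
  apply: eq_Rintegral => y _.
  have -> : tnth (act v y) ord0 = a * (tnth y i + tnth y j).
    rewrite -(actd i y) -(actd j y) !tnth_mktuple -big_split/= mulr_sumr.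
    by apply: eq_bigr => k _; rewrite !mxE; ring.
  by rewrite exprMn expr2 a2; field.
have ig := integrableZl measurableT 2^-1 (integrableD measurableT ii jj).
rewrite (RintegralD (f1 := fun z : n.-tuple R => 2^-1 * (tnth z i * tnth z i + tnth z j * tnth z j))
  measurableT ig ij').
rewrite (RintegralZl (f := fun z : n.-tuple R => tnth z i * tnth z i + tnth z j * tnth z j) _
  measurableT (integrableD measurableT ii jj)).
rewrite (RintegralD measurableT ii jj) !sq (_ : 2^-1 * (1 + 1) = 1); last by field.
by move=> h; apply: (addrI 1); rewrite h addr0.
Qed.

(** Invariance under z -> -z. Since [act_orthogonalR] asks for a nonnegative function, it is applied
    to (y_i + 1)^2, whose odd part is 2 y_i. *)
Lemma Rintegral_tnth n (i : 'I_n) : \int[N n]_y tnth y i = 0.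
Proof.
have mf : measurable_fun setT (fun y : n.-tuple R => (tnth y i + 1) ^+ 2).
  by apply: measurable_funX; apply: measurable_funD => //; exact: measurable_tnth.
have BB : (- 1%:M : 'M[R]_n) *m (- 1%:M)^T = 1%:M.
  by rewrite linearN/= trmx1 mulmxN mulNmx mulmx1 opprK.
have H := act_orthogonalR BB mf (fun z => sqr_ge0 _).
have ii := integrable_mul i i measurableT.
have i1 := integrable_tnth i measurableT.
have ik : (N n).-integrable setT (EFin \o cst 1) by exact: finite_measure_integrable_cst.
have E e : \int[N n]_z (tnth z i * tnth z i + 1 + e * tnth z i) =
   \int[N n]_z (tnth z i * tnth z i + 1) + e * \int[N n]_y tnth y i.
  rewrite (RintegralD (f1 := fun z : n.-tuple R => tnth z i * tnth z i + 1)
    (f2 := fun z : n.-tuple R => e * tnth z i) measurableT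
    (integrableD measurableT ii ik) (integrableZl measurableT e i1)).
  by rewrite (RintegralZl (f := fun z : n.-tuple R => tnth z i)).
have := E 2; have := E (-2).
have -> : \int[N n]_z (tnth z i * tnth z i + 1 + 2 * tnth z i) =
    \int[N n]_y (tnth y i + 1) ^+ 2.
  by apply: eq_Rintegral => y _; ring.
have -> : \int[N n]_z (tnth z i * tnth z i + 1 + - 2 * tnth z i) =
    \int[N n]_z (tnth (act (- 1%:M) z) i + 1) ^+ 2.
  by apply: eq_Rintegral => y _; rewrite act_opp act1 tnth_mktuple; ring.
rewrite H => -> ?; lra.
Qed.

Lemma Rintegral_qform n (W : 'M[R]_n) D : measurable D ->
  \int[N n]_(y in D) qform W y =
  \sum_(i < n) \sum_(j < n) W i j * \int[N n]_(y in D) (tnth y i * tnth y j).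
Proof.
move=> mD.
have ig i j : (N n).-integrable D (EFin \o (fun y => W i j * tnth y i * tnth y j)).
  have := integrableZl mD (W i j) (integrable_mul i j mD).
  by apply: eq_integrable => // y _ /=; rewrite -EFinM mulrA.
rewrite /qform Rintegral_sum//; last first.
  move=> i; rewrite (_ : _ \o _ = fun x =>
      (\sum_(j < n) (EFin \o (fun y : n.-tuple R => W i j * tnth y i * tnth y j)%R) x)%E).
    by apply: integrable_sum => // j _; exact: ig.
  by apply/funext => x /=; rewrite sumEFin.
apply: eq_bigr => i _; rewrite Rintegral_sum//.
apply: eq_bigr => j _; rewrite -RintegralZl//; last exact: integrable_mul.
by apply: eq_Rintegral => y _; rewrite mulrA.
Qed.

End mixed_moments.

(** * Pointwise remainder of the exponential and inverse of a perturbed identity matrix *)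

Section expansion_lemma.
Context {R : realType}.
Local Notation N := (@std_normal R).

#[local] Opaque std_normal.

Lemma expR_sub1_ub (u : R) : expR u - 1 <= u * expR u.
Proof.
have := expR_ge1Dx (- u); have := expR_gt0 u.
move=> e0; rewrite -(ler_pM2r e0) expRN mulVf ?lt0r_neq0//.
by set e := expR u => h; lra.
Qed.

Lemma expR_taylor1 (u : R) : `|expR u - 1 - u| <= u ^+ 2 * expR `|u|.
Proof.
have h1 := expR_ge1Dx u; have h2 := expR_sub1_ub u.
rewrite ger0_norm; last by lra.
have [u0|u0] := leP 0 u; first by rewrite ger0_norm//; nra.
have : 1 <= expR `|u| by rewrite -expR0 ler_expR.
by move=> ?; nra.
Qed.

Lemma sqr_le_expR (s : R) : 0 <= s -> s ^+ 2 <= 256 * expR (s / 8).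
Proof.
move=> s0; have -> : s / 8 = s / 16 + s / 16 by field.
rewrite expRD; have := expR_ge1Dx (s / 16).
by set e := expR _ => h; nra.
Qed.

(** Here u is the exponent, v its part linear in the perturbation, and s stands for |y|^2. The
    smallness condition gives |u| <= s / 8, so exp|u| costs exp(s / 8); the factor s^2 costs another
    exp(s / 8) and the 256 of [sqr_le_expR]. Together they just reach the integrable exp(s / 4). *)
Lemma expR_pointwise (u v s k1 k2 e : R) : 0 <= s -> 0 <= k1 -> 0 <= k2 -> 0 <= e ->
  `|u| <= k1 * e * s -> `|u - v| <= k2 * e ^+ 2 * s -> k1 * e <= 1 / 8 ->
  `|expR u - 1 - v| <= (256 * k1 ^+ 2 + 4 * k2) * e ^+ 2 * expR (s / 4).
Proof.
move=> s0 k10 k20 e0 us uvs ke.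
have -> : expR u - 1 - v = (expR u - 1 - u) + (u - v) by ring.
apply: (le_trans (ler_normD _ _)).
rewrite mulrDl [leRHS]mulrDl; apply: lerD.
  apply: (le_trans (expR_taylor1 u)).
  have us' : `|u| <= s / 8 by apply: (le_trans us); rewrite mulrC ler_wpM2l//; lra.
  have u2 : u ^+ 2 <= k1 ^+ 2 * e ^+ 2 * s ^+ 2.
    by rewrite -[u ^+ 2]real_normK ?num_real// -!exprMn lerXn2r ?nnegrE// !mulr_ge0.
  have -> : s / 4 = s / 8 + s / 8 by field.
  have := sqr_le_expR s0; rewrite expRD; set E := expR (s / 8) => sE.
  have E0 : 0 < E by exact: expR_gt0.
  apply: (@le_trans _ _ (k1 ^+ 2 * e ^+ 2 * s ^+ 2 * E)).
    by apply: ler_pM; [exact: sqr_ge0|exact: expR_ge0|exact: u2|rewrite ler_expR].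
  have k0 : 0 <= k1 ^+ 2 * e ^+ 2 by rewrite mulr_ge0 ?sqr_ge0.
  have -> : 256 * k1 ^+ 2 * e ^+ 2 * (E * E) = k1 ^+ 2 * e ^+ 2 * (256 * E) * E by ring.
  by rewrite ler_pM2r// ler_wpM2l.
apply: (le_trans uvs).
have -> : 4 * k2 * e ^+ 2 * expR (s / 4) = k2 * e ^+ 2 * (4 * expR (s / 4)) by ring.
rewrite ler_wpM2l// ?mulr_ge0 ?sqr_ge0//.
by have := expR_ge1Dx (s / 4); set E := expR _ => ?; lra.
Qed.

Lemma qform_bound n (M : 'M[R]_n) c (y : n.-tuple R) : 0 <= c ->
  (forall i j, `|M i j| <= c) -> `|qform M y| <= (n ^ 2)%:R * c * sum_sqr y.
Proof.
move=> c0 Mc; apply: (le_trans (ler_norm_sum _ _ _)).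
apply: (@le_trans _ _ (\sum_(i < n) \sum_(j < n) c * sum_sqr y)).
  apply: ler_sum => i _; apply: (le_trans (ler_norm_sum _ _ _)).
  apply: ler_sum => j _; rewrite -mulrA normrM.
  by apply: ler_pM => //; exact: mul_le_sum_sqr.
by rewrite !sumr_const !card_ord -mulrnA -mulnn -[leLHS]mulr_natl mulrA.
Qed.

Lemma norm_mulmx_row n p (V : 'M[R]_(p, n)) m (E : 'M[R]_(n, m)) e i j :
  (forall k l, `|E k l| <= e) -> `|(V *m E) i j| <= (\sum_k `|V i k|) * e.
Proof.
move=> Ee; rewrite mxE mulr_suml; apply: (le_trans (ler_norm_sum _ _ _)).
by apply: ler_sum => k _; rewrite normrM ler_wpM2l.
Qed.

Lemma row_sum_mulmx n p (V : 'M[R]_(p, n)) m (E : 'M[R]_(n, m)) e i :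
  (forall k l, `|E k l| <= e) ->
  \sum_j `|(V *m E) i j| <= m%:R * e * \sum_k `|V i k|.
Proof.
move=> Ee; apply: (@le_trans _ _ (\sum_(j < m) (\sum_k `|V i k|) * e)).
  by apply: ler_sum => j _; exact: norm_mulmx_row.
by rewrite sumr_const card_ord -[leLHS]mulr_natl [(\sum_k _) * e]mulrC mulrA.
Qed.

Section perturb.
Variables (n : nat) (E : 'M[R]_n) (e : R).
Hypothesis Ee : forall i j, `|E i j| <= e.
Hypothesis ne : n%:R * e <= 1 / 2.

(** A row vector v with v (1 + E) = 0 satisfies v = - v E, whereas multiplication by E at least
    halves the sum of absolute values; hence v = 0. *)
Lemma perturb_unit : 1%:M + E \in unitmx.
Proof.
rewrite -row_free_unit; apply: inj_row_free => v; rewrite mulmxDr mulmx1 => vE.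
have {}vE : v = - (v *m E) by apply/eqP; rewrite -subr_eq0 opprK vE.
have := row_sum_mulmx v ord0 Ee; set s := \sum_k `|v _ k| => h.
have s0 : 0 <= s by apply: sumr_ge0.
have sE : \sum_j `|(v *m E) ord0 j| = s.
  rewrite /s; apply: eq_bigr => j _ /=; have /= := congr1 (fun M : 'rV_n => M ord0 j) vE.
  by rewrite [X in _ = X]mxE => ->; rewrite normrN.
have {h} s1 : s = 0 by have := ler_wpM2r s0 ne; move: h; rewrite sE; lra.
apply/matrixP => i j; rewrite (ord1 i) [RHS]mxE; apply/eqP.
rewrite -normr_eq0 eq_le normr_ge0 andbT.
by rewrite -s1 /s (bigD1 j)//= lerDl sumr_ge0.
Qed.

Let W := invmx (1%:M + E).

Let WE : 1%:M - W = W *m E.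
Proof.
have := mulVmx perturb_unit; rewrite -/W mulmxDr mulmx1 => <-.
by rewrite addrC addKr.
Qed.

Let row_sum_W i : \sum_j `|W i j| <= 2.
Proof.
(* From W = 1 - W E, where the row sum of W E is at most half that of W. *)
have h := row_sum_mulmx W i Ee.
have : \sum_j `|W i j| <= 1 + \sum_j `|(W *m E) i j|.
  have -> : 1 = \sum_j `|(1%:M : 'M[R]_n) i j|.
    rewrite (bigD1 i)//= big1 => [|j ji]; first by rewrite mxE eqxx addr0 normr1.
    by rewrite mxE eq_sym (negbTE ji) normr0.
  rewrite -big_split/=; apply: ler_sum => j _.
  have -> : W i j = (1%:M : 'M[R]_n) i j - (W *m E) i j by rewrite -WE !mxE subKr.
  exact: ler_normB.
have : 0 <= \sum_j `|W i j| by apply: sumr_ge0.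
by move: h; set s := \sum_j `|W i j|; set t := \sum_j _ => h s0 st; have := ler_wpM2r s0 ne; lra.
Qed.

Let e_ge0 (i : 'I_n) : 0 <= e. Proof. exact: le_trans (normr_ge0 _) (Ee i i). Qed.

Lemma perturb_inv1 i j : `|(1%:M - W) i j| <= 2 * e.
Proof.
rewrite WE; apply: (le_trans (norm_mulmx_row W i j Ee)).
exact: ler_wpM2r (e_ge0 i) _ _ (row_sum_W i).
Qed.

(** The second step of the Neumann series: 1 - W - E = - (1 - W) E, a product of two factors of
    order e. *)
Lemma perturb_inv2 i j : `|(1%:M - W - E) i j| <= 2 * n%:R * e ^+ 2.
Proof.
have -> : 1%:M - W - E = - ((1%:M - W) *m E).
  by rewrite {1}WE mulmxBl mul1mx opprB.
rewrite mxE normrN; apply: (le_trans (norm_mulmx_row _ i j Ee)).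
rewrite expr2 mulrA ler_wpM2r//; first exact: e_ge0 i.
apply: (@le_trans _ _ (\sum_(k < n) 2 * e)).
  by apply: ler_sum => k _; exact: perturb_inv1.
by rewrite sumr_const card_ord -[leLHS]mulr_natl mulrA [_ * 2]mulrC.
Qed.

End perturb.

End expansion_lemma.

(** * Expansion of the probability of an event, uniformly over events *)

Section gaussian_expansion.
Context {R : realType}.
Local Notation N := (@std_normal R).

#[local] Opaque std_normal.

Definition first_order n (E : 'M[R]_n) (A : set (n.-tuple R)) : R :=
  fine (N n A) + 2^-1 * (\int[N n]_(y in A) qform E y - \tr E * fine (N n A)).

Lemma probability_fine_itv d (T : measurableType d) (P : probability T R) A :
  measurable A -> 0 <= fine (P A) <= 1.
Proof.
move=> mA; rewrite fine_ge0 ?measure_ge0//= -lee_fin fineK ?probability_le1//.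
exact: fin_num_measure.
Qed.

Lemma act_density n m (B : 'M[R]_(n, m)) (A : set (n.-tuple R)) :
  B *m B^T \in unitmx -> measurable A ->
  exists2 c : R, 0 < c &
   N m [set z | A (act B z)] = (c%:E * \int[N n]_(y in A) gdens (invmx (B *m B^T)) y)%E
   /\ (1 = c%:E * \int[N n]_y gdens (invmx (B *m B^T)) y)%E.
Proof.
move=> Su mA; have [c c0 H] := act_law Su; exists c => //; split.
  have mI : measurable_fun setT (fun y : n.-tuple R => (\1_A y)%:E : \bar R).
    by apply/measurable_EFinP; exact: measurable_indic.
  have := H _ mI; rewrite (_ : \int[N m]_z _ = N m [set z | A (act B z)])%E; last first.
    have mBA : measurable [set z | A (act B z)].
      by have := measurable_act B measurableT mA; rewrite setTI.
    by apply: (etrans (integral_indic (N m) measurableT mBA)); rewrite setIT.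
  move=> ->; last by move=> z; rewrite lee_fin indicE.
  apply: (congr1 (mule c%:E)); rewrite [RHS]integral_mkcond.
  apply: eq_integral => y _; rewrite patchE indicE.
  by case: (y \in A); rewrite ?mul1e ?mul0e.
have := H (cst 1%E) (@measurable_cst _ _ _ _ _ _) (fun=> lee01).
rewrite integral_std_normal_cst => {1}->; apply: (congr1 (mule c%:E)).
by apply: eq_integral => y _; rewrite mul1e.
Qed.

Section fixed.
Variables (n m : nat) (B : 'M[R]_(n, m)) (E : 'M[R]_n) (e : R).
Hypothesis BE : B *m B^T = 1%:M + E.
Hypothesis e0 : 0 <= e.
Hypothesis Ee : forall i j, `|E i j| <= e.
Hypothesis ne : n%:R * e <= 1 / 2.
Hypothesis n2e : (n ^ 2)%:R * e <= 1 / 8.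

Let W := invmx (1%:M + E).
Let u (y : n.-tuple R) := (sum_sqr y - qform W y) / 2.
Let k1 : R := (n ^ 2)%:R.
Let k2 : R := (n ^ 2)%:R * n%:R.
Let c1 := 256 * k1 ^+ 2 + 4 * k2.

Let uE y : u y = 2^-1 * qform (1%:M - W) y.
Proof. by rewrite qformB qform1 /u mulrC. Qed.

Let u_bound y : `|u y| <= k1 * e * sum_sqr y.
Proof.
have e2 : 0 <= 2 * e by rewrite mulr_ge0.
have := qform_bound y e2 (perturb_inv1 Ee ne).
rewrite uE normrM ger0_norm// /k1; set q := `|_|; set s := sum_sqr y => h.
by rewrite ler_pdivrMl//; apply: (le_trans h); rewrite le_eqVlt; apply/orP; left; apply/eqP; ring.
Qed.

Let u_bound2 y : `|u y - 2^-1 * qform E y| <= k2 * e ^+ 2 * sum_sqr y.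
Proof.
have e2 : 0 <= 2 * n%:R * e ^+ 2 by rewrite !mulr_ge0.
have := qform_bound y e2 (perturb_inv2 Ee ne).
rewrite uE -mulrBr -qformB normrM ger0_norm// /k2; set q := `|_|; set s := sum_sqr y => h.
by rewrite ler_pdivrMl//; apply: (le_trans h); rewrite le_eqVlt; apply/orP; left; apply/eqP; ring.
Qed.

Let measurable_u : measurable_fun setT u.
Proof.
by apply: measurable_funM => //; apply: measurable_funB;
  [exact: measurable_sum_sqr|exact: measurable_qform].
Qed.

Let h y := expR (u y) - 1 - 2^-1 * qform E y.

Let mqE : measurable_fun setT (fun y => 2^-1 * qform E y).
Proof. by apply: measurable_funM => //; exact: measurable_qform. Qed.

Let mexpu : measurable_fun setT (fun y => expR (u y)).
Proof. exact: measurableT_comp measurable_u. Qed.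

Let mh : measurable_fun setT h.
Proof. by apply: measurable_funB mqE; exact: measurable_funB. Qed.

Let h_bound y : `|h y| <= c1 * e ^+ 2 * expR (sum_sqr y / 4).
Proof.
have k20 : 0 <= k2 by rewrite mulr_ge0.
exact: (expR_pointwise (sum_sqr_ge0 y) (ler0n _ _) k20 e0 (u_bound y) (u_bound2 y) n2e).
Qed.

Let expu_bound y : `|expR (u y)| <= 1 * expR (sum_sqr y / 4).
Proof.
rewrite ger0_norm ?expR_ge0// mul1r ler_expR.
have := u_bound y; rewrite ler_norml => /andP[_ ub].
apply: (le_trans ub); have s0 := sum_sqr_ge0 y.
by rewrite mulrC ler_wpM2l//; apply: (le_trans n2e); lra.
Qed.

Let qE_bound y : `|qform E y| <= 4 * k1 * e * expR (sum_sqr y / 4).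
Proof.
apply: (le_trans (qform_bound y e0 Ee)).
rewrite -/k1; have := sum_sqr_le_exp y; set s := sum_sqr y; set x := expR _ => sx.
have k0 : 0 <= k1 * e by rewrite mulr_ge0// ler0n.
by have := ler_wpM2l k0 sx; lra.
Qed.

Let c10 : 0 <= c1.
Proof.
apply: addr_ge0; apply: mulr_ge0; rewrite ?ler0n ?sqr_ge0//.
by apply: mulr_ge0; exact: ler0n.
Qed.

Let Rint_expu D : measurable D ->
  `|\int[N n]_(y in D) expR (u y) -
    (fine (N n D) + 2^-1 * \int[N n]_(y in D) qform E y)| <= c1 * e ^+ 2 * expq n.
Proof.
move=> mD.
have ih := integrable_dominated mh h_bound mD.
have iq := integrable_dominated (measurable_qform E) qE_bound mD.
have ik : (N n).-integrable D (EFin \o cst 1) by exact: finite_measure_integrable_cst.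
have iq2 := integrableZl mD 2^-1 iq.
have -> : \int[N n]_(y in D) expR (u y) =
   \int[N n]_(y in D) (h y + (1 + 2^-1 * qform E y)).
  by apply: eq_Rintegral => y _; rewrite /h; ring.
rewrite (RintegralD (f1 := h) (f2 := fun y => 1 + 2^-1 * qform E y) mD ih
  (integrableD mD ik iq2)).
rewrite (RintegralD (f1 := cst 1) (f2 := fun y => 2^-1 * qform E y) mD ik iq2).
rewrite (RintegralZl (f := qform E) _ mD iq) Rintegral_cst// mul1r addrK.
have H := Rintegral_dominated mh h_bound mD; exact: H.
Qed.

Let Rint_qE D : measurable D -> `|\int[N n]_(y in D) qform E y| <= 4 * k1 * e * expq n.
Proof.
by move=> mD; have H := Rintegral_dominated (measurable_qform E) qE_bound mD; exact: H.
Qed.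

Let Rint_qE_T : \int[N n]_y qform E y = \tr E.
Proof.
rewrite Rintegral_qform//; apply: eq_bigr => i _.
rewrite (bigD1 i)//= big1 => [|j ji]; first by rewrite addr0 Rintegral_mul eqxx mulr1.
by rewrite Rintegral_mul eq_sym (negbTE ji) mulr0.
Qed.

Let tr_bound : `|\tr E| <= n%:R * e.
Proof.
apply: (le_trans (ler_norm_sum _ _ _)).
apply: (@le_trans _ _ (\sum_(i < n) e)); first exact: ler_sum.
by rewrite sumr_const card_ord mulr_natl.
Qed.

Lemma first_order_error (A : set (n.-tuple R)) : measurable A -> e <= 1 ->
  `|fine (N m [set z | A (act B z)]) - first_order E A| <=
  (2 * c1 * expq n + (2 * k1 * expq n + n%:R + 2 * c1 * expq n) * n%:R) * e ^+ 2.
Proof.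
move=> mA e1.
have Su : B *m B^T \in unitmx by rewrite BE; exact: perturb_unit Ee ne.
have [c c0] := act_density Su mA; rewrite BE -/W.
have gE : gdens W = EFin \o (fun y => expR (u y)) by [].
rewrite gE => -[PE TE].
set P := fine _; set p := \int[N n]_(y in A) expR (u y); set D := \int[N n]_y expR (u y).
have iA := integrable_dominated mexpu expu_bound mA.
have iT := integrable_dominated mexpu expu_bound measurableT.
have PpD : P * D = p.
  have Pp : P = c * p.
    by rewrite /P PE /p /Rintegral fineM//; exact: integrable_fin_num.
  have D1 : 1 = c * D.
    by have := congr1 fine TE; rewrite fineM//; exact: integrable_fin_num.
  by rewrite Pp mulrAC -D1 mul1r.
have P01 : 0 <= P <= 1.
  apply: probability_fine_itv.
  by have := measurable_act B measurableT mA; rewrite setTI.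
have a01 := probability_fine_itv (N n) mA.
have hp := Rint_expu mA; have hD := Rint_expu measurableT.
rewrite Rint_qE_T in hD.
have NT : fine (N n [set: n.-tuple R]) = 1.
  by have := @probability_setT _ _ _ (N n) => ->.
rewrite NT -/D in hD; rewrite -/p in hp.
have hb := Rint_qE mA; have ht := tr_bound.
rewrite /first_order; move: PpD P01 a01 hp hD hb ht.
set a := fine (N n A); set b := Rintegral _ _ _; set t := \tr E.
have x0 : 0 <= c1 * e ^+ 2 * expq n by rewrite !mulr_ge0 ?sqr_ge0// ltW// expq_gt0.
move: (expq n) (expq_gt0 (R := R) n) x0 => G G0.
set x := c1 * e ^+ 2 * G => x0 PpD /andP[P0 P1] /andP[a0 a1] hp hD hb ht.
(* [P D = p] with [p = a + b / 2 + rA] and [D = 1 + t / 2 + r]. *)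
pose rA := p - (a + 2^-1 * b); pose r := D - (1 + 2^-1 * t).
(* The product (P - a) t / 2 counts as second order because P - a is itself of order e, by [Pab]. *)
have PE' : P - (a + 2^-1 * (b - t * a)) = rA - P * r - (P - a) * (2^-1 * t).
  by rewrite /rA /r -PpD; ring.
have Pa : P - a = 2^-1 * b + rA - P * r - P * (2^-1 * t).
  by rewrite /rA /r -PpD; ring.
have Pr : `|P * r| <= x by rewrite normrM (ger0_norm P0) -[leRHS]mul1r; exact: ler_pM.
have Pt : `|P * (2^-1 * t)| <= n%:R * e.
  rewrite normrM (ger0_norm P0) -[leRHS]mul1r; apply: ler_pM => //.
  by rewrite normrM ger0_norm//; have := normr_ge0 t; lra.
have tn : `|2^-1 * t| <= n%:R * e by rewrite normrM ger0_norm//; have := normr_ge0 t; lra.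
have Pab : `|P - a| <= 2 * k1 * e * G + n%:R * e + 2 * x.
  have hb' : `|2^-1 * b| <= 2 * k1 * e * G by rewrite normrM ger0_norm//; lra.
  rewrite Pa; apply: (le_trans (ler_normB _ _)).
  have := ler_normB (2^-1 * b + rA) (P * r); have := ler_normD (2^-1 * b) rA.
  by rewrite -/rA in hp; move=> h1 h2; lra.
have xe : x <= c1 * G * e.
  have -> : x = c1 * G * e * e by rewrite /x; ring.
  by rewrite ler_piMr// !mulr_ge0// ltW.
have ne0 : 0 <= n%:R * e by rewrite mulr_ge0.
have Pabt : `|(P - a) * (2^-1 * t)| <= (2 * k1 * e * G + n%:R * e + 2 * (c1 * G * e)) * (n%:R * e).
  by rewrite normrM; apply: ler_pM => //; apply: (le_trans Pab); lra.
rewrite PE'; apply: (le_trans (ler_normB _ _)).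
have h1 := ler_normB rA (P * r).
rewrite -/rA in hp.
have -> : (2 * c1 * G + (2 * k1 * G + n%:R + 2 * c1 * G) * n%:R) * e ^+ 2 =
   x + x + (2 * k1 * e * G + n%:R * e + 2 * (c1 * G * e)) * (n%:R * e).
  by rewrite /x; ring.
by apply: lerD => //; apply: (le_trans h1); exact: lerD.
Qed.

End fixed.

Lemma gaussian_expansion n : exists C d : R, [/\ 0 < C, 0 < d &
  forall m (B : 'M[R]_(n, m)) (E : 'M[R]_n) e A,
    B *m B^T = 1%:M + E -> 0 <= e <= d -> (forall i j, `|E i j| <= e) ->
    measurable A ->
    `|fine (N m [set z | A (act B z)]) - first_order E A| <= C * e ^+ 2].
Proof.
pose k1 : R := (n ^ 2)%:R; pose c1 : R := 256 * k1 ^+ 2 + 4 * (k1 * n%:R).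
pose C : R := 2 * c1 * expq n + (2 * k1 * expq n + n%:R + 2 * c1 * expq n) * n%:R.
have G0 := expq_gt0 (R := R) n.
have k10 : 0 <= k1 by exact: ler0n.
have n0 : 0 <= n%:R :> R by exact: ler0n.
have kn : k1 = n%:R * n%:R by rewrite /k1 -mulnn natrM.
have c10 : 0 <= c1.
  apply: addr_ge0; apply: mulr_ge0; rewrite ?ler0n ?sqr_ge0//.
  exact: mulr_ge0.
have C0 : 0 <= C by rewrite !(addr_ge0, mulr_ge0)// ltW.
(* Small enough for the three conditions n e <= 1/2, n^2 e <= 1/8 and e <= 1 at once. The constant
   below is [C + 1] because [C] vanishes for n = 0. *)
pose d : R := (8 * (1 + n%:R + k1))^-1.
have d0 : 0 < d by rewrite invr_gt0; lra.
have dE : d * (8 * (1 + n%:R + k1)) = 1 by rewrite mulVf//; lra.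
exists (C + 1), d; split => //; first by lra.
move=> m B E e A BE /andP[e0 ed] Ee mA.
have h1 : n%:R * e <= 1 / 2 by nra.
have h2 : (n ^ 2)%:R * e <= 1 / 8 by rewrite -/k1; nra.
have h3 : e <= 1 by nra.
apply: (le_trans (first_order_error BE e0 Ee h1 h2 mA h3)).
rewrite -/k1 -/c1 -/C ler_wpM2r ?sqr_ge0//; lra.
Qed.

End gaussian_expansion.

(** * The Student law and its first-order correction *)

Section student_law.
Context {R : realType}.
Local Notation N := (@std_normal R).

#[local] Opaque std_normal.

(** The reflection that exchanges the first basis vector with the unit vector of equal coordinates
    s, along their difference v with |v|^2 = 2 (1 - s). For k = 0 the two vectors coincide and v =
    0. *)
Lemma householder_mean k : (1 <= k)%N -> exists Q : 'M[R]_k.+1,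
  Q *m Q^T = 1%:M /\ forall j, Q ord0 j = (Num.sqrt k.+1%:R)^-1.
Proof.
move=> k1; pose s : R := (Num.sqrt k.+1%:R)^-1.
have s2 : k.+1%:R * s ^+ 2 = 1.
  by rewrite exprVn sqr_sqrtr ?ler0n// divff// pnatr_eq0.
have s1 : 1 - s != 0.
  apply/negP => /eqP/subr0_eq sE; move: s2; rewrite -sE expr1n mulr1 => /eqP.
  by rewrite -[1]/(1%:R) eqr_nat eqSS; case: k k1 {s sE}.
pose v : 'cV[R]_k.+1 := \col_j ((j == ord0)%:R - s).
have vv : v^T *m v = (2 * (1 - s))%:M.
  apply/matrixP => i j; rewrite !ord1 !mxE eqxx mulr1n.
  under eq_bigr do rewrite !mxE -expr2.
  rewrite big_ord_recl/= ?eqxx ?mulr1n.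
  under eq_bigr do rewrite ?mulr0n sub0r sqrrN.
  rewrite sumr_const card_ord -[s ^+ 2 *+ _]mulr_natl.
  have -> : k%:R = k.+1%:R - 1 :> R by rewrite -addn1 natrD addrK.
  by rewrite mulrBl s2 mul1r; ring.
pose Q : 'M[R]_k.+1 := 1%:M - (1 - s)^-1 *: (v *m v^T).
have QT : Q^T = Q by rewrite /Q linearB/= trmx1 linearZ/= trmx_mul trmxK.
exists Q; split; last first.
  move=> j; rewrite !mxE big_ord1 !mxE eqxx mulrA mulVf// mul1r -/s.
  by rewrite [ord0 == j]eq_sym opprB addrC subrK.
have PP : (v *m v^T) *m (v *m v^T) = (2 * (1 - s)) *: (v *m v^T).
  by rewrite mulmxA -(mulmxA v) vv mul_mx_scalar scalemxAl.
rewrite QT /Q mulmxBl mul1mx mulmxBr mulmx1 -scalemxAl -scalemxAr PP !scalerA.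
move: (v *m v^T) => V; apply/matrixP => i j; rewrite !mxE.
by field.
Qed.

Definition ysum n (y : n.-tuple R) : R := \sum_i tnth y i.

Definition root_mean n (y : n.-tuple R) : R := Num.sqrt n%:R * (n%:R^-1 * ysum y).

Definition sq_dev n (y : n.-tuple R) : R :=
  \sum_i (tnth y i - n%:R^-1 * ysum y) ^+ 2.

Lemma sq_devE k (y : k.+1.-tuple R) :
  sq_dev y = sum_sqr y - root_mean y ^+ 2.
Proof.
rewrite /sq_dev; under eq_bigr do rewrite sqrrB.
rewrite big_split/= sumrB sumr_const card_ord -/(sum_sqr y) /root_mean.
rewrite sumrMnl -mulr_suml -/(ysum y).
rewrite [in RHS]exprMn sqr_sqrtr ?ler0n//.
rewrite -[X in _ + X = _]mulr_natl.
have : k.+1%:R != 0 :> R by rewrite pnatr_eq0.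
by move: (k.+1%:R) => m m0; field.
Qed.

Lemma measurable_ysum n : measurable_fun setT (@ysum n).
Proof. by apply: measurable_sum => i; exact: measurable_tnth. Qed.

Lemma measurable_root_mean n : measurable_fun setT (@root_mean n).
Proof.
by apply: measurable_funM => //; apply: measurable_funM => //; exact: measurable_ysum.
Qed.

Lemma measurable_sq_dev n : measurable_fun setT (@sq_dev n).
Proof.
apply: measurable_sum => i; apply: measurable_funX; apply: measurable_funB.
  exact: measurable_tnth.
by apply: measurable_funM => //; exact: measurable_ysum.
Qed.

Lemma measurable_mean_dev n :
  measurable_fun setT (fun y : n.-tuple R => (root_mean y, sq_dev y)).
Proof. by apply: measurable_fun_pair; [exact: measurable_root_mean|exact: measurable_sq_dev]. Qed.

Local Open Scope ereal_scope.

(** Under [Q] the scaled mean becomes the first coordinate; since |y| is preserved, the squared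
    deviation becomes the sum of squares of the other k coordinates. *)
Lemma cochran k (F : R * R -> \bar R) : (1 <= k)%N ->
  measurable_fun setT F -> (forall p, 0 <= F p) ->
  \int[N k.+1]_y F (root_mean y, sq_dev y) = \int[normal01 \x chi2 k]_p F p.
Proof.
move=> k1 mF F0; have [Q [QQ Q0]] := householder_mean k1.
pose h (w : k.+1.-tuple R) : R * R := (tnth w ord0, sum_sqr w - tnth w ord0 ^+ 2)%R.
have mh : measurable_fun setT h.
  apply: measurable_fun_pair; first exact: measurable_tnth.
  apply: measurable_funB; first exact: measurable_sum_sqr.
  by apply: measurable_funX; exact: measurable_tnth.
have mFh : measurable_fun setT (fun w => F (h w)) by exact: (measurableT_comp mF mh).
transitivity (\int[N k.+1]_w F (h w)).
  apply/esym; apply: (etrans (esym (act_orthogonal QQ mFh (fun w => F0 _)))).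
  apply: eq_integral => y _; congr (F _).
  have rE : tnth (act Q y) ord0 = root_mean y.
    rewrite tnth_mktuple; under eq_bigr do rewrite Q0.
    rewrite -mulr_sumr /root_mean /ysum mulrA; congr (_ * _)%R.
    have q0 : Num.sqrt (k.+1%:R : R) != 0%R by rewrite gt_eqF// sqrtr_gt0 ltr0n.
    have := sqr_sqrtr (ler0n R k.+1); move: (Num.sqrt _) q0 => q q0 <-.
    by field.
  by rewrite /h sum_sqr_act (mulmx1C QQ) qform1 rE sq_devE.
apply: (etrans (integral_std_normalS mFh (fun w => F0 _))).
rewrite (fubini_tonelli1 F mF F0); apply: eq_integral => x _.
rewrite /fubini_F ge0_integral_distribution//; last exact: (measurableT_comp mF).
apply: eq_integral => z _; rewrite /h /= sum_sqr_cons tnth0.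
by rewrite [(x ^+ 2 + _)%R]addrC addrK.
Qed.

Local Close Scope ereal_scope.

(** The one-sample t-statistic of the coordinates, for the hypothesis of mean 0. *)
Definition t_ratio n (y : n.-tuple R) : R :=
  root_mean y / Num.sqrt (n.-1%:R^-1 * sq_dev y).

Lemma t_ratioE k (y : k.+1.-tuple R) :
  t_ratio y = student_ratio k (root_mean y, sq_dev y).
Proof. by rewrite /t_ratio /student_ratio/= [k%:R^-1 * _]mulrC. Qed.

Definition t_event n (x : R) : set (n.-tuple R) := [set y | `|t_ratio y| <= x].

Definition st_event k (x : R) : set (R * R) := [set p | `|student_ratio k p| <= x].

Lemma measurable_st_event k x : measurable (st_event k x).
Proof.
rewrite [X in measurable X](_ : _ = (Num.norm \o student_ratio k) @^-1` `]-oo, x]); last first.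
  by apply/seteqP; split => p /=; rewrite in_itv.
rewrite -[X in measurable X]setTI.
have m : measurable_fun setT (Num.norm \o @student_ratio R k).
  by apply: measurableT_comp => //; exact: measurable_student_ratio.
exact: m.
Qed.

Lemma t_eventE k x : @t_event k.+1 x = (fun y => (root_mean y, sq_dev y)) @^-1` st_event k x.
Proof. by apply/seteqP; split => y; rewrite /t_event /st_event /= t_ratioE. Qed.

Lemma measurable_t_event k x : measurable (@t_event k.+1 x).
Proof.
rewrite t_eventE -[X in measurable X]setTI; apply: measurable_mean_dev => //.
exact: measurable_st_event.
Qed.

Lemma Rintegral_t_event k x (g : R * R -> R) : (1 <= k)%N ->
  measurable_fun setT g -> (forall p, 0 <= g p) ->
  \int[N k.+1]_(y in t_event x) g (root_mean y, sq_dev y) =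
  \int[(normal01 \x chi2 k)%E]_(p in st_event k x) g p.
Proof.
move=> k1 mg g0; rewrite /Rintegral [in LHS]integral_mkcond [in RHS]integral_mkcond.
apply: (congr1 fine).
have mG : measurable_fun setT ((EFin \o g) \_ (st_event k x)).
  apply/(measurable_restrictT _ (measurable_st_event k x)).
  exact/measurable_funTS/measurable_EFinP.
have G0 p : (0 <= ((EFin \o g) \_ (st_event k x)) p)%E.
  by rewrite patchE; case: ifP => // _; rewrite lee_fin.
rewrite -(cochran k1 mG G0); apply: eq_integral => y _.
by rewrite !patchE t_eventE; congr (if _ then _ else _).
Qed.

Lemma t_event_student k x : (1 <= k)%N ->
  fine (N k.+1 (t_event x)) = fine (student k [set t : R | `|t| <= x]).
Proof.
move=> k1; have := @Rintegral_t_event k x (cst 1) k1 (@measurable_cst _ _ _ _ _ _) (fun=> ler01).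
rewrite !Rintegral_cst ?mul1r//; [exact: measurable_st_event|exact: measurable_t_event].
Qed.

End student_law.

(** * The chi-square expectations in [Upsilon] as moments over the t-event *)

Section upsilon.
Context {R : realType}.
Local Notation N := (@std_normal R).

#[local] Opaque std_normal.

(** At v = 0 the division by zero makes the ratio 0, so the left side always holds while the right
    side fails for x != 0; hence the condition 0 < v, whose complement is a null event. *)
Lemma student_ratio_le k (x v r : R) : (1 <= k)%N -> 0 < v -> 0 <= r ->
  (`|student_ratio k (x, v)| <= r) = (x ^+ 2 <= v * r ^+ 2 / k%:R).
Proof.
move=> k1 v0 r0; have k0 : 0 < k%:R :> R by rewrite ltr0n.
have w0 : 0 < v / k%:R by rewrite divr_gt0.
rewrite /student_ratio/= normrM normfV (ger0_norm (sqrtr_ge0 _)).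
rewrite ler_pdivrMr ?sqrtr_gt0// -ler_sqr ?nnegrE ?mulr_ge0 ?sqrtr_ge0//.
rewrite real_normK ?num_real// exprMn sqr_sqrtr ?(ltW w0)//.
by congr (_ <= _); ring.
Qed.

Lemma measurable_le_cst (y : \bar R) : measurable [set v : R | (v%:E <= y)%E].
Proof.
case: y => [r||].
- rewrite (_ : [set v | _] = `]-oo, r]%classic); first exact: measurable_itv.
  by apply/seteqP; split => v /=; rewrite in_itv/= lee_fin.
- rewrite (_ : [set v | _] = setT)//.
  by apply/seteqP; split => v //= _; exact: leey.
- rewrite (_ : [set v | _] = set0)//.
  by apply/seteqP; split => v.
Qed.

Lemma chi2_cdf_itv k (y : \bar R) : 0 <= chi2_cdf k y <= 1.
Proof. by apply: probability_fine_itv; exact: measurable_le_cst. Qed.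

Lemma measurable_chi2_cdf k : measurable_fun setT (fun r : R => chi2_cdf k r%:E : R).
Proof.
apply: nondecreasing_measurable => // s t st.
apply: fine_le; rewrite ?fin_num_measure//; try exact: measurable_le_cst.
apply: le_measure; rewrite ?inE; try exact: measurable_le_cst.
by move=> v /= vs; apply: (le_trans vs); rewrite lee_fin.
Qed.

Local Open Scope ereal_scope.

(** Since v h(v) may be negative for v < 0, the transfer along the law of [sum_sqr] goes through
    integrability, which the bound on h provides. *)
Lemma expectation_chi2 k (h : R -> R) : measurable_fun setT h ->
  (forall v, 0 <= h v <= 1)%R ->
  'E_(chi2 k)[fun v => (v * h v)%R] =
  \int[N k]_z (sum_sqr z * h (sum_sqr z))%:E.
Proof.
move=> mh h01; rewrite unlock.
have mf : measurable_fun setT (fun v : R => v * h v)%R by exact: measurable_funM.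
have mfs : measurable_fun setT (fun z : k.-tuple R => sum_sqr z * h (sum_sqr z))%R.
  exact: (measurableT_comp mf (@measurable_sum_sqr R k)).
have bd (z : k.-tuple R) :
    (`|sum_sqr z * h (sum_sqr z)| <= 4 * expR (sum_sqr z / 4))%R.
  have /andP[h0 h1] := h01 (sum_sqr z); have s0 := sum_sqr_ge0 z.
  rewrite ger0_norm ?mulr_ge0//; apply: le_trans (sum_sqr_le_exp z).
  by rewrite ler_piMr.
rewrite integral_distribution//; first exact/measurable_EFinP.
have H := integrable_dominated mfs bd measurableT; exact: H.
Qed.

Lemma integral_std_normal1 (f : R -> \bar R) : measurable_fun setT f ->
  (forall v, (0 <= v)%R -> 0 <= f v) ->
  \int[N 1]_z f (sum_sqr z) = \int[normal01]_x f (x ^+ 2)%R.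
Proof.
move=> mf f0.
have mfs := measurableT_comp mf (@measurable_sum_sqr R 1).
apply: (etrans (integral_std_normalS mfs _)).
  by move=> z; apply: f0; exact: sum_sqr_ge0.
apply: eq_integral => x _; rewrite integral_std_normal0 /= sum_sqr_cons.
by rewrite /sum_sqr big_ord0 addr0.
Qed.

Lemma normal01_set1 (a : R) : normal01 [set a] = 0.
Proof.
have /null_content_dominatesP H := @normal_prob_dominates R 0%R 1%R.
have := H [set a] (measurable_set1 a) (lebesgue_measure_set1 a).
by [].
Qed.

Lemma normal01_sqr_eq (c : R) : normal01 [set x : R | (x ^+ 2 = c)%R] = 0.
Proof.
have sub : [set x : R | (x ^+ 2 = c)%R] `<=` [set Num.sqrt c] `|` [set (- Num.sqrt c)%R].
  move=> x /= <-; rewrite sqrtr_sqr.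
  have [x0|x0] := leP 0%R x; [left|right] => /=; first by rewrite ger0_norm.
  by rewrite ltr0_norm// opprK.
apply/eqP; rewrite eq_le measure_ge0 andbT.
have ms (a : R) : measurable [set a] by exact: measurable_set1.
have mX : measurable [set x : R | (x ^+ 2 = c)%R].
  rewrite -[X in measurable X]setTI.
  have m : measurable_fun setT (fun x : R => x ^+ 2)%R by exact: measurable_funX.
  exact: (m measurableT _ (ms c)).
apply: (@le_trans _ _ (normal01 ([set Num.sqrt c] `|` [set (- Num.sqrt c)%R]))).
  by apply: le_measure => //; rewrite inE//; exact: measurableU.
apply: (le_trans (measureU2 _ _ _)) => //.
rewrite -[leRHS]adde0; have le0 a : normal01 [set a] <= 0 :> \bar R.
  by have H := normal01_set1 a; rewrite le_eqVlt; apply/orP; left; apply/eqP; exact: H.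
by apply: leeD; exact: le0.
Qed.

(** Once all coordinates but the first are fixed, x^2 = c - |y|^2 has at most two solutions, which
    form a null set. For k = 0 the law is a point mass at 0. *)
Lemma chi2_set1 k (c : R) : (1 <= k)%N -> chi2 k [set c] = 0.
Proof.
case: k => // k _.
have mP : measurable_fun setT (fun z : k.+1.-tuple R => (\1_[set c] (sum_sqr z))%:E : \bar R).
  apply/measurable_EFinP; apply: measurableT_comp; last exact: measurable_sum_sqr.
  exact: measurable_indic.
transitivity (\int[chi2 k.+1]_v (\1_[set c] v)%:E).
  by rewrite integral_indic// setIT.
rewrite ge0_integral_distribution//; last exact/measurable_EFinP/measurable_indic.
apply: (etrans (integral_std_normalS_swap mP _)) => //.
apply: integral0_eq => y _.
transitivity (\int[normal01]_x (\1_[set x : R | (x ^+ 2 = c - sum_sqr y)%R] x)%:E).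
  apply: eq_integral => x _; rewrite sum_sqr_cons !indicE;
  congr (EFin (GRing.natmul 1 (nat_of_bool _))).
  by apply/idP/idP; rewrite !inE/=; [move=> <-|move=> ->]; rewrite ?addrK ?subrK.
rewrite integral_indic//; last first.
  rewrite -[X in measurable X]setTI.
  have m : measurable_fun setT (fun x : R => x ^+ 2)%R by exact: measurable_funX.
  exact: (m measurableT _ (measurable_set1 _)).
by rewrite setIT; have H := normal01_sqr_eq (c - sum_sqr y); exact: H.
Qed.

Lemma chi2_le0 k : (1 <= k)%N -> chi2 k [set v : R | (v <= 0)%R] = 0.
Proof.
move=> k1; rewrite -(chi2_set1 0 k1).
rewrite /chi2 /distribution /pushforward; congr (N k _).
apply/seteqP; split => z /=; last by move=> ->.
by move=> h; apply/eqP; rewrite eq_le h sum_sqr_ge0.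
Qed.

Local Close Scope ereal_scope.

End upsilon.

Section upsilon_moments.
Context {R : realType}.
Local Notation N := (@std_normal R).

#[local] Opaque std_normal.

Lemma sq_dev_ge0 n (y : n.-tuple R) : 0 <= sq_dev y.
Proof. by apply: sumr_ge0 => i _; exact: sqr_ge0. Qed.

Local Open Scope ereal_scope.

Lemma chi2_1E (A : set R) : measurable A ->
  chi2 1 A = \int[normal01]_x (\1_A (x ^+ 2))%:E.
Proof.
move=> mA.
have mI : measurable_fun setT (fun v : R => (\1_A v)%:E : \bar R).
  exact/measurable_EFinP/measurable_indic.
transitivity (\int[chi2 1]_v (\1_A v)%:E).
  by rewrite integral_indic// setIT.
rewrite ge0_integral_distribution//.
by apply: (etrans (integral_std_normal1 mI _)).
Qed.

Lemma measurable_patch_st_event k r (g : R * R -> R) :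
  measurable_fun setT g -> measurable_fun setT ((EFin \o g) \_ (st_event k r)).
Proof.
move=> mg; apply/(measurable_restrictT _ (measurable_st_event k r)).
exact/measurable_funTS/measurable_EFinP.
Qed.

(** For s > 0 the section of the event is a bound on x^2. At s = 0 this description fails, but the
    weight s vanishes. *)
Lemma integral_sq_dev_section k (r s : R) : (1 <= k)%N -> (0 <= r)%R -> (0 <= s)%R ->
  \int[normal01]_x ((EFin \o (fun p : R * R => `|p.2|%R)) \_ (st_event k r)) (x, s) =
  (s * chi2_cdf 1 (s * r ^+ 2 / k%:R)%:E)%:E.
Proof.
move=> k1 r0; rewrite le_eqVlt => /orP[/eqP <-|s0].
  rewrite mul0r; apply: integral0_eq => x _; rewrite patchE.
  by case: ifP => // _ /=; rewrite normr0.
set c := (s * r ^+ 2 / k%:R)%R.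
have mA := measurable_le_cst (c%:E).
rewrite EFinM /chi2_cdf fineK ?fin_num_measure// (chi2_1E mA).
rewrite -(ge0_integralZl_EFin normal01 measurableT _ _ (ltW s0)); last 2 first.
- by move=> x _; rewrite lee_fin.
- apply/measurable_EFinP; apply: measurableT_comp; last exact: measurable_funX.
  exact: measurable_indic.
apply: eq_integral => x _; rewrite patchE indicE.
have -> : ((x, s) \in st_event k r) = ((x ^+ 2)%R \in [set v : R | v%:E <= c%:E]).
  apply/idP/idP; rewrite !inE /st_event /= student_ratio_le// lee_fin.
by case: ifP => _ /=; rewrite ?mule1 ?mule0// gtr0_norm.
Qed.

Lemma sq_dev_moment k (r : R) : (1 <= k)%N -> (0 <= r)%R ->
  (\int[N k.+1]_(y in t_event r) sq_dev y)%R =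
  fine 'E_(chi2 k)[fun v : R => (v * chi2_cdf 1 (v * r ^+ 2 / k%:R)%:E)%R].
Proof.
move=> k1 r0.
have mg : measurable_fun setT (fun p : R * R => `|p.2|%R).
  by apply: measurableT_comp.
(* The absolute value makes the integrand nonnegative on the whole plane, as Tonelli's theorem
   requires. *)
transitivity (\int[N k.+1]_(y in t_event r) `|sq_dev y|)%R.
  by apply: eq_Rintegral => y _; rewrite ger0_norm// sq_dev_ge0.
rewrite (@Rintegral_t_event R k r (fun p => `|p.2|%R))//.
rewrite /Rintegral; apply: (congr1 fine); rewrite integral_mkcond.
have mF := measurable_patch_st_event k r mg.
set F := (_ \_ _) in mF *.
have F0 p : 0 <= F p by rewrite /F patchE; case: ifP => // _ /=; rewrite lee_fin.
have mh : measurable_fun setT (fun v : R => chi2_cdf 1 (v * r ^+ 2 / k%:R)%:E : R).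
  apply: (measurableT_comp (measurable_chi2_cdf 1)).
  by apply: measurable_funM => //; exact: measurable_funM.
apply: (etrans _ (esym (expectation_chi2 k mh (fun v => chi2_cdf_itv 1 _)))).
have mG := measurable_fun_fubini_tonelli_G (m1 := normal01) F mF F0.
rewrite (fubini_tonelli2 F mF F0) ge0_integral_distribution//; last first.
  by move=> v; apply: integral_ge0 => x _; exact: F0.
apply: eq_integral => z _; apply: integral_sq_dev_section => //.
exact: sum_sqr_ge0.
Qed.

(** The argument of [chi2_cdf] in the last expectation of [Upsilon], extended so that r = 0 is
    included. *)
Definition inv_level k (r u : R) : \bar R :=
  if r == 0%R then +oo else (k%:R * u / r ^+ 2)%:E.

Lemma measurable_inv_level k r : measurable_fun setT (fun u => chi2_cdf k (inv_level k r u) : R).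
Proof.
rewrite /inv_level; case: eqP => // _.
apply: (measurableT_comp (measurable_chi2_cdf k)).
by apply: measurable_funM => //; exact: measurable_funM.
Qed.

(** For fixed x, the event reads v >= k x^2 / r^2, whose complement is counted by the distribution
    function up to a null set. At r = 0 the event is null and the level is +oo, in accordance with
    the convention in [Upsilon]. *)
Lemma chi2_st_section k (r x : R) : (1 <= k)%N -> (0 <= r)%R -> x != 0%R ->
  chi2 k [set v | st_event k r (x, v)] + (chi2_cdf k (inv_level k r (x ^+ 2)))%:E = 1.
Proof.
move=> k1 r0 x0.
have mA : measurable [set v | st_event k r (x, v)].
  have m : measurable_fun setT (fun v : R => (x, v)) by exact: measurable_pair1.
  by have := m measurableT _ (measurable_st_event k r); rewrite setTI.
have mB := measurable_le_cst (inv_level k r (x ^+ 2)).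
rewrite /chi2_cdf fineK ?fin_num_measure//.
set A := [set v | st_event k r (x, v)] in mA *.
set B := [set v | _] in mB *.
pose c := (k%:R * x ^+ 2 / r ^+ 2)%R.
pose Z := [set v : R | (v <= 0)%R] `|` [set c].
have mneg : measurable [set v : R | (v <= 0)%R].
  by have := measurable_le_cst (0%:E : \bar R).
have mZ : measurable Z by exact: measurableU.
have Z0 : chi2 k Z <= 0.
  apply: (le_trans (measureU2 _ mneg (measurable_set1 c))).
  have h1 : chi2 k [set v : R | (v <= 0)%R] = 0 by exact: chi2_le0.
  have h2 : chi2 k [set c] = 0 by exact: chi2_set1.
  by apply: (@le_trans _ _ (0 + 0));
    [apply: leeD; rewrite le_eqVlt; apply/orP; left; apply/eqP|rewrite adde0].
have key v : (0 < v)%R -> v != c -> A v <-> ~ B v.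
  move=> v0 vc; rewrite /A /B /st_event /= student_ratio_le// /inv_level.
  have k0 : (0 < k%:R :> R)%R by rewrite ltr0n.
  have x2 : (0 < x ^+ 2)%R by rewrite exprn_even_gt0.
  case: eqP => [->|/eqP r1].
    rewrite expr0n/= mulr0 mul0r leNgt x2; split => // h; exfalso; apply: h; exact: leey.
  have r2 : (0 < r ^+ 2)%R by rewrite exprn_even_gt0.
  rewrite lee_fin ler_pdivlMr// -/c.
  have -> : (x ^+ 2 * k%:R <= v * r ^+ 2)%R = (c <= v)%R.
    by rewrite /c ler_pdivrMr// [(k%:R * _)%R]mulrC.
  split; first by move=> cv /(conj cv)/andP; rewrite -eq_le eq_sym (negbTE vc).
  by move=> /negP; rewrite -ltNge => /ltW.
have AE : chi2 k A = chi2 k (~` B).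
  apply/eqP; rewrite eq_le; apply/andP; split.
    apply: (@le_trans _ _ (chi2 k (~` B `|` Z))).
      apply: le_measure; rewrite ?inE//; first exact: measurableU (measurableC mB) mZ.
      move=> v Av; have [v0|v0] := leP v 0%R; first by right; left.
      have [->|vc] := eqVneq v c; first by right; right.
      by left; apply/key.
    apply: (le_trans (measureU2 _ (measurableC mB) mZ)).
    by rewrite -[leRHS]adde0; apply: leeD; [exact: lexx|exact: Z0].
  apply: (@le_trans _ _ (chi2 k (A `|` Z))).
    apply: le_measure; rewrite ?inE//; [exact: measurableC|exact: measurableU|].
    move=> v Bv; have [v0|v0] := leP v 0%R; first by right; left.
    have [->|vc] := eqVneq v c; first by right; right.
    by left; apply/key.
  apply: (le_trans (measureU2 _ mA mZ)).
  by rewrite -[leRHS]adde0; apply: leeD; [exact: lexx|exact: Z0].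
rewrite AE probability_setC// subeK// fin_num_measure//.
Qed.

(** The integrals of x^2 over the event and over its complement add up to the second moment 1. This
    is the origin of the final 1 and of the minus sign in [Upsilon]. *)
Lemma root_mean_moment k (r : R) : (1 <= k)%N -> (0 <= r)%R ->
  (\int[N k.+1]_(y in t_event r) (root_mean y ^+ 2) =
  1 - fine ('E_(chi2 1)[fun v : R => (v * chi2_cdf k (inv_level k r v))%R])%E)%R.
Proof.
move=> k1 r0.
have mg : measurable_fun setT (fun p : R * R => p.1 ^+ 2)%R by exact: measurable_funX.
rewrite (@Rintegral_t_event R k r (fun p => p.1 ^+ 2)%R)//; last by move=> p; exact: sqr_ge0.
rewrite /Rintegral integral_mkcond.
have mF := measurable_patch_st_event k r mg.
set F := (_ \_ _) in mF *.
have F0 p : 0 <= F p by rewrite /F patchE; case: ifP => // _ /=; rewrite lee_fin sqr_ge0.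
have mh := measurable_inv_level k r.
have h0 u : (0 <= chi2_cdf k (inv_level k r u) :> R)%R.
  by have /andP[] := chi2_cdf_itv (R := R) k (inv_level k r u).
rewrite (expectation_chi2 1 mh (fun v => chi2_cdf_itv k _)).
have mq : measurable_fun setT (fun v : R => (v * chi2_cdf k (inv_level k r v))%:E).
  by apply/measurable_EFinP; exact: measurable_funM.
have -> : \int[N 1]_z (sum_sqr z * chi2_cdf k (inv_level k r (sum_sqr z)))%:E =
   \int[normal01]_x (x ^+ 2 * chi2_cdf k (inv_level k r (x ^+ 2)))%:E.
  apply: (integral_std_normal1 mq) => v v0.
  by rewrite lee_fin mulr_ge0.
rewrite (fubini_tonelli1 F mF F0).
have mG := measurable_fun_fubini_tonelli_F (m2 := chi2 k) F mF F0.
have G0 x : 0 <= fubini_F (chi2 k) F x by apply: integral_ge0 => v _; exact: F0.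
set H := fun x : R => (x ^+ 2 * chi2_cdf k (inv_level k r (x ^+ 2)))%:E.
have mH : measurable_fun setT H.
  by apply: (measurableT_comp mq); exact: measurable_funX.
have H0 x : 0 <= H x by rewrite lee_fin mulr_ge0// sqr_ge0.
have : \int[normal01]_x fubini_F (chi2 k) F x + \int[normal01]_x H x = 1.
  rewrite -(ge0_integralD normal01 measurableT (fun x _ => G0 x) mG (fun x _ => H0 x) mH).
  rewrite -(normal01_second_moment (R := R)); apply: eq_integral => x _.
  have FE : fubini_F (chi2 k) F x = (x ^+ 2)%:E * chi2 k [set v | st_event k r (x, v)].
    have mA : measurable [set v | st_event k r (x, v)].
      have m : measurable_fun setT (fun v : R => (x, v)) by exact: measurable_pair1.
      by have := m measurableT _ (measurable_st_event k r); rewrite setTI.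
    have mI : measurable_fun setT (fun v : R => (\1_[set v | st_event k r (x, v)] v)%:E : \bar R).
      exact/measurable_EFinP/measurable_indic.
    have I0 v : [set: R] v -> 0 <= (\1_[set v | st_event k r (x, v)] v)%:E :> \bar R.
      by rewrite lee_fin.
    transitivity ((x ^+ 2)%:E * \int[chi2 k]_v (\1_[set v | st_event k r (x, v)] v)%:E).
      rewrite -(ge0_integralZl_EFin (chi2 k) measurableT I0 mI (sqr_ge0 x)).
      apply: eq_integral => v _; rewrite /F patchE indicE.
      have -> : ((x, v) \in st_event k r) = (v \in [set v | st_event k r (x, v)]).
        by apply/idP/idP; rewrite !inE.
      by case: ifP => _ /=; rewrite ?mule1 ?mule0.
    by apply: (congr1 (mule _)); rewrite integral_indic// setIT.
  (* [chi2_st_section] excludes x = 0, where the weight x^2 vanishes. *)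
  rewrite FE /H; have [->|x0] := eqVneq x 0%R.
    by rewrite expr0n/= mul0r mul0e adde0.
  rewrite (EFinM (x ^+ 2) (chi2_cdf _ _)) -ge0_muleDr ?lee_fin ?h0//.
  by have -> := chi2_st_section k1 r0 x0; rewrite mule1.
have : 0 <= \int[normal01]_x fubini_F (chi2 k) F x by apply: integral_ge0 => x _.
have : 0 <= \int[normal01]_x H x by apply: integral_ge0 => x _; exact: H0.
move: (\int[normal01]_x H x) (\int[normal01]_x fubini_F (chi2 k) F x).
move=> [a||] [b||]//= _ _; rewrite -EFinD => -[<-].
by rewrite addrK.
Qed.

Lemma Upsilon_t_event k (r : R) : (1 <= k)%N -> (0 <= r)%R ->
  (Upsilon k.+1 r = - k.+1%:R ^+ 2 * fine (N k.+1 (t_event r))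
   + k.+2%:R * (\int[N k.+1]_(y in t_event r) sq_dev y)
   + \int[N k.+1]_(y in t_event r) (root_mean y ^+ 2))%R.
Proof.
move=> k1 r0; rewrite sq_dev_moment// root_mean_moment// t_event_student//.
by rewrite /Upsilon -[in RHS]addrA [in RHS](addrC 1%R) !addrA.
Qed.

End upsilon_moments.

(** * Permutation invariance and the evaluation of the first-order term *)

Section exchangeable.
Context {R : realType}.
Local Notation N := (@std_normal R).

#[local] Opaque std_normal.

Lemma act_perm n (s : {perm 'I_n}) (y : n.-tuple R) i :
  tnth (act (perm_mx s) y) i = tnth y (s i).
Proof.
rewrite tnth_mktuple (bigD1 (s i))//= big1 => [|j ji].
  by rewrite !mxE eqxx mul1r addr0.
by rewrite !mxE eq_sym (negbTE ji) mul0r.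
Qed.

Lemma ysum_perm n (s : {perm 'I_n}) (y : n.-tuple R) : ysum (act (perm_mx s) y) = ysum y.
Proof.
rewrite /ysum [RHS](reindex_inj (@perm_inj _ s))/=.
by apply: eq_bigr => i _; rewrite act_perm.
Qed.

Lemma sum_sqr_perm n (s : {perm 'I_n}) (y : n.-tuple R) :
  sum_sqr (act (perm_mx s) y) = sum_sqr y.
Proof.
rewrite /sum_sqr [RHS](reindex_inj (@perm_inj _ s))/=.
by apply: eq_bigr => i _; rewrite act_perm.
Qed.

Lemma sq_dev_perm n (s : {perm 'I_n}) (y : n.-tuple R) :
  sq_dev (act (perm_mx s) y) = sq_dev y.
Proof.
rewrite /sq_dev ysum_perm [RHS](reindex_inj (@perm_inj _ s))/=.
by apply: eq_bigr => i _; rewrite act_perm.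
Qed.

Lemma t_event_perm n (s : {perm 'I_n}) (y : n.-tuple R) x :
  (act (perm_mx s) y \in t_event x) = (y \in t_event x).
Proof.
by apply/idP/idP; rewrite !inE /t_event /= /t_ratio /root_mean ysum_perm sq_dev_perm.
Qed.

Section moments.
Variables (k : nat) (x : R).
Local Notation A := (@t_event R k.+1 x).

Let mA : measurable A := @measurable_t_event R k x.

Let isum : (N k.+1).-integrable A (EFin \o @sum_sqr R k.+1).
Proof.
have bd (y : k.+1.-tuple R) : `|sum_sqr y| <= 4 * expR (sum_sqr y / 4).
  by rewrite ger0_norm ?sum_sqr_ge0//; exact: sum_sqr_le_exp.
have H := integrable_dominated (@measurable_sum_sqr R k.+1) bd mA; exact: H.
Qed.

Definition t_moment (i j : 'I_k.+1) : R :=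
  \int[N k.+1]_(y in A) (tnth y i * tnth y j).

(** Orthogonal invariance is available for nonnegative integrands only. Adding [sum_sqr], which
    dominates |y_i y_j| and is itself invariant, achieves this and cancels afterwards. *)
Lemma t_moment_perm (s : {perm 'I_k.+1}) i j : t_moment (s i) (s j) = t_moment i j.
Proof.
pose g i j (y : k.+1.-tuple R) := tnth y i * tnth y j + sum_sqr y.
have gE i' j' : \int[N k.+1]_(y in A) g i' j' y = t_moment i' j' + \int[N k.+1]_(y in A) sum_sqr y.
  have H := RintegralD (f1 := fun y : k.+1.-tuple R => tnth y i' * tnth y j')
    (f2 := @sum_sqr R k.+1) mA (integrable_mul i' j' mA) isum.
  exact: H.
suff : \int[N k.+1]_(y in A) g (s i) (s j) y = \int[N k.+1]_(y in A) g i j y.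
  by rewrite !gE => /addIr.
rewrite Rintegral_mkcond [RHS]Rintegral_mkcond.
have mg i' j' : measurable_fun setT (g i' j').
  by apply: measurable_funD; [exact: measurable_mul_tnth|exact: measurable_sum_sqr].
have mf : measurable_fun setT ((g i j) \_ A).
  by apply/(measurable_restrictT _ mA); exact: measurable_funTS.
have f0 y : 0 <= ((g i j) \_ A) y.
  rewrite patchE; case: ifP => // _; rewrite /g.
  by have := mul_le_sum_sqr y i j; rewrite ler_norml => /andP[]; lra.
have PP : (perm_mx s : 'M[R]_k.+1) *m (perm_mx s)^T = 1%:M.
  by rewrite tr_perm_mx -perm_mxM mulgV perm_mx1.
rewrite -(act_orthogonalR PP mf f0); apply: eq_Rintegral => y _.
rewrite !patchE t_event_perm; case: ifP => // _.
by rewrite /g !act_perm sum_sqr_perm.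
Qed.

Lemma t_moment_diag i : t_moment i i = t_moment ord0 ord0.
Proof. by rewrite -(t_moment_perm (tperm i ord0)) tpermL. Qed.

Lemma t_moment_offdiag i j : i != j -> t_moment i j = t_moment ord0 ord_max.
Proof.
move=> ij; have [k0|k0] := eqVneq k 0%N.
  have z (l : 'I_k.+1) : val l = 0%N.
    by apply/eqP; rewrite -leqn0 -k0 -ltnS; exact: ltn_ord.
  by case/eqP: ij; apply/val_inj; rewrite !z.
have m0 : ord0 != ord_max :> 'I_k.+1 by rewrite -val_eqE /= eq_sym.
pose s := tperm i ord0; have si : s i = ord0 by rewrite tpermL.
rewrite -(t_moment_perm s) si.
have sj : s j != ord0 by rewrite -si (inj_eq perm_inj) eq_sym.
pose t := tperm (s j) ord_max.
rewrite -(t_moment_perm t) tpermL tpermD// eq_sym//.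
Qed.

Definition alpha : R := \int[N k.+1]_(y in A) (root_mean y ^+ 2).
Definition beta : R := \int[N k.+1]_(y in A) sq_dev y.

Lemma root_mean_sqr (y : k.+1.-tuple R) :
  root_mean y ^+ 2 = k.+1%:R^-1 * \sum_i \sum_j tnth y i * tnth y j.
Proof.
rewrite /root_mean exprMn sqr_sqrtr ?ler0n//.
have -> : \sum_i \sum_j tnth y i * tnth y j = ysum y ^+ 2.
  by rewrite expr2 /ysum mulr_suml; apply: eq_bigr => i _; rewrite mulr_sumr.
have : k.+1%:R != 0 :> R by rewrite pnatr_eq0.
by move: (k.+1%:R) => m m0; field.
Qed.

Let isumj i : (N k.+1).-integrable A (EFin \o (fun y => \sum_j tnth y i * tnth y j)).
Proof.
rewrite (_ : _ \o _ = fun y =>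
    (\sum_j (EFin \o (fun y : k.+1.-tuple R => tnth y i * tnth y j)%R) y)%E).
  by apply: integrable_sum => // j _; exact: integrable_mul.
by apply/funext => y /=; rewrite sumEFin.
Qed.

Lemma alphaE : k.+1%:R * alpha = \sum_i \sum_j t_moment i j.
Proof.
rewrite /alpha; under eq_Rintegral do rewrite root_mean_sqr.
rewrite RintegralZl//; last first.
  rewrite (_ : _ \o _ = fun y =>
      (\sum_i (EFin \o (fun y : k.+1.-tuple R => \sum_j tnth y i * tnth y j)%R) y)%E).
    by apply: integrable_sum => // j _; exact: isumj.
  by apply/funext => y /=; rewrite sumEFin.
rewrite mulrA divff ?pnatr_eq0// mul1r Rintegral_sum//.
apply: eq_bigr => i _; rewrite Rintegral_sum// => j; exact: integrable_mul.
Qed.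

Lemma alpha_betaE : alpha + beta = \sum_i t_moment i i.
Proof.
have bd (y : k.+1.-tuple R) : `|root_mean y ^+ 2| <= 4 * expR (sum_sqr y / 4).
  rewrite ger0_norm ?sqr_ge0//; apply: le_trans (sum_sqr_le_exp y).
  by have := sq_dev_ge0 y; rewrite sq_devE; lra.
have bd2 (y : k.+1.-tuple R) : `|sq_dev y| <= 4 * expR (sum_sqr y / 4).
  rewrite ger0_norm ?sq_dev_ge0//; apply: le_trans (sum_sqr_le_exp y).
  by rewrite sq_devE lerBlDr lerDl sqr_ge0.
have mr : measurable_fun setT (fun y : k.+1.-tuple R => root_mean y ^+ 2).
  by apply: measurable_funX; exact: measurable_root_mean.
have i1 := integrable_dominated mr bd mA.
have i2 := integrable_dominated (@measurable_sq_dev R k.+1) bd2 mA.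
have H := RintegralD (f1 := fun y : k.+1.-tuple R => root_mean y ^+ 2)
  (f2 := @sq_dev R k.+1) mA i1 i2.
transitivity (\int[N k.+1]_(y in A) (root_mean y ^+ 2 + sq_dev y)); first exact: (esym H).
rewrite /t_moment -Rintegral_sum//; last by move=> i; exact: integrable_mul.
apply: eq_Rintegral => y _; rewrite sq_devE addrC subrK.
by apply: eq_bigr => i _; rewrite expr2.
Qed.

Lemma t_moment_bound i j : `|t_moment i j| <= 4 * expq k.+1.
Proof.
have H := Rintegral_dominated (measurable_mul_tnth i j) (@mul_dominated R k.+1 i j) mA.
exact: H.
Qed.

End moments.

Definition up_mx n : 'M[R]_n := \matrix_(i, j) (i.+1 == j)%:R.

(** The matrix M / 2 - 1, where [up_mx] is the upper half of the adjacency matrix M of the path. *)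
Definition neighbour_mx n : 'M[R]_n := - 1%:M + 2^-1 *: (up_mx n + (up_mx n)^T).

Lemma sum_up_mx k : \sum_(i < k.+1) \sum_(j < k.+1) up_mx k.+1 i j = k%:R.
Proof.
rewrite exchange_big/= big_ord_recl [X in X + _]big1 ?add0r => [|i _]; last by rewrite mxE.
transitivity (\sum_(j < k) (1 : R)); last by rewrite sumr_const card_ord.
apply: eq_bigr => j _; rewrite (bigD1 (widen_ord (leqnSn k) j))//= big1 => [|i ij].
  by rewrite mxE /= eqxx addr0.
by rewrite mxE /= eqSS; case: eqP => // E; move: ij; rewrite -val_eqE /= E eqxx.
Qed.

Lemma neighbour_sum k (p r : R) (m : 'I_k.+1 -> 'I_k.+1 -> R) :
  (forall i, m i i = p) -> (forall i j, i != j -> m i j = r) ->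
  \sum_i \sum_j neighbour_mx k.+1 i j * m i j = - k.+1%:R * p + k%:R * r.
Proof.
move=> mp mr.
have up_r i j : up_mx k.+1 i j * m i j = up_mx k.+1 i j * r.
  rewrite mxE; case: eqP => [E|_]; last by rewrite !mul0r.
  by rewrite mr// -val_eqE /= neq_ltn -E ltnSn.
have down_r i j : up_mx k.+1 j i * m i j = up_mx k.+1 j i * r.
  rewrite mxE; case: eqP => [E|_]; last by rewrite !mul0r.
  by rewrite mr// -val_eqE /= neq_ltn -E ltnSn orbT.
have S1 : \sum_i \sum_j up_mx k.+1 i j * m i j = k%:R * r.
  rewrite -sum_up_mx mulr_suml; apply: eq_bigr => i _.
  by rewrite mulr_suml; apply: eq_bigr => j _.
have S2 : \sum_i \sum_j up_mx k.+1 j i * m i j = k%:R * r.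
  rewrite -sum_up_mx exchange_big/= mulr_suml; apply: eq_bigr => i _.
  by rewrite mulr_suml; apply: eq_bigr => j _.
have S0 : \sum_i \sum_j (1%:M : 'M[R]_k.+1) i j * m i j = k.+1%:R * p.
  transitivity (\sum_(i < k.+1) p); last by rewrite sumr_const card_ord mulr_natl.
  apply: eq_bigr => i _; rewrite (bigD1 i)//= big1 => [|j ji].
    by rewrite mxE eqxx mul1r addr0.
  by rewrite mxE eq_sym (negbTE ji) mul0r.
transitivity (- (\sum_i \sum_j (1%:M : 'M[R]_k.+1) i j * m i j) +
  2^-1 * (\sum_i \sum_j up_mx k.+1 i j * m i j + \sum_i \sum_j up_mx k.+1 j i * m i j)).
  rewrite -big_split/= mulr_sumr -sumrN -big_split/=; apply: eq_bigr => i _.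
  rewrite -big_split/= mulr_sumr -sumrN -big_split/=; apply: eq_bigr => j _.
  by rewrite !mxE; ring.
by rewrite S0 S1 S2; field.
Qed.

Lemma tr_neighbour n : \tr (neighbour_mx n) = - n%:R.
Proof.
rewrite /mxtrace; under eq_bigr do rewrite !mxE eqxx (gtn_eqF (ltnSn _)) addr0 mulr0 addr0.
by rewrite sumrN sumr_const card_ord.
Qed.

(** Let K = k + 1, and let p and r be the common diagonal and off-diagonal moments over the event A.
    Then alpha + beta = K p and alpha = p + (K - 1) r, so the quadratic form contributes - K p + (K
    - 1) r = - (alpha + (K + 1) beta) / K, and the trace - K contributes K P(A). Their sum is - 1/K
    times [Upsilon]; [V] only feeds the error. *)
Lemma first_order_eval k (e rho x : R) (V : 'M[R]_k.+1) : (1 <= k)%N -> 0 <= x ->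
  (forall i j, `|V i j| <= rho) ->
  `|first_order (e *: neighbour_mx k.+1 + V) (t_event x) -
    (fine (N k.+1 (t_event x)) - e / (2 * k.+1%:R) * Upsilon k.+1 x)| <=
  (2 * (k.+1 ^ 2)%:R * expq k.+1 + k.+1%:R) * rho.
Proof.
move=> k1 x0 Vr; have mA := @measurable_t_event R k x.
have rho0 : 0 <= rho by exact: le_trans (normr_ge0 _) (Vr ord0 ord0).
rewrite Upsilon_t_event// -/(alpha k x) -/(beta k x) /first_order.
have a01 := probability_fine_itv (N k.+1) mA.
set a := fine _ in a01 *.
rewrite Rintegral_qform//.
pose p := t_moment x (ord0 : 'I_k.+1) ord0; pose r := t_moment x (ord0 : 'I_k.+1) ord_max.
have K0 : k.+1%:R != 0 :> R by rewrite pnatr_eq0.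
have abE : alpha k x + beta k x = k.+1%:R * p.
  rewrite alpha_betaE (eq_bigr (fun=> p)) => [|i _]; last exact: t_moment_diag.
  by rewrite sumr_const card_ord mulr_natl.
have aE : k.+1%:R * alpha k x = k.+1%:R * p + k.+1%:R * k%:R * r.
  rewrite alphaE (eq_bigr (fun=> p + k%:R * r)) => [|i _].
    by rewrite sumr_const card_ord -[LHS]mulr_natl; ring.
  rewrite (bigD1 i)//= t_moment_diag; congr (_ + _).
  rewrite (eq_bigr (fun=> r)) => [|j ji]; last by rewrite t_moment_offdiag// eq_sym.
  by rewrite sumr_const cardC1 card_ord mulr_natl.
pose S := \sum_i \sum_j (e *: neighbour_mx k.+1 + V) i j * t_moment x i j.
rewrite -[X in 2^-1 * (X - _)]/S.
have -> : S = e * (- k.+1%:R * p + k%:R * r) + \sum_i \sum_j V i j * t_moment x i j.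
  rewrite -(neighbour_sum (t_moment_diag x) (@t_moment_offdiag k x)).
  rewrite /S mulr_sumr -big_split/=; apply: eq_bigr => i _.
  rewrite mulr_sumr -big_split/=; apply: eq_bigr => j _.
  by rewrite !mxE; ring.
rewrite mxtraceD mxtraceZ tr_neighbour.
set W := \sum_i \sum_j _.
have Wb : `|W| <= (k.+1 ^ 2)%:R * (rho * (4 * expq k.+1)).
  apply: (le_trans (ler_norm_sum _ _ _)).
  apply: (@le_trans _ _ (\sum_(i < k.+1) \sum_(j < k.+1) rho * (4 * expq k.+1))).
    apply: ler_sum => i _; apply: (le_trans (ler_norm_sum _ _ _)).
    apply: ler_sum => j _; rewrite normrM.
    by apply: ler_pM => //; exact: t_moment_bound.
  by rewrite !sumr_const !card_ord -mulrnA -mulnn -[leLHS]mulr_natl.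
have tV : `|\tr V| <= k.+1%:R * rho.
  apply: (le_trans (ler_norm_sum _ _ _)).
  apply: (@le_trans _ _ (\sum_(i < k.+1) rho)); first exact: ler_sum.
  by rewrite sumr_const card_ord mulr_natl.
have tVa : `|\tr V * a| <= k.+1%:R * rho.
  rewrite normrM -[leRHS]mulr1; have /andP[a0 a1] := a01.
  by apply: ler_pM => //; rewrite ger0_norm.
have kE : k%:R = k.+1%:R - 1 :> R by rewrite -addn1 natrD addrK.
have k2E : k.+2%:R = k.+1%:R + 1 :> R by rewrite -addn1 natrD.
rewrite [X in `|X|](_ : _ = 2^-1 * (W - \tr V * a)).
  rewrite normrM ger0_norm//; have := ler_normB W (\tr V * a).
  move: Wb tVa; set G := expq _; set K2 := (k.+1 ^ 2)%:R.
  by move=> h1 h2 h3; have : 0 <= k.+1%:R * rho by [rewrite mulr_ge0]; lra.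
rewrite k2E; move: aE abE; rewrite kE; move: (k.+1%:R) K0 => K K0.
move: (alpha k x) (beta k x) => al be aE abE.
have -> : be = K * p - al by rewrite -abE addrC addKr.
have -> : al = p + (K - 1) * r by apply: (mulfI K0); rewrite aE; ring.
by field.
Qed.

End exchangeable.

(** * Covariances of block sums *)

Section block_covariance.
Context {R : realType}.
Variable gamma : int -> R.
Hypothesis gamma_even : forall h, gamma (- h) = gamma h.
Hypothesis hsum : summable [set: int] (fun h : int => (h%:~R ^+ 2 * `|gamma h|)%:E).

Lemma weighted_partial_sums : exists2 S : R, 0 <= S &
  forall n, \sum_(0 <= k < n) k.+1%:R ^+ 2 * `|gamma k.+1%:Z| <= S.
Proof.
pose f (h : int) : \bar R := `|(h%:~R ^+ 2 * `|gamma h|)%:E|%E.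
have f0 h : (0 <= f h)%E by exact: abse_ge0.
have fin : (\esum_(h in [set: int]) f h)%E \is a fin_num.
  by rewrite ge0_fin_numE//; exact: esum_ge0.
exists (fine (\esum_(h in [set: int]) f h)%E); first by apply/fine_ge0/esum_ge0.
move=> n; rewrite -lee_fin fineK//.
pose e (k : nat) := Posz k.+1.
apply: esum_ge; exists (e @` `I_n).
  by split => //; apply: finite_image; exact: finite_II.
rewrite fsbig_image//; last by move=> i j _ _ [].
rewrite -fsbig_ord big_mkord -sumEFin; apply: lee_sum => i _.
by rewrite /f /e gee0_abs ?lee_fin// mulr_ge0// sqr_ge0.
Qed.

Let g k := gamma k%:Z.

(** The variance of the sum of [n] consecutive observations. *)
Definition toeplitz_sum n : R := \sum_(0 <= i < n) \sum_(0 <= j < n) gamma (i%:Z - j%:Z).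

Lemma toeplitz_sumS n : toeplitz_sum n.+1 =
  toeplitz_sum n + g 0 + 2 * \sum_(0 <= k < n) g k.+1.
Proof.
rewrite /toeplitz_sum big_nat_recr//=.
under eq_bigr do rewrite big_nat_recr//=.
rewrite big_split/= big_nat_recr//= subrr -/(g 0).
have E1 : \sum_(0 <= i < n) gamma (i%:Z - n%:Z) = \sum_(0 <= k < n) g k.+1.
  rewrite big_nat_rev/= add0n big_nat [RHS]big_nat; apply: eq_bigr => i /andP[_ i1].
  by rewrite -gamma_even /g opprB subzn ?leq_subr//; congr (gamma _%:Z); rewrite subKn.
have E2 : \sum_(0 <= j < n) gamma (n%:Z - j%:Z) = \sum_(0 <= k < n) g k.+1.
  by rewrite -E1; apply: eq_bigr => i _; rewrite -gamma_even opprB.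
by rewrite E1 E2; ring.
Qed.

(** Separating the number [N] of lags from [n] makes two quantities comparable: N = n gives the
    variance, and N -> oo gives n sigma^2 - B. *)
Definition lag_sum (n N : nat) : R :=
  n%:R * g 0 + \sum_(0 <= k < N) 2 * (n%:R - k.+1%:R) * g k.+1.

Lemma toeplitz_lag_sum n : toeplitz_sum n = lag_sum n n.
Proof.
elim: n => [|n IH]; first by rewrite /toeplitz_sum /lag_sum !big_geq// mul0r addr0.
have nE : n.+1%:R = n%:R + 1 :> R by rewrite -addn1 natrD.
have E : \sum_(0 <= k < n) 2 * (n.+1%:R - k.+1%:R) * g k.+1 =
    \sum_(0 <= k < n) 2 * (n%:R - k.+1%:R) * g k.+1 + 2 * \sum_(0 <= k < n) g k.+1.
  by rewrite mulr_sumr -big_split/=; apply: eq_bigr => k _; rewrite nE; ring.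
rewrite toeplitz_sumS IH /lag_sum big_nat_recr//= subrr mulr0 mul0r addr0 E nE.
by ring.
Qed.

Lemma is_cvg_weighted (w : nat -> R) (c : R) : (forall k, `|w k| <= c * k.+1%:R ^+ 2) ->
  cvgn (series (fun k => w k * g k.+1)).
Proof.
move=> wb; have [S S0 SP] := weighted_partial_sums.
have c0 : 0 <= c by have := le_trans (normr_ge0 _) (wb 0%N); rewrite expr1n mulr1.
apply: normed_cvg; apply: nondecreasing_is_cvgn.
  apply/nondecreasing_seqP => n.
  change (\sum_(0 <= k < n) `|w k * g k.+1| <= \sum_(0 <= k < n.+1) `|w k * g k.+1|).
  by rewrite big_nat_recr//= lerDl.
exists (c * S) => _ [n _ <-] /=; apply: le_trans (ler_wpM2l c0 (SP n)).
rewrite mulr_sumr; apply: ler_sum => k _.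
by rewrite normrM mulrA ler_wpM2r.
Qed.

Lemma zsum_lag n : n%:R * zsum gamma - zsum (fun h : int => `|h|%:~R * gamma h) =
  limn (lag_sum n).
Proof.
rewrite /zsum normr0 mul0r add0r.
have E1 : (fun k : nat => gamma k.+1%:Z + gamma (- k.+1%:Z)) = (fun k => 2 * g k.+1).
  by apply/funext => k; rewrite gamma_even mulr_natl mulr2n.
have E2 : (fun k : nat => `|k.+1%:Z|%:~R * gamma k.+1%:Z + `|- k.+1%:Z|%:~R * gamma (- k.+1%:Z))
    = (fun k => (2 * k.+1%:R) * g k.+1).
  have e k : `|k.+1%:Z|%:~R = k.+1%:R :> R by [].
  by apply/funext => k; rewrite gamma_even normrN e /g; ring.
rewrite E1 E2.
have one k : 1 <= k.+1%:R :> R by rewrite ler1n.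
have c1 : cvgn (series (fun k => 2 * g k.+1)).
  apply: (@is_cvg_weighted _ 2) => k; rewrite ger0_norm//.
  by have := one k; nra.
have c2 : cvgn (series (fun k => (2 * k.+1%:R) * g k.+1)).
  apply: (@is_cvg_weighted _ 2) => k; rewrite ger0_norm ?mulr_ge0//.
  by have := one k; nra.
apply/esym/cvg_lim => //.
have -> : lag_sum n = fun N => n%:R * (g 0 + series (fun k => 2 * g k.+1) N) -
    series (fun k => (2 * k.+1%:R) * g k.+1) N.
  apply/funext => N; rewrite /lag_sum /series/= mulrDr mulr_sumr -addrA -sumrB.
  by congr (_ + _); apply: eq_bigr => k _; ring.
apply: cvgB; last exact: c2.
apply: cvgM; first exact: cvg_cst.
by apply: cvgD; [exact: cvg_cst|exact: c1].
Qed.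

Lemma is_cvg_lag n : cvgn (lag_sum n).
Proof.
apply: is_cvgD; first exact: is_cvg_cst.
apply: (@is_cvg_weighted (fun k => 2 * (n%:R - k.+1%:R)) (2 * (n%:R + 1))) => k.
rewrite normrM ger0_norm// -mulrA ler_wpM2l//.
have := ler_normB (n%:R : R) k.+1%:R.
rewrite (ger0_norm (ler0n _ n)) (ger0_norm (ler0n _ k.+1)).
have : 1 <= k.+1%:R :> R by rewrite ler1n.
have : 0 <= n%:R :> R by rewrite ler0n.
by move=> ? ? ?; nra.
Qed.

(** The error is the part of [lag_sum] with lags h > n, where h - n <= h^2 / n; the summability of
    h^2 |gamma h| makes it O(1/n). *)
Lemma toeplitz_sum_asymptotics : exists2 S : R, 0 <= S & forall n, (1 <= n)%N ->
  `|toeplitz_sum n - (n%:R * zsum gamma - zsum (fun h : int => `|h|%:~R * gamma h))|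
  <= 2 * S / n%:R.
Proof.
have [S S0 SP] := weighted_partial_sums; exists S => // n n1.
have n0 : 0 < n%:R :> R by rewrite ltr0n.
rewrite zsum_lag distrC toeplitz_lag_sum.
have key N : (n <= N)%N -> `|lag_sum n N - lag_sum n n| <= 2 * S / n%:R.
  move=> nN; rewrite /lag_sum.
  rewrite [X in `|X|](_ : _ = \sum_(n <= k < N) 2 * (n%:R - k.+1%:R) * g k.+1); last first.
    by rewrite (@big_cat_nat _ _ _ n 0 N)//=; ring.
  apply: (le_trans (ler_norm_sum _ _ _)).
  apply: (@le_trans _ _ (\sum_(n <= k < N) 2 / n%:R * (k.+1%:R ^+ 2 * `|gamma k.+1%:Z|))).
    rewrite big_nat [leRHS]big_nat; apply: ler_sum => k /andP[nk _].
    rewrite normrM mulrA ler_wpM2r// normrM ger0_norm// -mulrA ler_wpM2l//.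
    have hk : n%:R <= k.+1%:R :> R by rewrite ler_nat leqW.
    rewrite distrC ger0_norm ?subr_ge0// ler_pdivlMl//.
    by move: hk n0; move: (n%:R) (k.+1%:R) => a b ab a0; nra.
  rewrite -mulr_sumr [leRHS]mulrAC; apply: ler_wpM2l; first by rewrite divr_ge0// ltW.
  apply: le_trans (SP N); rewrite [leRHS](@big_cat_nat _ _ _ n)//= lerDr.
  by apply: sumr_ge0 => k _; rewrite mulr_ge0// sqr_ge0.
have c : cvgn (lag_sum n) by exact: is_cvg_lag.
rewrite ler_norml; apply/andP; split.
  rewrite lerBrDr; apply: limr_ge => //; near=> N.
  have nN : (n <= N)%N by near: N; exact: nbhs_infty_ge.
  by have := key N nN; rewrite ler_norml => /andP[+ _]; rewrite lerBrDr.
rewrite lerBlDr; apply: limr_le => //; near=> N.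
have nN : (n <= N)%N by near: N; exact: nbhs_infty_ge.
by have := key N nN; rewrite ler_norml => /andP[_]; rewrite lerBlDr.
Unshelve. all: by end_near. Qed.

(** The covariance of the sums of observations over the index ranges [p, q) and [r, s). *)
Definition rect_sum (p q r s : nat) : R :=
  \sum_(p <= i < q) \sum_(r <= j < s) gamma (i%:Z - j%:Z).

Lemma rect_sumC p q r s : rect_sum p q r s = rect_sum r s p q.
Proof.
rewrite /rect_sum exchange_big/=; apply: eq_bigr => i _; apply: eq_bigr => j _.
by rewrite -gamma_even opprB.
Qed.

Lemma rect_sum_split p q q' r s : (p <= q)%N -> (q <= q')%N ->
  rect_sum p q' r s = rect_sum p q r s + rect_sum q q' r s.
Proof. by move=> pq qq; rewrite /rect_sum (@big_cat_nat _ _ _ q). Qed.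

Lemma rect_sum_diag p n : rect_sum p (p + n) p (p + n) = toeplitz_sum n.
Proof.
rewrite /rect_sum /toeplitz_sum -{1 3}[p]add0n ![(p + n)%N]addnC.
rewrite big_addn addnK; apply: eq_bigr => i _.
rewrite -{1}[p]add0n big_addn addnK; apply: eq_bigr => j _.
by rewrite !PoszD; congr gamma; ring.
Qed.

(** With F the first block, L the last and M the stretch between them, Var(F + M + L) - Var(F + M) -
    Var(M + L) + Var(M) = 2 Cov(F, L), and stationarity equates the two middle variances. For d = 1
    the stretch M is empty. *)
Lemma rect_sum_blocks b d : (0 < d)%N ->
  2 * rect_sum (d * b) (d.+1 * b) 0 b =
  toeplitz_sum (d.+1 * b) - 2 * toeplitz_sum (d * b) + toeplitz_sum (d.-1 * b).
Proof.
move=> d0.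
have h1 : (b <= d * b)%N by rewrite leq_pmull.
have h2 : (d * b <= d.+1 * b)%N by rewrite leq_mul2r leqnSn orbT.
have T1 := rect_sum_diag 0 (d.+1 * b); have T2 := rect_sum_diag 0 (d * b).
have T3 := rect_sum_diag b (d * b); have T4 := rect_sum_diag b (d.-1 * b).
have e1 : (b + d * b = d.+1 * b)%N by rewrite mulSn.
have e2 : (b + d.-1 * b = d * b)%N by rewrite -mulSn prednK.
rewrite add0n in T1 T2; rewrite e1 in T3; rewrite e2 in T4.
rewrite -T1 -{1}[toeplitz_sum (d * b)]addr0.
have -> : 2 * (toeplitz_sum (d * b) + 0) = rect_sum 0 (d * b) 0 (d * b) +
  rect_sum b (d.+1 * b) b (d.+1 * b) by rewrite T2 T3; ring.
rewrite -T4.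
have s1 r s : rect_sum 0 (d.+1 * b) r s =
   rect_sum 0 b r s + rect_sum b (d * b) r s + rect_sum (d * b) (d.+1 * b) r s.
  by rewrite (@rect_sum_split 0 (d * b))// (@rect_sum_split 0 b (d * b)).
have s2 r s : rect_sum 0 (d * b) r s = rect_sum 0 b r s + rect_sum b (d * b) r s.
  by rewrite (@rect_sum_split 0 b (d * b)).
have s3 r s : rect_sum b (d.+1 * b) r s =
   rect_sum b (d * b) r s + rect_sum (d * b) (d.+1 * b) r s.
  by rewrite (@rect_sum_split b (d * b)).
have t1 p q : rect_sum p q 0 (d.+1 * b) =
   rect_sum p q 0 b + rect_sum p q b (d * b) + rect_sum p q (d * b) (d.+1 * b).
  by rewrite rect_sumC s1 !(rect_sumC _ _ p q).
have t2 p q : rect_sum p q 0 (d * b) = rect_sum p q 0 b + rect_sum p q b (d * b).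
  by rewrite rect_sumC s2 !(rect_sumC _ _ p q).
have t3 p q : rect_sum p q b (d.+1 * b) =
   rect_sum p q b (d * b) + rect_sum p q (d * b) (d.+1 * b).
  by rewrite rect_sumC s3 !(rect_sumC _ _ p q).
rewrite s1 s2 s3 !t1 !t2 !t3.
rewrite (rect_sumC 0 b (d * b) (d.+1 * b)) (rect_sumC 0 b b (d * b)).
by rewrite (rect_sumC b (d * b) (d * b) (d.+1 * b)); ring.
Qed.

Definition block_cov (b i j : nat) : R := rect_sum (i * b) (i.+1 * b) (j * b) (j.+1 * b).

Lemma block_covC b i j : block_cov b i j = block_cov b j i.
Proof. exact: rect_sumC. Qed.

Lemma block_cov_diag b i : block_cov b i i = toeplitz_sum b.
Proof. by rewrite /block_cov mulSn addnC rect_sum_diag. Qed.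

Lemma block_cov_shift b i d : block_cov b (i + d) i = rect_sum (d * b) (d.+1 * b) 0 b.
Proof.
rewrite /block_cov /rect_sum.
rewrite (_ : ((i + d) * b = d * b + i * b)%N); last by rewrite mulnDl addnC.
rewrite (_ : ((i + d).+1 * b = d.+1 * b + i * b)%N); last by rewrite !mulSn mulnDl; lia.
rewrite big_addn addnK.
apply: eq_bigr => s _.
rewrite mulSn -{1}[(i * b)%N]add0n big_addn addnK; apply: eq_bigr => t _.
by rewrite !PoszD; congr gamma; ring.
Qed.

(** At distance 1 the second difference is (2 b sigma^2 - B) - 2 (b sigma^2 - B) + 0 = B, twice the
    covariance; at distance 2 or more all three variances carry -B and everything cancels up to the
    remainders. *)
Lemma block_cov_asymptotics : exists2 S : R, 0 <= S & forall b i j, (1 <= b)%N ->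
  `|block_cov b i j - (if i == j then b%:R * zsum gamma - zsum (fun h : int => `|h|%:~R * gamma h)
     else if (i.+1 == j) || (j.+1 == i) then zsum (fun h : int => `|h|%:~R * gamma h) / 2
     else 0)| <= S / b%:R.
Proof.
have [S S0 SP] := toeplitz_sum_asymptotics.
(* Each variance is known up to 2 S / b; a second difference has weights 1, 2, 1 and is halved. *)
exists (4 * S); first by rewrite mulr_ge0.
move=> b i j b1.
have b0 : 0 < b%:R :> R by rewrite ltr0n.
wlog ji : i j / (j <= i)%N => [hw|].
  have [|ij] := leqP j i; first exact: hw.
  by have := hw j i (ltnW ij); rewrite block_covC eq_sym orbC.
set sg := zsum gamma in SP *; set B := zsum _ in SP *.
have T d : (1 <= d)%N -> `|toeplitz_sum (d * b) - ((d * b)%:R * sg - B)| <= 2 * (S / b%:R).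
  move=> d1; have db : (1 <= d * b)%N by rewrite muln_gt0 d1.
  apply: (le_trans (SP _ db)); rewrite mulrA ler_wpM2l ?mulr_ge0//.
  by rewrite lef_pV2 ?posrE ?ltr0n// ler_nat leq_pmull.
have [d ->] : exists d, i = (j + d)%N by exists (i - j)%N; rewrite subnKC.
have Sb : 0 <= S / b%:R by rewrite divr_ge0// ltW.
have -> : 4 * S / b%:R = 4 * (S / b%:R) by rewrite mulrA.
move: Sb T; move: (S / b%:R) => x x0 T.
case: d => [|d].
  rewrite addn0 eqxx block_cov_diag.
  by have := T 1%N isT; rewrite mul1n; lra.
have -> : (j + d.+1 == j)%N = false by apply/negbTE/eqP; lia.
have -> : ((j + d.+1).+1 == j)%N = false by apply/negbTE/eqP; lia.
rewrite block_cov_shift; have E := @rect_sum_blocks b d.+1 isT.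
rewrite /=; case: d E => [|d] E.
  rewrite addn1 eqxx; have := T 1%N isT; have := T 2%N isT.
  move: E; rewrite /= mul0n mul1n natrM.
  have -> : toeplitz_sum 0 = 0 by rewrite /toeplitz_sum big_geq.
  move: (rect_sum _ _ _ _) (toeplitz_sum _) (toeplitz_sum _) => r t2 t1 E.
  rewrite !ler_norml => /andP[h1 h2] /andP[h3 h4].
  by apply/andP; split; lra.
have -> : (j.+1 == j + d.+2)%N = false by apply/negbTE/eqP; lia.
rewrite subr0.
have := T d.+1 isT; have := T d.+2 isT; have := T d.+3 isT.
move: E; rewrite /= !natrM.
have -> : d.+3%:R = d.+1%:R + 2 :> R by rewrite -(addn2 d.+1) natrD.
have -> : d.+2%:R = d.+1%:R + 1 :> R by rewrite -(addn1 d.+1) natrD.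
move: (rect_sum _ _ _ _) (toeplitz_sum _) (toeplitz_sum _) (toeplitz_sum _) => r t3 t2 t1 E.
move: (d.+1%:R) (b%:R) => D bb; rewrite !ler_norml => /andP[h1 h2] /andP[h3 h4] /andP[h5 h6].
by apply/andP; split; lra.
Qed.

End block_covariance.

(** * The index groups as consecutive blocks, and divisibility of the sample size *)

Section groups.
Context {R : realType}.

(** Blocks and positions are counted from 0, observations from 1. *)
Definition block_index (b i t : nat) : int := (i * b + t).+1%:Z.

Lemma block_index_inj b i : injective (block_index b i).
Proof. by move=> s t; rewrite /block_index => -[] /addnI. Qed.

Lemma group_blockE K b i : (0 < K)%N ->
  group K (K * b) i.+1 = block_index b i @` `I_b.
Proof.
move=> K0; have K0' : K%:R != 0 :> rat by rewrite pnatr_eq0 -lt0n.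
have E m : m%:R * (K * b)%:R / K%:R = (m * b)%:Z%:~R :> rat.
  by rewrite !natrM mulrCA mulrC mulKf// -natrM.
rewrite /group /= !E; apply/seteqP; split => [s /=|_ [t /= tb <-]].
  rewrite ltr_int ler_int => -[].
  case: s => [s|//] h1 h2; exists (s - (i * b).+1)%N; last by rewrite /block_index; congr Posz; lia.
  by lia.
by rewrite /block_index ltr_int ler_int; split; lia.
Qed.

Lemma group_size_block K b i : (0 < K)%N -> group_size K (K * b) i.+1 = b.
Proof.
move=> K0; rewrite /group_size group_blockE//; apply: card_fset_set.
by apply: inj_card_eq => s t _ _; exact: block_index_inj.
Qed.

Lemma groupE K T j (s : int) : (0 < K)%N ->
  group K T j s <-> (j.-1 * T)%:Z < s * K%:Z /\ s * K%:Z <= (j * T)%:Z.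
Proof.
move=> K0; have K0' : 0 < K%:R :> rat by rewrite ltr0n.
rewrite /group /= ltr_pdivrMr// ler_pdivlMr// -!natrM.
have e (m : nat) : m%:R = m%:Z%:~R :> rat by [].
by rewrite [K%:R]e -intrM !e ltr_int ler_int.
Qed.

(** Write T = q K + r. The first group is {1, ..., q}; if r > 0, then T / K > q and the last group
    contains the q + 1 indices T - q, ..., T. *)
Lemma equal_groups_dvd K T : (2 <= K)%N -> equal_groups K T -> exists b, T = (K * b)%N.
Proof.
move=> K2 eqg; have K0 : (0 < K)%N by lia.
have h1 : (1 <= 1 <= K)%N by lia.
have hK : (1 <= K <= K)%N by lia.
have := eqg 1%N K h1 hK.
have TE := divn_eq T K; have rK := ltn_pmod T K0.
move: (T %/ K)%N (T %% K)%N TE rK => q r TE rK.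
have s1 : group_size K T 1 = q.
  rewrite /group_size; apply: card_fset_set.
  rewrite (_ : group K T 1 = block_index 0 0 @` `I_q).
    by apply: inj_card_eq => s t _ _; exact: block_index_inj.
  apply/seteqP; split => [s /(groupE _ _ _ K0) [/= h2 h3]|_ [t /= tq <-]].
    case: s h2 h3 => [[|s]|s] h2 h3; [by lia| |by lia].
    by exists s => //=; nia.
  by apply/groupE => //; rewrite /block_index; split; nia.
have sK : (0 < r)%N -> (q < group_size K T K)%N.
  move=> r0; apply: leq_card_fset_set.
    apply: (@sub_finite_set _ _ (block_index 0 0 @` `I_T)); last first.
      by apply: finite_image; exact: finite_II.
    move=> s /(groupE _ _ _ K0) [h2 h3].
    case: s h2 h3 => [[|s]|s] h2 h3; [by lia| |by lia].
    by exists s => //=; nia.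
  pose f (t : nat) : int := T%:Z - t%:Z.
  have fi : {in `I_q.+1 &, injective f} by move=> s t _ _; rewrite /f; lia.
  rewrite -(card_le_eql (inj_card_eq fi)); apply: subset_card_le => _ [t /= tq <-].
  by apply/groupE => //; rewrite /f; split; nia.
rewrite s1 => qE; case: (posnP r) => [r0|/sK]; last by rewrite -qE ltnn.
by exists q; rewrite TE r0 addn0 mulnC.
Qed.

Lemma group_mean_block d (Omega : measurableType d) (P : probability Omega R)
    (X : int -> {RV P >-> R}) K b i w : (0 < K)%N ->
  group_mean X K (K * b) i.+1 w =
  (\sum_(0 <= t < b) X (block_index b i t) w) / b%:R.
Proof.
move=> K0; rewrite /group_mean group_size_block// group_blockE// fsbig_image.
  by rewrite big_mkord -fsbig_ord.
by move=> s t _ _; exact: block_index_inj.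
Qed.

End groups.

Section block_sums.
Context {R : realType}.

Definition block_mx_sum (K b : nat) (c : R) : 'M[R]_(K, K * b) :=
  \matrix_(i, s) (c * (i * b <= s < i.+1 * b)%N%:R).

Lemma sum_block_mx K b c (i : 'I_K) (F : nat -> R) :
  \sum_(s < K * b) block_mx_sum K b c i s * F s =
  c * \sum_(i * b <= s < i.+1 * b) F s.
Proof.
have iK : (i.+1 * b <= K * b)%N by rewrite leq_mul2r ltn_ord orbT.
rewrite (big_nat_widenl _ 0)// (big_nat_widen _ _ (K * b))// big_mkord [in RHS]big_mkcond/=.
rewrite mulr_sumr; apply: eq_bigr => s _; rewrite mxE -mulrA; congr (_ * _).
by case: ifP => _; rewrite ?mul1r ?mul0r.
Qed.

Lemma sum_block_shift b i (F : nat -> R) :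
  \sum_(i * b <= s < i.+1 * b) F s = \sum_(0 <= t < b) F (i * b + t)%N.
Proof.
rewrite mulSn -{1}[(i * b)%N]add0n big_addn addnK.
by apply: eq_bigr => t _; rewrite addnC.
Qed.

Lemma block_gram K b c m (B : 'M[R]_(K * b, m)) (gamma : int -> R) :
  (forall s t : 'I_(K * b), (B *m B^T) s t = gamma (s%:Z - t%:Z)) ->
  forall i j : 'I_K,
  let C := block_mx_sum K b c *m B in
  (C *m C^T) i j = c ^+ 2 * block_cov gamma b i j.
Proof.
move=> BB i j C.
have -> : C *m C^T = block_mx_sum K b c *m (B *m B^T) *m (block_mx_sum K b c)^T.
  by rewrite /C trmx_mul !mulmxA.
rewrite mxE; under eq_bigr => t _ do rewrite [X in X * _]mxE [X in _ * X]mxE.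
under eq_bigr => t _ do (under eq_bigr => s _ do rewrite BB).
under eq_bigr => t _ do rewrite (@sum_block_mx K b c i (fun s => gamma (s%:Z - t%:Z))) mulrC.
rewrite (@sum_block_mx K b c j (fun t => c * \sum_(i * b <= s < i.+1 * b) gamma (s%:Z - t%:Z))).
rewrite -mulr_sumr mulrA -expr2; congr (_ * _).
by rewrite /block_cov /rect_sum exchange_big.
Qed.

End block_sums.

(** * Mean and covariance of the Gaussian representation of the observations *)

Section series_law.
Context {R : realType} d (Omega : measurableType d) (P : probability Omega R).
Variables (X : int -> {RV P >-> R}) (mu : R) (gamma : int -> R).
Hypothesis hgauss : gaussian_series X.
Hypothesis hstat : stationary_with X mu gamma.
Local Notation N := (@std_normal R).

#[local] Opaque std_normal.

Lemma autocov_even h : gamma (- h) = gamma h.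
Proof.
have [_ _ H] := hstat.
apply/EFin_inj; rewrite -(H h (- h)) -(H 0 h) addrN add0r.
by congr ('E_P[_]%E); apply/funext => w; rewrite mulrC.
Qed.

Variable n : nat.

Definition obs (w : Omega) : n.-tuple R := [tuple X i.+1%:Z w | i < n].

Lemma measurable_obs : measurable_fun setT obs.
Proof.
apply/measurable_fun_tnthP => i.
rewrite (_ : _ \o _ = X i.+1%:Z); last by apply/funext => w /=; rewrite tnth_mktuple.
exact: measurable_funPT.
Qed.

Section affine.
Variables (m : nat) (a : 'I_n -> R) (B : 'M[R]_(n, m)).

Let aff (z : m.-tuple R) : n.-tuple R := [tuple a i + \sum_(j < m) B i j * tnth z j | i < n].

Let affE z : aff z = tadd [tuple a i | i < n] (act B z).
Proof. by apply: eq_from_tnth => i; rewrite !tnth_mktuple addrC. Qed.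

Let maff : measurable_fun setT aff.
Proof.
rewrite (_ : aff = tadd [tuple a i | i < n] \o act B); last exact/funext/affE.
by apply: measurableT_comp; [exact: measurable_tadd|exact: measurable_act].
Qed.

Hypothesis law : forall A, measurable A ->
  P [set w | A (obs w)] = N m [set z | A (aff z)].

(** [gaussian_series] provides an equality of laws with unspecified [a] and [B]. Comparing integrals
    of coordinates and of products of coordinates identifies [a] with the mean and [B *m B^T] with
    the autocovariances. *)
Lemma integral_law (f : n.-tuple R -> R) : measurable_fun setT f ->
  P.-integrable setT (EFin \o (f \o obs)) ->
  (N m).-integrable setT (EFin \o (f \o aff)) ->
  (\int[P]_w (f (obs w))%:E = \int[N m]_z (f (aff z))%:E)%E.
Proof.
move=> mf iP iN.
have mE : measurable_fun setT (EFin \o f) by exact/measurable_EFinP.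
pose XO : {RV P >-> n.-tuple R} := HB.pack obs (isMeasurableFun.Build _ _ _ _ _ measurable_obs).
pose XA : {RV (N m) >-> n.-tuple R} := HB.pack aff (isMeasurableFun.Build _ _ _ _ _ maff).
transitivity (\int[distribution P XO]_u (EFin \o f) u)%E.
  by rewrite integral_distribution.
transitivity (\int[distribution (N m) XA]_u (EFin \o f) u)%E; last first.
  by rewrite integral_distribution.
apply: eq_measure_integral => A mA _; exact: law.
Qed.

Lemma integrable_centered i j :
  (N m).-integrable setT (EFin \o (fun z => tnth (act B z) i * tnth (act B z) j)).
Proof.
have E : (fun z => tnth (act B z) i * tnth (act B z) j) =
   (fun z => \sum_k \sum_l (B i k * B j l) * (tnth z k * tnth z l)).
  apply/funext => z; rewrite !tnth_mktuple mulr_suml; apply: eq_bigr => k _.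
  by rewrite mulr_sumr; apply: eq_bigr => l _; rewrite mulrACA.
rewrite E.
rewrite (_ : _ \o _ = fun z =>
    (\sum_k \sum_l ((B i k * B j l)%:E *
      (EFin \o (fun z : m.-tuple R => tnth z k * tnth z l)%R) z))%E).
  apply: integrable_sum => // k _; apply: integrable_sum => // l _.
  by apply: integrableZl => //; exact: integrable_mul.
by apply/funext => z /=; rewrite -sumEFin; apply: eq_bigr => k _; rewrite -sumEFin.
Qed.

Lemma Rintegral_centered i j :
  \int[N m]_z (tnth (act B z) i * tnth (act B z) j) = (B *m B^T) i j.
Proof.
have E z : tnth (act B z) i * tnth (act B z) j =
   \sum_k \sum_l (B i k * B j l) * (tnth z k * tnth z l).
  rewrite !tnth_mktuple mulr_suml; apply: eq_bigr => k _.
  by rewrite mulr_sumr; apply: eq_bigr => l _; rewrite mulrACA.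
have ikl k l : (N m).-integrable setT (EFin \o (fun z => (B i k * B j l) * (tnth z k * tnth z l))).
  exact: (integrableZl measurableT (B i k * B j l) (integrable_mul k l measurableT)).
under eq_Rintegral do rewrite E.
rewrite Rintegral_sum//; last first.
  move=> k; rewrite (_ : _ \o _ = fun z =>
      (\sum_l (EFin \o (fun z : m.-tuple R => (B i k * B j l) * (tnth z k * tnth z l))%R) z)%E).
    by apply: integrable_sum => // l _; exact: ikl.
  by apply/funext => z /=; rewrite sumEFin.
rewrite mxE; apply: eq_bigr => k _; rewrite Rintegral_sum//.
rewrite (bigD1 k)//= big1 => [|l lk].
  by rewrite RintegralZl ?Rintegral_mul ?eqxx ?mulr1 ?addr0 ?mxE//; exact: integrable_mul.
by rewrite RintegralZl ?Rintegral_mul 1?eq_sym ?(negbTE lk) ?mulr0//; exact: integrable_mul.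
Qed.

Lemma integrable_act i : (N m).-integrable setT (EFin \o (fun z => tnth (act B z) i)).
Proof.
have E : (fun z => tnth (act B z) i) = (fun z => \sum_k B i k * tnth z k).
  by apply/funext => z; rewrite !tnth_mktuple.
rewrite E (_ : _ \o _ = fun z =>
    (\sum_k ((B i k)%:E * (EFin \o (fun z : m.-tuple R => tnth z k)) z))%E).
  by apply: integrable_sum => // k _; apply: integrableZl => //; exact: integrable_tnth.
by apply/funext => z /=; rewrite -sumEFin.
Qed.

Lemma Rintegral_act i : \int[N m]_z tnth (act B z) i = 0.
Proof.
under eq_Rintegral do rewrite tnth_mktuple.
rewrite Rintegral_sum//; last first.
  by move=> k; exact: (integrableZl measurableT (B i k) (integrable_tnth k measurableT)).
rewrite big1// => k _; rewrite RintegralZl ?Rintegral_tnth ?mulr0//.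
exact: integrable_tnth.
Qed.

Lemma law_mean i : a i = mu.
Proof.
have [L2 EX _] := hstat.
have iX : P.-integrable setT (EFin \o X i.+1%:Z).
  apply/Lfun1_integrable; apply: Lfun_subset12 (L2 _).
  by rewrite fin_num_measure.
have mt : measurable_fun setT (fun u : n.-tuple R => tnth u i) by exact: measurable_tnth.
have oE : (fun u : n.-tuple R => tnth u i) \o obs = X i.+1%:Z.
  by apply/funext => w /=; rewrite tnth_mktuple.
have aE : (fun u : n.-tuple R => tnth u i) \o aff = (fun z => a i + tnth (act B z) i).
  by apply/funext => z /=; rewrite affE !tnth_mktuple addrC.
have ik : (N m).-integrable setT (EFin \o cst (a i)) by exact: finite_measure_integrable_cst.
have ia := integrableD measurableT ik (integrable_act i).
have H := integral_law mt.
rewrite oE aE in H; have {}H := H iX ia.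
have EXi : (\int[P]_w (tnth (obs w) i)%:E = mu%:E)%E.
  rewrite -(EX i.+1%:Z) unlock.
  by apply: eq_integral => w _; rewrite tnth_mktuple.
rewrite EXi in H; apply/esym; apply: (etrans (congr1 fine H)).
have R1 := RintegralD (f1 := cst (a i)) (f2 := fun z => tnth (act B z) i)
  measurableT ik (integrable_act i).
transitivity (\int[N m]_z (cst (a i) z + tnth (act B z) i)).
  by rewrite /Rintegral; congr fine; apply: eq_integral => z _; rewrite affE !tnth_mktuple addrC.
rewrite R1 Rintegral_act addr0 Rintegral_cst//.
rewrite -[RHS]mulr1; apply: (congr1 ( *%R (a i))).
exact: (congr1 fine (@probability_setT _ _ _ (N m))).
Qed.

Lemma law_cov i j : (B *m B^T) i j = gamma (i%:Z - j%:Z).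
Proof.
have [L2 _ EC] := hstat.
have L2c k : (fun w => X k w - mu) \in Lfun P 2%:E.
  rewrite (_ : (fun w => _) = (X k : Omega -> R) - cst mu)//.
  by rewrite rpredB ?lee1n//= => _; rewrite Lfun_cst.
pose f (u : n.-tuple R) := (tnth u i - mu) * (tnth u j - mu).
have mf : measurable_fun setT f.
  by apply: measurable_funM; apply: measurable_funB => //; exact: measurable_tnth.
have oE : f \o obs = (fun w => (X i.+1%:Z w - mu) * (X j.+1%:Z w - mu)).
  by apply/funext => w; rewrite /f /= !tnth_mktuple.
have aE : f \o aff = (fun z => tnth (act B z) i * tnth (act B z) j).
  apply/funext => z; rewrite /f /= affE !(tnth_mktuple _ i) !(tnth_mktuple _ j) !law_mean.
  by rewrite !addrK.
have iX : P.-integrable setT (EFin \o (f \o obs)).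
  by rewrite oE; apply/Lfun1_integrable; apply: Lfun2_mul_Lfun1.
have ia : (N m).-integrable setT (EFin \o (f \o aff)) by rewrite aE; exact: integrable_centered.
have H := integral_law mf iX ia.
rewrite -Rintegral_centered.
have -> : \int[N m]_z (tnth (act B z) i * tnth (act B z) j) = fine (\int[N m]_z (f (aff z))%:E)%E.
  by rewrite -aE.
rewrite -H -autocov_even opprB.
have := EC i.+1%:Z (j%:Z - i%:Z); rewrite unlock.
have -> : i.+1%:Z + (j%:Z - i%:Z) = j.+1%:Z by lia.
move=> E; apply: (etrans _ (congr1 fine E)); apply: (congr1 fine).
by apply: eq_integral => w _; rewrite /f !tnth_mktuple.
Qed.

End affine.

End series_law.

(** * The expansion of the t-statistic *)

Section t_statistic.
Context {R : realType} d (Omega : measurableType d) (P : probability Omega R).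
Variables (X : int -> {RV P >-> R}) (mu : R).

(** The centred block sums scaled by [c] are the centred group means times e = c b > 0, and this
    common factor cancels in the ratio; [c] is thus free to be chosen as the normalisation. *)
Lemma t_stat_ratio k b c w : (1 <= b)%N -> 0 < c ->
  t_stat X mu k.+1 (k.+1 * b) w =
  t_ratio (act (block_mx_sum k.+1 b c) (tadd [tuple - mu | i < k.+1 * b] (obs X (k.+1 * b) w))).
Proof.
move=> b1 c0.
have b0 : 0 < b%:R :> R by rewrite ltr0n.
pose gm (i : 'I_k.+1) := group_mean X k.+1 (k.+1 * b) i.+1 w.
set y := act _ _; pose e := c * b%:R.
have e0 : 0 < e by rewrite mulr_gt0.
have yE i : tnth y i = e * (gm i - mu).
  rewrite tnth_mktuple.
  under eq_bigr => s _ do rewrite !tnth_mktuple.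
  rewrite (@sum_block_mx R k.+1 b c i (fun s => X s.+1%:Z w - mu)) sum_block_shift.
  rewrite sumrB sumr_const_nat subn0 /gm group_mean_block// -mulr_natl.
  rewrite /e /block_index; move: (\sum_(0 <= t < b) _) => S.
  by field; rewrite lt0r_neq0.
pose mb := mean_bar X k.+1 (k.+1 * b) w.
have mbE : k.+1%:R^-1 * \sum_i gm i = mb.
  by rewrite /mb /mean_bar big_add1/= big_mkord.
have K0 : k.+1%:R != 0 :> R by rewrite pnatr_eq0.
have meanE : k.+1%:R^-1 * ysum y = e * (mb - mu).
  rewrite /ysum; under eq_bigr do rewrite yE.
  rewrite -mulr_sumr sumrB sumr_const card_ord -mbE -[mu *+ _]mulr_natl.
  by field.
have devE : sq_dev y = e ^+ 2 * \sum_i (gm i - mb) ^+ 2.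
  rewrite /sq_dev meanE mulr_sumr; apply: eq_bigr => i _; rewrite yE.
  by ring.
have S2E : S2 X k.+1 (k.+1 * b) w = k%:R^-1 * \sum_i (gm i - mb) ^+ 2.
  by rewrite /S2 big_add1/= big_mkord.
rewrite /t_ratio /root_mean meanE devE /t_stat -/mb S2E.
rewrite (mulrCA k.+1.-1%:R^-1) (sqrtrM _ (sqr_ge0 e)) sqrtr_sqr (gtr0_norm e0).
rewrite (mulrCA _ e) -mulf_div divff ?mul1r// lt0r_neq0//.
Qed.

End t_statistic.

Section final.
Context {R : realType}.

Lemma neighbour_mxE n i j : neighbour_mx (R := R) n i j =
  if i == j then -1 else if (i.+1 == j)%N || (j.+1 == i)%N then 2^-1 else 0.
Proof.
rewrite !mxE; have [->|ij] := eqVneq i j.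
  by rewrite (gtn_eqF (ltnSn _)) addr0 mulr0 addr0.
rewrite oppr0 add0r.
case: eqP => [E|_].
  have -> : (j.+1 == i)%N = false by apply/negbTE/eqP; lia.
  by rewrite addr0 mulr1.
by case: eqP => _; rewrite ?add0r ?mulr1 ?mulr0.
Qed.

End final.

(** The constants are chosen before x, and the error is expressed in the group size b; the supremum
    and the rate in T follow directly. *)
Lemma t_stat_expansion (R : realType) (d : measure_display)
    (Omega : measurableType d) (P : probability Omega R)
    (X : int -> {RV P >-> R}) (mu : R) (gamma : int -> R) (k : nat) :
  gaussian_series X -> stationary_with X mu gamma -> 0 < zsum gamma ->
  summable [set: int] (fun h : int => (h%:~R ^+ 2 * `|gamma h|)%:E) ->
  (1 <= k)%N ->
  let B := zsum (fun h : int => `|h|%:~R * gamma h) in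
  exists C b0 : R, forall b x, (1 <= b)%N -> b0 <= b%:R -> 0 <= x ->
    `|fine (P [set w | `|t_stat X mu k.+1 (k.+1 * b) w| <= x])
      - Psi (zsum gamma) B k.+1 (k.+1 * b) x| <= C / b%:R ^+ 2.
Proof.
move=> hgauss hstat s0 hsum k1 B.
have even := autocov_even hstat.
have [S S0 SP] := block_cov_asymptotics even hsum.
have [C [dl [C0 dl0 GE]]] := @gaussian_expansion R k.+1.
set s2 := zsum gamma in s0 SP *; rewrite -/B in SP; clearbody s2 B.
pose kp := (`|B| + S) / s2.
have kp0 : 0 <= kp by rewrite divr_ge0 ?addr_ge0// ltW.
pose C2 : R := 2 * (k.+1 ^ 2)%:R * expq k.+1 + k.+1%:R.
(* [kp / b] will bound the entries of [E]: |B| / sigma^2 comes from the first-order term, S /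
   sigma^2 from the remainder. The first summand is the quadratic error of [gaussian_expansion], the
   second that of [first_order_eval]; b >= kp / dl keeps [E] within the admissible radius. *)
exists (C * kp ^+ 2 + C2 * (S / s2)), (kp / dl) => b x b1 bk x0.
have bp : 0 < b%:R :> R by rewrite ltr0n.
have sb : 0 < s2 * b%:R by rewrite mulr_gt0.
have b1' : 1 <= b%:R :> R by rewrite ler1n.
pose c : R := (Num.sqrt (s2 * b%:R))^-1.
have c0 : 0 < c by rewrite invr_gt0 sqrtr_gt0.
have c2 : c ^+ 2 = (s2 * b%:R)^-1 by rewrite exprVn sqr_sqrtr// ltW.
have [m [a [Bm law]]] := hgauss (k.+1 * b)%N (fun i => i.+1%:Z).
have aE i := law_mean hstat law i.
have covE i j := law_cov hstat law i j.
pose G := block_mx_sum (R := R) k.+1 b c.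
pose E : 'M[R]_k.+1 := (G *m Bm) *m (G *m Bm)^T - 1%:M.
(* [e] is the coefficient of the first-order perturbation. The remainder [V] is the O(1/b) error of
   [block_cov_asymptotics] divided by sigma^2 b, hence O(1/b^2). *)
pose e := B / (s2 * b%:R).
pose V := E - e *: neighbour_mx k.+1.
pose rho := S / b%:R / (s2 * b%:R).
have Vb i j : `|V i j| <= rho.
  have VE : V i j = (block_cov gamma b i j - (if (i == j :> nat) then b%:R * s2 - B
     else if (i.+1 == j) || (j.+1 == i) then B / 2 else 0)) / (s2 * b%:R).
    have EE : E i j = (s2 * b%:R)^-1 * block_cov gamma b i j - (i == j)%:R.
      by rewrite /E mxE (block_gram c covE) c2 [X in _ + X]mxE [X in - X]mxE.
    rewrite /V mxE [X in _ + X]mxE [X in - X]mxE EE neighbour_mxE /e.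
    have bn : b%:R != 0 :> R by rewrite lt0r_neq0.
    have sn : s2 != 0 by rewrite lt0r_neq0.
    rewrite (_ : (i == j :> nat) = (i == j))//.
    case: (i == j); first by rewrite mulr1n; field; rewrite bn sn.
    by case: (_ || _); rewrite mulr0n; field; rewrite bn sn.
  rewrite VE normrM normfV (gtr0_norm sb).
  by apply: ler_wpM2r; [rewrite invr_ge0 ltW|exact: SP].
have rho_b : rho <= S / s2 / b%:R.
  have -> : rho = S / s2 / b%:R * b%:R^-1.
    by rewrite /rho; field; rewrite !lt0r_neq0.
  by apply: ler_piMr; [rewrite !mulr_ge0// invr_ge0 ltW|rewrite invf_le1].
have Eb i j : `|E i j| <= kp / b%:R.
  have -> : E = V + e *: neighbour_mx k.+1 by rewrite /V subrK.
  rewrite mxE [X in _ + X]mxE.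
  have nb : `|e * neighbour_mx k.+1 i j| <= `|B| / s2 / b%:R.
    rewrite normrM /e normrM normfV (gtr0_norm sb) -[leRHS]mulr1 invfM !mulrA.
    apply: ler_wpM2l; first by rewrite !mulr_ge0// invr_ge0 ltW.
    rewrite neighbour_mxE; case: ifP => _; first by rewrite normrN1.
    by case: ifP => _; rewrite ?normr0// ger0_norm ?invr_ge0// invf_le1 ?ler1n.
  apply: (le_trans (ler_normD _ _)); rewrite /kp mulrDl mulrDl addrC.
  by apply: lerD => //; exact: le_trans (Vb i j) rho_b.
have BE : (G *m Bm) *m (G *m Bm)^T = 1%:M + E by rewrite /E addrC subrK.
have eb : 0 <= kp / b%:R <= dl.
  apply/andP; split; first by apply: divr_ge0 => //; exact: ltW.
  by rewrite ler_pdivrMr// mulrC -ler_pdivrMr.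
have mA := @measurable_t_event R k x.
have h1 := GE m (G *m Bm) E (kp / b%:R) (t_event x) BE eb Eb mA.
have h2 := first_order_eval e k1 x0 Vb.
rewrite -/C2 (_ : e *: _ + V = E) in h2; last by rewrite /V addrC subrK.
have PE : P [set w | `|t_stat X mu k.+1 (k.+1 * b) w| <= x] =
    std_normal m [set z | t_event x (act (G *m Bm) z)].
  pose y u := act G (tadd [tuple - mu | i < k.+1 * b] u).
  have my : measurable_fun setT y.
    by apply: (measurableT_comp (measurable_act G)); exact: measurable_tadd.
  have mAy : measurable [set u | t_event x (y u)].
    by have := my measurableT _ mA; rewrite setTI.
  rewrite (_ : [set w | _] = [set w | t_event x (y (obs X (k.+1 * b) w))]); last first.
    by apply/seteqP; split => w /=; rewrite (@t_stat_ratio _ _ _ _ _ _ k b c).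
  rewrite (law _ mAy); congr (std_normal m _).
  apply/funext => z /=; congr (t_event x _); rewrite /y act_mul; congr (act G _).
  by apply: eq_from_tnth => i; rewrite !tnth_mktuple aE addrC addKr.
have a01 : fine (std_normal k.+1 (t_event x)) = fine (student k [set t : R | `|t| <= x]).
  exact: t_event_student.
rewrite PE /Psi /= -a01.
have -> : B / (2 * s2 * (k.+1 * b)%:R) = e / (2 * k.+1%:R).
  by rewrite /e natrM; field; rewrite !lt0r_neq0// ltr0n.
have rE : rho = S / s2 / b%:R ^+ 2 by rewrite /rho; field; rewrite !lt0r_neq0.
move: h1 h2; rewrite rE; set p := fine _; set f := first_order _ _; set q := _ - _ * Upsilon _ _.
move=> h1 h2; have -> : p - q = (p - f) + (f - q) by ring.
apply: (le_trans (ler_normD _ _)).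
have -> : (C * kp ^+ 2 + C2 * (S / s2)) / b%:R ^+ 2 =
    C * (kp / b%:R) ^+ 2 + C2 * (S / s2 / b%:R ^+ 2).
  by field; rewrite !lt0r_neq0.
exact: lerD.
Qed.


Theorem theorem2p1 (R : realType) (d : measure_display)
    (Omega : measurableType d) (P : probability Omega R)
    (X : int -> {RV P >-> R}) (mu mu0 : R) (gamma : int -> R) (K : nat)
    (hgauss : gaussian_series X)
    (hstat : stationary_with X mu gamma)
    (hsigma : 0 < zsum gamma)
    (hsum : summable [set: int] (fun h : int => (h%:~R ^+ 2 * `|gamma h|)%:E))
    (hK : (2 <= K)%N)
    (H0 : mu = mu0) :
  let sigma2 := zsum gamma in
  let B := zsum (fun h : int => `|h|%:~R * gamma h) in
  exists C : R, \forall T \near within [set T : nat | equal_groups K T] \oo,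
    (ereal_sup ([set `|fine (P [set w | `|t_stat X mu0 K T w| <= x])
                      - Psi sigma2 B K T x|%:E | x in `[0, +oo[ ])%R
     <= (C / T%:R ^+ 2)%:E)%E.
Proof.
move=> sigma2 B; rewrite -H0.
case: K hK => // k k1.
have [C [b0 H]] := t_stat_expansion hgauss hstat hsigma hsum k1.
(* The factor K^2 turns 1/b^2 into 1/T^2, and T >= b0 K ensures b >= b0. *)
exists (C * k.+1%:R ^+ 2); rewrite near_withinE; near=> T => eqT.
have T0 : (0 < T)%N by near: T; exact: nbhs_infty_gt.
have Tb : b0 * k.+1%:R <= T%:R by near: T; exact: nbhs_infty_ger.
have [b TE] := equal_groups_dvd k1 eqT.
have b1 : (1 <= b)%N by move: T0; rewrite TE muln_gt0 => /andP[].
have Kp : 0 < k.+1%:R :> R by rewrite ltr0n.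
have bb : b0 <= b%:R by rewrite -(ler_pM2r Kp) -natrM mulnC -TE.
apply: ge_ereal_sup => _ [x x0 <-]; rewrite lee_fin TE.
have {}x0 : 0 <= x by move: x0; rewrite /= in_itv/= andbT.
apply: (le_trans (H b x b1 bb x0)); rewrite natrM exprMn.
rewrite le_eqVlt; apply/orP; left; apply/eqP.
by field; rewrite !lt0r_neq0// ltr0n.
Unshelve. all: by end_near. Qed.
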